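(* Let $A$ be a noetherian AS Gorenstein algebra of type $(d,\mathfrak l)$. Suppose there is a $\xi\in\mathbb{R}$ such that $$\deg\mathrm{Tor}^A_i(k,k)\le \xi i+\mathfrak l-\xi d$$ for all $i\ge0$. Then $A$ is AS regular.
   Context: $k$ is a field. A connected graded algebra is an $\mathbb{N}$-graded $k$-algebra $A=\bigoplus_{i\ge 0}A_i$ with $A_0=k$; $k$ also denotes the graded $A$-bimodule $A/A_{\ge1}$. Noetherian means left and right noetherian. $M(\ell)_m=M_{m+\ell}$ for a graded module $M$. For a $\mathbb{Z}$-graded vector space $M$, $\deg(M)=\sup\{j\mid M_j\ne0\}$, with $\deg(0)=-\infty$. A connected graded algebra $T$ is Artin--Schelter (AS) Gorenstein of type $(d,\mathfrak l)$ if (a) $T$ has injective dimension $d<\infty$ on the left and on the right; (b) $\mathrm{Ext}^i_T({}_Tk,{}_TT)=\mathrm{Ext}^i_T(k_T,T_T)=0$ for all $i\ne d$; (c) $\mathrm{Ext}^d_T({}_Tk,{}_TT)\cong\mathrm{Ext}^d_T(k_T,T_T)\cong k(\mathfrak l)$ for some integer $\mathfrak l$. If in addition $T$ has finite global dimension and finite Gelfand--Kirillov dimension, $T$ is AS regular. *)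

(* Defs.v *)
From HB Require Import structures.
From mathcomp Require Import all_boot all_order all_algebra.
From mathcomp Require Import boolp classical_sets functions reals ereal sequences exp.
From mathcomp Require Import generic_quotient ring_quotient.
From mathcomp.multinomials Require Import freeg.

Set Implicit Arguments.
Unset Strict Implicit.
Unset Printing Implicit Defensive.

Import GRing.Theory.

Local Open Scope classical_set_scope.
Local Open Scope ring_scope.
Local Open Scope quotient_scope.

(* All graded objects are internally graded: a grading of V is a family G of
   subsets of V (the homogeneous components).  A right A-module is a left
   module over the converse algebra A^c (opp_alg A for graded algebras).  Graded
   vector spaces over k, such as Ext and Tor, are given by their components. *)

Section SubQuotient.
Variables (R : nzRingType) (V : lmodType R).

Section Sub.
Variable S : submodClosed V.

Record submod : Type := Submod { submod_val : V; submodP : submod_val \in S }.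

HB.instance Definition _ := [isSub for submod_val].
HB.instance Definition _ := [Choice of submod by <:].
HB.instance Definition _ := [SubChoice_isSubLmodule of submod by <:].

(* submodClosed does not record that S is closed under opposite, which the
   library's quotient needs *)
Definition zpred : {pred V} := fun x => x \in S.
Fact zpred_zmod_closed : zmod_closed zpred.
Proof. exact: GRing.submod_closedB (GRing.submodClosedP S). Qed.
HB.instance Definition _ := GRing.isZmodClosed.Build V zpred zpred_zmod_closed.

Definition lquot : Type := @Quotient.quot V zpred.
HB.instance Definition _ := GRing.Zmodule.on lquot.

Definition lquot_pi (x : V) : lquot := \pi_(@Quotient.quot V zpred) x.

Lemma lquot_piP x y : reflect (lquot_pi x = lquot_pi y) (x - y \in S).
Proof.
have -> : (x - y \in S) = (x - y \in zpred) by [].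
by rewrite Quotient.idealrBE; apply: eqP.
Qed.

Lemma lquot_piD x y : lquot_pi (x + y) = lquot_pi x + lquot_pi y.
Proof. by rewrite /lquot_pi [LHS]raddfD. Qed.

Definition lquot_scale (a : R) (q : lquot) : lquot :=
  lquot_pi (a *: repr (q : (@Quotient.quot V zpred))).

Lemma lquot_reprK (q : lquot) : lquot_pi (repr (q : (@Quotient.quot V zpred))) = q.
Proof. exact: reprK. Qed.

Lemma lquot_scale_pi a x : lquot_scale a (lquot_pi x) = lquot_pi (a *: x).
Proof.
apply/lquot_piP; rewrite -scalerBr rpredZ //; apply/lquot_piP.
exact: lquot_reprK.
Qed.

Fact lquot_scaleA a b q :
  lquot_scale a (lquot_scale b q) = lquot_scale (a * b) q.
Proof. by rewrite -[q]lquot_reprK !lquot_scale_pi scalerA. Qed.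

Fact lquot_scale1 : left_id 1 lquot_scale.
Proof. by move=> q; rewrite -[q]lquot_reprK lquot_scale_pi scale1r. Qed.

Fact lquot_scaleDr : right_distributive lquot_scale +%R.
Proof.
move=> a p q; rewrite -[p]lquot_reprK -[q]lquot_reprK.
by rewrite -lquot_piD !lquot_scale_pi scalerDr lquot_piD.
Qed.

Fact lquot_scaleDl q : {morph lquot_scale^~ q : a b / a + b}.
Proof.
by move=> a b; rewrite -[q]lquot_reprK !lquot_scale_pi scalerDl lquot_piD.
Qed.

HB.instance Definition _ := GRing.Zmodule_isLmodule.Build R lquot
  lquot_scaleA lquot_scale1 lquot_scaleDr lquot_scaleDl.

Fact lquot_pi_linear : linear lquot_pi.
Proof. by move=> a x y; rewrite lquot_piD -lquot_scale_pi. Qed.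
HB.instance Definition _ := GRing.isLinear.Build R V lquot _ lquot_pi
  lquot_pi_linear.

End Sub.

Definition lspan (G : set V) : {pred V} := fun x =>
  `[< exists2 s : seq (R * V), (forall p, p \in s -> G p.2) &
        x = \sum_(p <- s) p.1 *: p.2 >].

Lemma mem_lspan (G : set V) x : G x -> x \in lspan G.
Proof.
move=> Gx; apply/asboolP; exists [:: (1, x)]; last by rewrite big_seq1 scale1r.
by move=> p; rewrite inE => /eqP->.
Qed.

Fact lspan_submod_closed (G : set V) : submod_closed (lspan G).
Proof.
split; first by apply/asboolP; exists [::]; rewrite ?big_nil.
move=> a x y /asboolP[s sG ->] /asboolP[t tG ->]; apply/asboolP.
exists ([seq (a * p.1, p.2) | p <- s] ++ t) => [p|].
  by rewrite mem_cat => /orP[/mapP[q qs ->]|/tG //]; apply: (sG q).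
rewrite big_cat big_map scaler_sumr; congr (_ + _).
by apply: eq_bigr => p _; rewrite scalerA.
Qed.
HB.instance Definition _ (G : set V) :=
  GRing.isSubmodClosed.Build R V (lspan G) (lspan_submod_closed G).

End SubQuotient.

Section LinearMaps.
Variables (R : nzRingType).

Definition lker (U V : lmodType R) (f : {linear U -> V}) : {pred U} :=
  fun x => f x == 0.

Fact lker_submod_closed (U V : lmodType R) (f : {linear U -> V}) :
  submod_closed (lker f).
Proof.
split; first by rewrite unfold_in linear0.
move=> a x y; rewrite !unfold_in => /eqP fx /eqP fy.
by rewrite linearP fx fy scaler0 addr0.
Qed.
HB.instance Definition _ (U V : lmodType R) (f : {linear U -> V}) :=
  GRing.isSubmodClosed.Build R U (lker f) (lker_submod_closed f).

Section Restrict.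
Variables (U V : lmodType R) (S : submodClosed U) (T : submodClosed V).
Variables (f : {linear U -> V}) (fST : forall x, x \in S -> f x \in T).

Definition submod_map (x : submod S) : submod T := Submod (fST (submodP x)).

Fact submod_map_linear : linear submod_map.
Proof. by move=> a x y; apply: val_inj; rewrite /= linearP. Qed.
HB.instance Definition _ := GRing.isLinear.Build R (submod S) (submod T) _
  submod_map submod_map_linear.
End Restrict.

Section Factor.
Variables (U V : lmodType R) (S : submodClosed U).
Variables (f : {linear U -> V}) (fS : forall x, x \in S -> f x = 0).

(* fS is not used in the body, but makes lquot_map well defined and linear *)
Definition lquot_map of (forall x, x \in S -> f x = 0) : lquot S -> V :=
  fun q => f (repr (q : @Quotient.quot _ (zpred S))).

Lemma lquot_map_pi x : lquot_map fS (lquot_pi S x) = f x.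
Proof.
apply/eqP; rewrite -subr_eq0 -linearB; apply/eqP/fS/lquot_piP.
exact: lquot_reprK.
Qed.

Fact lquot_map_linear : linear (lquot_map fS).
Proof.
move=> a p q; rewrite -[p]lquot_reprK -[q]lquot_reprK -linearP.
by rewrite !lquot_map_pi linearP.
Qed.
HB.instance Definition _ := GRing.isLinear.Build R (lquot S) V _
  (lquot_map fS) lquot_map_linear.
End Factor.

Variables (K : choiceType) (M : lmodType R) (g : K -> M).

HB.instance Definition _ := GRing.isZmodMorphism.Build {freeg K / R} M
  (@fglift R M K g) (lift_is_additive g).

Fact fglift_scalable : scalable (@fglift R M K g).
Proof.
move=> a x; rewrite -[x in RHS]freeg_sumE !raddf_sum /=.
by apply: eq_bigr => z _; rewrite !liftU scalerA.
Qed.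
HB.instance Definition _ := GRing.isScalable.Build R {freeg K / R} M _
  (@fglift R M K g) fglift_scalable.

End LinearMaps.

(* the homology at V of U --f--> V --g--> W, that is ker g / im f *)

Section Homology.
Variables (R : nzRingType) (U V W : lmodType R).
Variables (f : {linear U -> V}) (g : {linear V -> W}).

Definition boundary : {pred submod (lker g)} :=
  fun x => `[< exists u, val x = f u >].

Fact boundary_submod_closed : submod_closed boundary.
Proof.
split; first by apply/asboolP; exists 0; rewrite linear0.
move=> a x y /asboolP[u xu] /asboolP[v yv]; apply/asboolP.
by exists (a *: u + v); rewrite !linearP /= xu yv.
Qed.
HB.instance Definition _ :=
  GRing.isSubmodClosed.Build R _ boundary boundary_submod_closed.

Definition homology : lmodType R := lquot boundary.

End Homology.

Section Restriction.
Variables (k : fieldType) (A : algType k).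

Definition restr (M : lmodType A) : Type := M.
HB.instance Definition _ (M : lmodType A) := GRing.Zmodule.on (restr M).

Section Scale.
Variable M : lmodType A.
Definition restr_scale (c : k) (m : restr M) : restr M := c%:A *: (m : M).
Fact restr_scaleA a b m :
  restr_scale a (restr_scale b m) = restr_scale (a * b) m.
Proof. by rewrite /restr_scale scalerA -scalerAl mul1r scalerA. Qed.
Fact restr_scale1 : left_id 1 restr_scale.
Proof. by move=> m; rewrite /restr_scale !scale1r. Qed.
Fact restr_scaleDr : right_distributive restr_scale +%R.
Proof. by move=> a x y; rewrite /restr_scale scalerDr. Qed.
Fact restr_scaleDl m : {morph restr_scale^~ m : a b / a + b}.
Proof. by move=> a b; rewrite /restr_scale !scalerDl. Qed.
HB.instance Definition _ := GRing.Zmodule_isLmodule.Build k (restr M)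
  restr_scaleA restr_scale1 restr_scaleDr restr_scaleDl.
End Scale.

HB.instance Definition _ := GRing.Lmodule.copy A^c A.
Fact converse_scaleAl (c : k) (x y : A^c) :
  c *: (x * y : A^c) = (c *: x : A^c) * y :> A^c.
Proof. exact (@scalerAr k A c y x). Qed.
HB.instance Definition _ :=
  GRing.Lmodule_isLalgebra.Build k A^c converse_scaleAl.
Fact converse_scaleAr (c : k) (x y : A^c) :
  c *: (x * y : A^c) = x * (c *: y : A^c) :> A^c.
Proof. exact (@scalerAl k A c y x). Qed.
HB.instance Definition _ :=
  GRing.Lalgebra_isAlgebra.Build k A^c converse_scaleAr.
End Restriction.

Definition homog_sum (I : eqType) (V : zmodType) (G : I -> set V) (x : V) :=
  exists2 s : seq (I * V), (forall p, p \in s -> G p.1 p.2) &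
    x = \sum_(p <- s) p.2.

(* V is the direct sum of the subgroups G i *)
Definition is_grading (I : eqType) (V : zmodType) (G : I -> set V) : Prop :=
  [/\ forall i, G i 0,
      forall i x y, G i x -> G i y -> G i (x - y),
      forall x, homog_sum G x
    & forall (s : seq I) (f : I -> V), uniq s -> (forall i, G i (f i)) ->
        \sum_(i <- s) f i = 0 -> forall i, i \in s -> f i = 0].

Section GradingTheory.
Variables (I : eqType) (V : zmodType) (G : I -> set V).

Lemma homog_sum1 i x : G i x -> homog_sum G x.
Proof.
move=> Gx; exists [:: (i, x)]; last by rewrite big_seq1.
by move=> p; rewrite inE => /eqP->.
Qed.

Lemma homog_sumD x y : homog_sum G x -> homog_sum G y -> homog_sum G (x + y).
Proof.
move=> [s sG ->] [t tG ->]; exists (s ++ t); last by rewrite big_cat.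
by move=> p; rewrite mem_cat => /orP[/sG|/tG].
Qed.

Lemma homog_sum_big (J : eqType) (r : seq J) (F : J -> V) :
  (forall j, j \in r -> homog_sum G (F j)) -> homog_sum G (\sum_(j <- r) F j).
Proof.
elim: r => [_|j r IHr Fr]; first by rewrite big_nil; exists [::]; rewrite ?big_nil.
rewrite big_cons; apply: homog_sumD; first exact/Fr/mem_head.
by apply: IHr => l lr; apply: Fr; rewrite inE lr orbT.
Qed.

Hypothesis gG : is_grading G.

Lemma grading0 i : G i 0. Proof. by case: gG. Qed.
Lemma gradingB i x y : G i x -> G i y -> G i (x - y).
Proof. by case: gG => _ GB _ _; apply: GB. Qed.
Lemma gradingN i x : G i x -> G i (- x).
Proof. by rewrite -sub0r; apply/gradingB/grading0. Qed.
Lemma gradingD i x y : G i x -> G i y -> G i (x + y).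
Proof. by move=> Gx Gy; rewrite -[y]opprK; apply/gradingB/gradingN. Qed.
Lemma grading_sum i (J : eqType) (r : seq J) (P : pred J) (F : J -> V) :
  (forall j, j \in r -> P j -> G i (F j)) -> G i (\sum_(j <- r | P j) F j).
Proof.
move=> GF; rewrite big_seq_cond; elim/big_ind: _ => [||j /andP[]].
- exact: grading0.
- exact: gradingD.
- exact: GF.
Qed.

Lemma grading_dec x : exists s (f : I -> V),
  [/\ uniq s, forall i, G i (f i) & x = \sum_(i <- s) f i].
Proof.
case: gG => _ _ /(_ x)[s sG ->] _.
exists (undup (map fst s)), (fun i => \sum_(p <- s | p.1 == i) p.2).
split; first exact: undup_uniq.
  by move=> i; apply: grading_sum => p /sG + /eqP <-.
rewrite (exchange_big_dep xpredT) //= [LHS]big_seq [RHS]big_seq.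
apply: eq_bigr => p ps; rewrite -big_filter.
rewrite (_ : [seq i <- undup (map fst s) | p.1 == i] = [:: p.1]) ?big_seq1 //.
have p1s : p.1 \in undup (map fst s) by rewrite mem_undup map_f.
rewrite (eq_filter (a2 := pred1 p.1)); last by move=> i /=; rewrite eq_sym.
by rewrite filter_pred1_uniq ?undup_uniq.
Qed.

End GradingTheory.

(* cg_conn (A_0 = k) and cg_mul make every component a k-subspace *)
Record cgAlg (k : fieldType) := CGAlg {
  cg_sort :> algType k;
  cg_homog : nat -> set cg_sort;
  cg_grading : is_grading cg_homog;
  cg_mul : forall i j x y, cg_homog i x -> cg_homog j y ->
    cg_homog (i + j)%N (x * y);
  cg_conn : forall x, cg_homog 0%N x <-> exists c : k, x = c%:A
}.

Section Opposite.
Variables (k : fieldType) (A : cgAlg k).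

Fact opp_mul i j (x y : A^c) : cg_homog i (x : A) -> cg_homog j (y : A) ->
  cg_homog (i + j)%N (x * y : A^c).
Proof. by move=> xi yj; rewrite addnC; apply: cg_mul yj xi. Qed.

Fact opp_conn (x : A^c) : cg_homog 0 (x : A) <-> exists c : k, x = c%:A.
Proof. exact: cg_conn. Qed.

Definition opp_alg : cgAlg k :=
  @CGAlg k A^c (@cg_homog k A) (@cg_grading k A) opp_mul opp_conn.

End Opposite.

Section GradedModules.
Variables (k : fieldType) (A : cgAlg k).

(* the Z-grading of A, with A_i = 0 for i < 0 *)
Definition zhomog (i : int) : set A :=
  match i with Posz n => cg_homog n | Negz _ => [set 0] end.

Lemma zhomog0 i : zhomog i 0.
Proof. by case: i => // n; apply: (grading0 (@cg_grading k A)). Qed.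

Lemma zhomog_mul i j x y : zhomog i x -> zhomog j y -> zhomog (i + j) (x * y).
Proof.
move=> xi yj; case: i xi => [i|i] xi; last first.
  by rewrite (xi : x = 0) mul0r; apply: zhomog0.
case: j yj => [j|j] yj; first exact: cg_mul.
by rewrite (yj : y = 0) mulr0; apply: zhomog0.
Qed.

Lemma zhomog_grading : is_grading zhomog.
Proof.
have gA := @cg_grading k A; split.
- exact: zhomog0.
- case=> i x y xi yi; first exact: (gradingB gA).
  by rewrite (xi : x = 0) (yi : y = 0) subr0.
- move=> x; have [s [f [_ fG ->]]] := grading_dec gA x.
  apply: homog_sum_big => i _; apply: (@homog_sum1 _ _ _ (Posz i)).
  exact: fG.
- move=> s f us fG sf0 i si; case: i si => [i|i] si; last exact: (fG (Negz i)).
  pose t := pmap (fun j : int => if j is Posz n then Some n else None) s.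
  have ut : uniq t.
    apply: (@pmap_uniq _ _ _ Posz) us => //.
    by case=> n /=.
  have ti : i \in t by rewrite mem_pmap; apply/mapP; exists (Posz i).
  case: gA => _ _ _ /(_ t (f \o Posz) ut); apply => //.
    by move=> n; exact: (fG (Posz n)).
  rewrite -[RHS]sf0 /t; elim: (s) => [|[n|n] r IHr] /=.
  + by rewrite !big_nil.
  + by rewrite !big_cons IHr.
  + by rewrite big_cons IHr (fG (Negz n) : f (Negz n) = 0) add0r.
Qed.

Record grMod := GrMod {
  gm_sort :> lmodType A;
  gm_homog : int -> set gm_sort;
  gm_grading : is_grading gm_homog;
  gm_act : forall i j a x, cg_homog i a -> gm_homog j x ->
    gm_homog (i%:Z + j) (a *: x)
}.

Definition reg_mod : grMod :=
  @GrMod A^o zhomog zhomog_grading (fun i j a x ai xj =>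
    zhomog_mul (ai : zhomog i a) xj).

(* triv_mod is k = A / A_{>=1}; pos_part is A_{>=1} *)

Definition pos_part : {pred A^o} := fun x =>
  `[< exists2 s : seq (nat * A),
        (forall p, p \in s -> (0 < p.1)%N /\ cg_homog p.1 p.2) &
        x = \sum_(p <- s) p.2 >].

Fact pos_part_submod_closed : submod_closed pos_part.
Proof.
split; first by apply/asboolP; exists [::]; rewrite ?big_nil.
move=> a x y /asboolP[s sG ->] /asboolP[t tG ->]; apply/asboolP.
have [r [f [_ fG ->]]] := grading_dec (@cg_grading k A) a.
exists ([seq ((i + p.1)%N, f i * p.2) | i <- r, p <- s] ++ t) => [q|].
  rewrite mem_cat => /orP[/allpairsP[[i p] /= [ri /sG[p0 pG] ->]]|/tG//] /=.
  by split; [rewrite addn_gt0 p0 orbT|apply: cg_mul].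
rewrite big_cat; congr (_ + _); rewrite big_allpairs_dep scaler_suml.
by apply: eq_bigr => i _; rewrite scaler_sumr.
Qed.
HB.instance Definition _ :=
  GRing.isSubmodClosed.Build A A^o pos_part pos_part_submod_closed.

Definition triv_homog (i : int) : set (lquot pos_part) :=
  [set lquot_pi pos_part x | x in zhomog i].

Lemma pos_part_homog (i : nat) x : (0 < i)%N -> cg_homog i x -> x \in pos_part.
Proof.
move=> i0 xi; apply/asboolP; exists [:: (i, x)]; last by rewrite big_seq1.
by move=> p; rewrite inE => /eqP->.
Qed.

Fact triv_grading : is_grading triv_homog.
Proof.
have gA := zhomog_grading; split.
- by move=> i; exists 0; rewrite ?linear0 //; apply: grading0.
- move=> i _ _ [x xi <-] [y yi <-]; exists (x - y); rewrite ?linearB //.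
  exact: gradingB.
- move=> q; rewrite -[q]lquot_reprK; set x := repr _.
  have [s [f [_ fG ->]]] := grading_dec gA x.
  rewrite linear_sum; apply: homog_sum_big => i _.
  by apply: (@homog_sum1 _ _ _ i); exists (f i).
- move=> s f us fG sf0.
  have f0 i : i != 0 -> f i = 0.
    case: i (fG i) => [[//|i]|i] [x xi <-] _.
      by rewrite -(linear0 (lquot_pi pos_part)); apply/lquot_piP;
         rewrite subr0; apply: pos_part_homog xi.
    by rewrite xi linear0.
  move=> i si; have [i0|/f0//] := eqVneq i 0; rewrite {}i0 in si *.
  move: sf0; rewrite (bigD1_seq 0) //= big1 ?addr0 // => j; exact: f0.
Qed.

Fact triv_act i j a x : cg_homog i a -> triv_homog j x ->
  triv_homog (i%:Z + j) (a *: x).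
Proof.
move=> ai [y yj <-]; exists (a * y); last by rewrite -linearZ.
exact: (@zhomog_mul (Posz i)).
Qed.

Definition triv_mod : grMod := GrMod triv_grading triv_act.

Definition degree0 (M N : grMod) (f : {linear M -> N}) : Prop :=
  forall j x, gm_homog j x -> gm_homog j (f x).

Section Kernel.
Variables (M N : grMod) (f : {linear M -> N}).

Definition ker_homog (j : int) : set (submod (lker f)) :=
  [set x | gm_homog j (val x)].

Hypothesis f0 : degree0 f.

Fact ker_grading : is_grading ker_homog.
Proof.
have gM := @gm_grading M; have gN := @gm_grading N; split.
- by move=> j; apply: (grading0 gM).
- by move=> j x y; apply: (gradingB gM).
- move=> x; have [s [g [us gG xE]]] := grading_dec gM (val x).
  have fg i : i \in s -> g i \in lker f.
    move=> si; rewrite unfold_in; apply/eqP.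
    case: gN => _ _ _ /(_ s (f \o g) us); apply => //=.
      by move=> j; apply: f0.
    by rewrite -linear_sum -xE; apply/eqP/(submodP x).
  pose h i : submod (lker f) := insubd 0 (g i).
  have -> : x = \sum_(i <- s) h i.
    apply: val_inj; rewrite raddf_sum xE /= big_seq [RHS]big_seq.
    by apply: eq_bigr => i /fg gi; rewrite /h val_insubd gi.
  apply: homog_sum_big => i /fg gi; apply: (@homog_sum1 _ _ _ i).
  by rewrite /ker_homog /= /h val_insubd gi.
- move=> s g us gG sg0 i si; apply: val_inj.
  case: gM => _ _ _ /(_ s (val \o g) us); apply => //=.
  by have := congr1 val sg0; rewrite raddf_sum raddf0.
Qed.

Fact ker_act i j a x : cg_homog i a -> ker_homog j x ->
  ker_homog (i%:Z + j) (a *: x).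
Proof. exact: gm_act. Qed.

Definition gr_ker : grMod := GrMod ker_grading ker_act.

End Kernel.

(* the free A-module on the homogeneous elements of M, where the basis element
   at (j, x) has degree j *)

Section FreeCover.
Variable M : grMod.

Definition homog_elt : Type := {p : int * M | `[< gm_homog p.1 p.2 >]}.
HB.instance Definition _ := Choice.on homog_elt.

Definition free_homog (n : int) : set {freeg homog_elt / A} :=
  [set D | forall h, zhomog (n - (val h).1) (coeff h D)].

Fact free_grading : is_grading free_homog.
Proof.
have gA := zhomog_grading; split.
- by move=> n h; rewrite coeff0; apply: (grading0 gA).
- by move=> n x y xn yn h; rewrite coeffB; apply: (gradingB gA).
- move=> D; rewrite -[D]freeg_sumE; apply: homog_sum_big => h _.
  have [s [f [_ fG ->]]] := grading_dec gA (coeff h D).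
  have -> : << \sum_(i <- s) f i *g h >> = \sum_(i <- s) << f i *g h >>.
    elim: s => [|i s IHs]; first by rewrite !big_nil freegU0.
    by rewrite !big_cons -IHs freegUD.
  apply: homog_sum_big => i _.
  apply: (@homog_sum1 _ _ _ (i + (val h).1)) => l; rewrite coeffU.
  have [<-|_] := eqVneq h l; first by rewrite mulr1 addrK.
  by rewrite mulr0; apply: (grading0 gA).
- move=> s f us fG sf0 i si; apply/eqP/freeg_eqP => h; rewrite coeff0.
  pose d := (val h).1; case: gA => _ _ _.
  move=> /(_ [seq j - d | j <- s] (fun j => coeff h (f (j + d)))).
  rewrite map_inj_uniq; last exact: addIr.
  move=> /(_ us) gA; rewrite -[i](subrK d); apply: gA; last exact: map_f.
    by move=> j; have := fG (j + d) h; rewrite addrK.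
  rewrite big_map -[RHS](coeff0 _ h) -sf0 raddf_sum /=.
  by apply: eq_bigr => j _; rewrite subrK.
Qed.

Fact free_act i j a x : cg_homog i a -> free_homog j x ->
  free_homog (i%:Z + j) (a *: x).
Proof.
move=> ai xj h; rewrite coeffZ -addrA; exact: zhomog_mul (xj h).
Qed.

Definition free_cover : grMod := GrMod free_grading free_act.

Definition cover_map : {linear free_cover -> M} :=
  fglift (fun h : homog_elt => (val h).2).

Fact cover_map_degree0 : degree0 cover_map.
Proof.
move=> j x xj; have gM := @gm_grading M.
rewrite -[x]freeg_sumE raddf_sum /=; apply: (grading_sum gM) => h _ _.
rewrite liftU; have /asboolP hG := valP h.
have := xj h; case E: (j - _) => [n|n] /= ch; last first.
  by rewrite ch scale0r; apply: (grading0 gM).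
by rewrite -[j](subrK (val h).1) E; apply: gm_act.
Qed.

Lemma cover_map_surj (y : M) : exists x, cover_map x = y.
Proof.
case: (@gm_grading M) => _ _ /(_ y)[s + ->] _.
elim: s => [_|p s IHs sG]; first by exists 0; rewrite linear0 big_nil.
have [|x xs] := IHs; first by move=> q qs; apply: sG; rewrite inE qs orbT.
pose h : homog_elt := exist _ p (asboolT (sG p (mem_head p s))).
exists (<< h >> + x); rewrite linearD xs big_cons; congr (_ + _).
by rewrite /= liftU scale1r.
Qed.

End FreeCover.

(* ... -> free_res M 1 -> free_res M 0 -> M -> 0 is the functorial free
   resolution of M: free_res M n covers the n-th syzygy (see res_exact) *)

Fixpoint syzygy (n : nat) (M : grMod) : grMod :=
  if n is n'.+1 then gr_ker (@cover_map_degree0 (syzygy n' M)) else M.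

Definition free_res (M : grMod) (n : nat) : grMod := free_cover (syzygy n M).

Definition res_diff (M : grMod) (n : nat) :
    {linear free_res M n.+1 -> free_res M n} :=
  (val : submod (lker (cover_map (syzygy n M))) -> _) \o
    cover_map (syzygy n.+1 M).

Fact res_diff_degree0 (M : grMod) n : degree0 (res_diff M n).
Proof. by move=> j x /cover_map_degree0. Qed.

Lemma res_exact0 (M : grMod) (y : free_res M 0) :
  cover_map M y = 0 <-> exists x, res_diff M 0 x = y.
Proof.
split=> [y0|[x <-]]; last exact/eqP/(submodP (cover_map (syzygy 1 M) x)).
have yk : y \in lker (cover_map M) by rewrite unfold_in y0.
have [x xy] := @cover_map_surj (syzygy 1 M) (Submod yk).
by exists x; rewrite /res_diff /= xy.
Qed.

Lemma res_exact (M : grMod) n (y : free_res M n.+1) :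
  res_diff M n y = 0 <-> exists x, res_diff M n.+1 x = y.
Proof.
have e (z : syzygy n.+2 M) : cover_map (syzygy n.+1 M) (val z) = 0.
  exact/eqP/(submodP z).
split=> [y0|[x <-]]; last first.
  by rewrite /res_diff /= e.
have yk : y \in lker (cover_map (syzygy n.+1 M)).
  by rewrite unfold_in; apply/eqP/val_inj.
have [x xy] := @cover_map_surj (syzygy n.+2 M) (Submod yk).
by exists x; rewrite /res_diff /= xy.
Qed.

End GradedModules.

(* A graded vector space over k, given by its components *)
Definition grVect (k : fieldType) : Type := int -> lmodType k.

Section Ext.
Variables (k : fieldType) (A : cgAlg k).

(* A-linear maps M -> N of degree n, that is degree 0 maps M -> N(n) *)
Definition hom_pred (M N : grMod A) (n : int) : {pred M -> restr N} := fun f =>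
  `[< (forall a x y, f (a *: x + y) = a *: (f x : N) + (f y : N)) /\
      forall j x, gm_homog j x -> gm_homog (j + n) (f x : N) >].

Fact hom_pred_submod_closed M N n : submod_closed (@hom_pred M N n).
Proof.
have gN := @gm_grading _ _ N; split.
  apply/asboolP; split=> [a x y|j x _]; first by rewrite scaler0 addr0.
  exact: (grading0 gN).
move=> c f g /asboolP[fl fh] /asboolP[gl gh]; apply/asboolP; split.
  move=> a x y; have E z : (c *: f + g) z = c%:A *: (f z : N) + (g z : N) by [].
  have ca : c%:A * a = a * c%:A by rewrite -scalerAl mul1r -scalerAr mulr1.
  by rewrite !E fl gl !scalerDr !scalerA ca addrACA.
move=> j x xj; apply: (gradingD gN); last exact: gh.
rewrite -[j + n]add0r; apply: (@gm_act _ _ _ 0%N); last exact: fh.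
by apply/cg_conn; exists c.
Qed.
HB.instance Definition _ (M N : grMod A) n := GRing.isSubmodClosed.Build k
  (M -> restr N) (@hom_pred M N n) (@hom_pred_submod_closed M N n).

Definition grHom (M N : grMod A) (n : int) : lmodType k :=
  submod (@hom_pred M N n).

Section Pullback.
Variables (M M' N : grMod A) (f : {linear M' -> M}) (f0 : degree0 f) (n : int).

Definition precomp (g : M -> restr N) : M' -> restr N := g \o f.
Fact precomp_linear : linear precomp. Proof. by []. Qed.
HB.instance Definition _ := GRing.isLinear.Build k (M -> restr N)
  (M' -> restr N) _ precomp precomp_linear.

Fact precomp_hom g : g \in @hom_pred M N n -> precomp g \in @hom_pred M' N n.
Proof.
move=> /asboolP[gl gh]; apply/asboolP; split=> [a x y|j x xj].
  by rewrite /precomp /= linearP gl.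
by apply: gh; apply: f0.
Qed.

Definition pullback : {linear grHom M N n -> grHom M' N n} :=
  submod_map precomp_hom.
End Pullback.

(* Ext^i_A(M, N), whose component of degree n is the i-th cohomology of
   the complex of homomorphisms of degree n from a free resolution of M to N *)
Definition Ext (M N : grMod A) (i : nat) : grVect k := fun n =>
  let d j := @pullback _ _ N _ (@res_diff_degree0 _ _ M j) n in
  if i is j.+1 then homology (d j) (d j.+1)
  else homology (\0 : {linear grHom M N n -> grHom (free_res M 0) N n}) (d 0%N).

End Ext.

Section Tensor.
Variables (k : fieldType) (A : cgAlg k).

Section TensorProduct.
Variables (M : grMod (opp_alg A)) (N : grMod A).

(* m a, for the right A-module M *)
Definition ract (m : M) (a : A) : M := (a : opp_alg A) *: m.

Definition tensor_rel : set {freeg (M * N)%type / k} := [set x |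
  [\/ exists m m' n, x = << (m + m', n) >> - << (m, n) >> - << (m', n) >>,
      exists m n n', x = << (m, n + n') >> - << (m, n) >> - << (m, n') >>,
      exists m a n, x = << (ract m a, n) >> - << (m, a *: n) >>
    | exists c m n, x = << (ract m c%:A, n) >> - << c *g (m, n) >> ]].

Definition tensor : lmodType k := lquot (lspan tensor_rel).

Definition tens (m : M) (n : N) : tensor := lquot_pi (lspan tensor_rel) << (m, n) >>.

Definition tensor_homog (j : int) : {pred tensor} := lspan
  [set t | exists a b m n,
    [/\ gm_homog a m, gm_homog b n, a + b = j & t = tens m n]].
HB.instance Definition _ j := GRing.SubmodClosed.on (tensor_homog j).

(* The component of degree j of M (x)_A N *)
Definition grTensor (j : int) : lmodType k := submod (tensor_homog j).

End TensorProduct.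

Section TensorMap.
Variables (M : grMod (opp_alg A)) (N N' : grMod A) (f : {linear N -> N'}).

Definition tensor_pre : {linear {freeg (M * N)%type / k} -> tensor M N'} :=
  fglift (fun p : M * N => tens p.1 (f p.2)).

Lemma tensor_preE m n : tensor_pre << (m, n) >> = tens m (f n).
Proof. by rewrite /= liftU scale1r. Qed.

Lemma tens_rel0 (x : {freeg (M * N')%type / k}) :
  tensor_rel x -> lquot_pi (lspan (@tensor_rel M N')) x = 0.
Proof.
move=> xR; rewrite -(linear0 (lquot_pi (lspan (@tensor_rel M N')))).
by apply/lquot_piP; rewrite subr0; apply: mem_lspan.
Qed.

Fact tensor_pre0 x : x \in lspan (@tensor_rel M N) -> tensor_pre x = 0.
Proof.
move=> /asboolP[s sR ->]; rewrite linear_sum big_seq big1 // => p /sR pR.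
rewrite linearZ_LR; suff -> : tensor_pre p.2 = 0 by rewrite scaler0.
case: pR => [[m [m' [n ->]]]|[m [n [n' ->]]]|[m [a [n ->]]]|[c [m [n ->]]]].
- rewrite 2!linearB !tensor_preE -!linearB; apply: tens_rel0.
  by constructor 1; exists m, m', (f n).
- rewrite 2!linearB !tensor_preE linearD -!linearB; apply: tens_rel0.
  by constructor 2; exists m, (f n), (f n').
- rewrite linearB !tensor_preE linearZ_LR -linearB; apply: tens_rel0.
  by constructor 3; exists m, a, (f n).
- have -> : << c *g (m, n) >> = c *: << (m, n) >> :> {freeg (M * N)%type / k}.
    apply/eqP/freeg_eqP => p'; rewrite coeffZ !coeffU.
    by rewrite mul1r.
  rewrite linearB linearZ_LR !tensor_preE -linearZ_LR -linearB.
  have -> : c *: << (m, f n) >> = << c *g (m, f n) >>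
      :> {freeg (M * N')%type / k}.
    by apply/eqP/freeg_eqP => p'; rewrite coeffZ !coeffU mul1r.
  by apply: tens_rel0; constructor 4; exists c, m, (f n).
Qed.

(* id_M (x) f *)
Definition tensor_map : {linear tensor M N -> tensor M N'} :=
  lquot_map tensor_pre0.

Lemma tensor_mapE m n : tensor_map (tens m n) = tens m (f n).
Proof. exact: etrans (lquot_map_pi tensor_pre0 _) (tensor_preE m n). Qed.

Hypothesis f0 : degree0 f.

Fact tensor_map_homog j x :
  x \in @tensor_homog M N j -> tensor_map x \in @tensor_homog M N' j.
Proof.
move=> /asboolP[s sG ->]; rewrite linear_sum big_seq.
apply: rpred_sum => p /sG[a [b [m [n [ma nb ab ->]]]]].
rewrite linearZ_LR rpredZ // tensor_mapE; apply: mem_lspan.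
by exists a, b, m, (f n); split=> //; apply: f0.
Qed.

Definition grTensor_map j : {linear grTensor M N j -> grTensor M N' j} :=
  submod_map (@tensor_map_homog j).

End TensorMap.

(* Tor_i^A(M, N), graded by total degree *)
Definition Tor (M : grMod (opp_alg A)) (N : grMod A) (i : nat) : grVect k := fun n =>
  let d j := @grTensor_map M _ _ _ (@res_diff_degree0 _ _ N j) n in
  if i is j.+1 then homology (d j.+1) (d j)
  else homology (d 0%N)
    (\0 : {linear grTensor M (free_res N 0) n -> grTensor M (free_res N 0) n}).

End Tensor.

Section GradedVectorSpaces.
Variable k : fieldType.

Definition gr_shift (V : grVect k) (l : int) : grVect k := fun m => V (m + l).

Definition gr_unit : grVect k := fun j => 
  if j == 0 then (k^o : lmodType k) else ('rV[k]_0 : lmodType k).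

Definition gr_isom (V W : grVect k) : Prop :=
  forall j, exists f : {linear V j -> W j}, bijective f.

Definition gr_zero (V : grVect k) : Prop := forall j (x : V j), x = 0.

(* deg V = sup {j | V_j <> 0}, which is -oo when V = 0 *)
Definition gr_deg (R : realType) (V : grVect k) : \bar R :=
  ereal_sup [set (j%:~R)%:E | j in [set j : int | exists x : V j, x <> 0]].

End GradedVectorSpaces.

Section RingTheory.
Variable R : nzRingType.

Definition left_ideal (I : set R) : Prop :=
  [/\ I 0, forall x y, I x -> I y -> I (x + y) & forall a x, I x -> I (a * x)].

Definition left_noetherian : Prop :=
  forall I : nat -> set R, (forall n, left_ideal (I n)) ->
    (forall n, I n `<=` I n.+1) -> exists N, forall n, (N <= n)%N -> I n = I N.

Definition injective_module (E : lmodType R) : Prop :=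
  forall (X Y : lmodType R) (i : {linear X -> Y}) (f : {linear X -> E}),
    injective i -> exists g : {linear Y -> E}, forall x, g (i x) = f x.

Definition projective_module (P : lmodType R) : Prop :=
  forall (X Y : lmodType R) (p : {linear X -> Y}) (f : {linear P -> Y}),
    (forall y, exists x, p x = y) ->
    exists g : {linear P -> X}, forall x, p (g x) = f x.

Definition exact_at (X Y Z : lmodType R) (f : {linear X -> Y})
    (g : {linear Y -> Z}) : Prop :=
  forall y, g y = 0 <-> exists x, f x = y.

(* there is an injective resolution 0 -> M -> E 0 -> ... -> E n -> 0 *)
Definition injdim_le (M : lmodType R) (n : nat) : Prop :=
  exists (E : nat -> lmodType R) (e : {linear M -> E 0%N})
         (d : forall i, {linear E i -> E i.+1}),
    [/\ forall i, injective_module (E i),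
        injective e,
        exact_at e (d 0%N),
        forall i, exact_at (d i) (d i.+1)
      & forall i, (n < i)%N -> forall x : E i, x = 0].

Definition injdim_eq (M : lmodType R) (n : nat) : Prop :=
  injdim_le M n /\ forall m, (m < n)%N -> ~ injdim_le M m.

(* there is a projective resolution 0 -> P n -> ... -> P 0 -> M -> 0 *)
Definition projdim_le (M : lmodType R) (n : nat) : Prop :=
  exists (P : nat -> lmodType R) (e : {linear P 0%N -> M})
         (d : forall i, {linear P i.+1 -> P i}),
    [/\ forall i, projective_module (P i),
        forall x, exists y, e y = x,
        exact_at (d 0%N) e,
        forall i, exact_at (d i.+1) (d i)
      & forall i, (n < i)%N -> forall x : P i, x = 0].

Definition finite_left_gldim : Prop :=
  exists n, forall M : lmodType R, projdim_le M n.

End RingTheory.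

Definition noetherian (R : nzRingType) : Prop :=
  left_noetherian R /\ left_noetherian R^c.

Definition finite_gldim (R : nzRingType) : Prop :=
  finite_left_gldim R /\ finite_left_gldim R^c.

Section GKdim.
Variables (k : fieldType) (A : algType k).

Definition lin_free (s : seq A) : Prop :=
  forall c : 'I_(size s) -> k,
    \sum_(i < size s) c i *: s`_i = 0 -> forall i, c i = 0.

(* the dimension of the span of s *)
Definition span_dim (s : seq A) : nat :=
  \max_(m : (size s).-tuple bool | `[< lin_free (mask m s) >])
    size (mask m s).

(* the products of at most n elements of s *)
Fixpoint words (s : seq A) (n : nat) : seq A :=
  if n is n'.+1 then words s n' ++ [seq x * w | x <- s, w <- words s n']
  else [:: 1].

(* sup over the finite-dimensional subspaces V = span s of
   limsup_n log_n dim (k + V + ... + V^n) *)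
Definition GKdim (R : realType) : \bar R :=
  ereal_sup [set limn_esup (fun n : nat =>
    (ln (span_dim (words s n))%:R / ln n%:R)%:E) | s in [set: seq A]].

End GKdim.

Section ArtinSchelter.
Variables (k : fieldType) (A : cgAlg k).

(* the conditions on the left module A; those on the right module A are
   the same conditions for the opposite algebra *)
Definition left_AS_Gorenstein (d : nat) (l : int) : Prop :=
  [/\ injdim_eq (A^o : lmodType A) d,
      forall i, i <> d -> gr_zero (Ext (triv_mod A) (reg_mod A) i)
    & gr_isom (Ext (triv_mod A) (reg_mod A) d) (gr_shift (gr_unit k) l)].

End ArtinSchelter.

Definition AS_Gorenstein (k : fieldType) (A : cgAlg k) (d : nat) (l : int) :
    Prop :=
  left_AS_Gorenstein A d l /\ left_AS_Gorenstein (opp_alg A) d l.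

Definition AS_regular (R : realType) (k : fieldType) (A : cgAlg k) : Prop :=
  (exists d l, AS_Gorenstein A d l) /\ finite_gldim A /\
  (GKdim A R < +oo)%E.

(* Main.v *)
(* Let F and G be the minimal free resolutions of k as a left and as a right
   A-module. The complex Hom(F, A) has cohomology k(l) only in degree d, and by the
   bound at i = d the module F_d is generated in degrees at most l. Hence a cocycle z
   of degree -l in Hom(F_d, A) has scalar entries in a basis.  If G_{d+1} had a basis
   element b, then the map G_{d+1} -> k dual to b, with z as a representative of the
   generator of k(l), would lift to a map from the syzygy of k in G_d to Hom(F_d, A):
   the boundaries have a finite free resolution by the Hom(F_j, A), j < d, and
   Ext^i(k, A) = 0 for i > d on the right.  The lift extends to G_d, so by minimality
   it maps b into A_{>=1} Hom(F_d, A), whereas it equals z there up to a boundary.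
   Thus G_{d+1} = 0, and by balancing Tor also F_{d+1} = 0.

   With a finite resolution of k, graded modules bounded below have finite projective
   dimension by Nakayama's lemma, and an arbitrary module M is handled through
   0 -> M[t] -> M[t] -> M -> 0.

   Finally the Hilbert series of A is 1/q for an integer polynomial q.  A noetherian
   algebra has subexponential growth, so the roots of q have norm at least 1 and the
   coefficients of 1/q grow polynomially, which bounds the GK dimension. *)
From HB Require Import structures.
From mathcomp Require Import all_boot all_order all_algebra.
From mathcomp Require Import boolp classical_sets functions reals ereal sequences exp.
From mathcomp Require Import algC.
From mathcomp Require Import generic_quotient ring_quotient.
From mathcomp.multinomials Require Import freeg.
Require Import Defs.

Set Implicit Arguments.
Unset Strict Implicit.
Unset Printing Implicit Defensive.

Import Order.TTheory GRing.Theory Num.Theory.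

Local Open Scope classical_set_scope.
Local Open Scope ring_scope.

(** * Zigzag arguments between two resolutions of k *)

(** Multiplying z by A_{>=1} moves it to degrees where the cohomology k(l) vanishes, so modulo
    boundaries z spans a copy of the right module k. This is why the map attached to z starts from
    the right resolution G, and why G_{d+1} = 0 comes before F_{d+1} = 0.

    Noetherianity makes all ranks finite, so both resolutions become sequences of matrices over A:
    rows for left modules, columns for right ones. The double complexes then consist of rectangular
    matrices, with one differential multiplying on each side. Ext and Tor refer to functorial
    resolutions of infinite rank; comparison maps and homotopies carry the hypotheses over to F and
    G.

    An arbitrary module M has no grading of its own: M[t] is graded by the powers of t, with a in
    A_i acting as a t^i. For the growth, a root rho of q with |rho| < 1 would lie inside the disc of
    convergence of the Hilbert series H and contradict q(rho) H(rho) = 1. *)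

Section MatrixColumns.
Variables (A : pzRingType).

Lemma mulmx_col m n p (X : 'M[A]_(m, n)) (Y : 'M[A]_(n, p)) b :
  X *m col b Y = col b (X *m Y).
Proof. by rewrite !colE mulmxA. Qed.

Lemma right_factor m n p (X : 'M[A]_(m, n)) (W : 'M[A]_(m, p)) :
  (forall b, exists w, col b W = X *m w) -> exists W', W = X *m W'.
Proof.
move=> /choice[f fP]; exists (\matrix_(a, b) f b a 0); apply/matrixP => a b.
have /matrixP/(_ a 0) := fP b; rewrite !mxE => ->.
by apply: eq_bigr => c _; rewrite mxE.
Qed.

Lemma left_factor m n p (Y : 'M[A]_(n, p)) (W : 'M[A]_(m, p)) :
  (forall a, exists w, row a W = w *m Y) -> exists W', W = W' *m Y.
Proof.
move=> /choice[f fP]; exists (\matrix_a f a).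
by apply/row_matrixP => a; rewrite row_mul rowK -fP.
Qed.

End MatrixColumns.

Section Zigzag.
Variables (A : nzRingType) (s r : nat -> nat).
Variable E : forall i, 'M[A]_(s i.+1, s i).
Variable D : forall i, 'M[A]_(r i, r i.+1).
Hypothesis EE : forall i, E i.+1 *m E i = 0.
Hypothesis DD : forall i, D i *m D i.+1 = 0.

(* The boundaries in degree i of the complex Hom(F, A), whose terms are columns. *)
Definition dual_boundary i : set 'cV[A]_(s i) :=
  if i is j.+1 return set 'cV[A]_(s i) then [set E j *m w | w in setT]
  else [set 0].

Section Dual.
Variable d : nat.
Hypothesis Ex : forall i (w : 'cV_(s i)), (i < d)%N -> E i *m w = 0 ->
  dual_boundary w.
Hypothesis Dx : forall i (w : 'rV_(r i.+1)), (d < i.+1)%N -> w *m D i.+1 = 0 ->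
  exists w', w = w' *m D i.

Let DxM i p (W : 'M_(p, r i.+1)) : (d < i.+1)%N -> W *m D i.+1 = 0 ->
  exists W', W = W' *m D i.
Proof.
move=> di WD0; apply: left_factor => a.
by apply: Dx => //; rewrite -row_mul WD0 row0.
Qed.

(** Dimension shifting: [E j *m Psi] represents a class in Ext^(m+1) of the right module k with
    values in the image of [E j], and that image has a finite free resolution by the columns of
    length [s i], i <= j. Each step lowers j and raises m, until only Ext of k with values in a free
    module is left, which vanishes above degree d. *)
Lemma dual_zigzag j m (Psi : 'M_(s j, r m.+1)) :
  (j < d)%N -> (d < m.+1)%N -> E j *m Psi *m D m.+1 = 0 ->
  exists Theta : 'M_(s j, r m), E j *m (Psi - Theta *m D m) = 0.
Proof.
elim: j m Psi => [|j IHj] m Psi jd dm.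
  rewrite -mulmxA => EPD0.
  have /(DxM dm)[Th ->] : Psi *m D m.+1 = 0.
    apply/matrixP => a b; rewrite mxE; have : dual_boundary (col b (Psi *m D m.+1)).
      by apply: Ex => //; rewrite mulmx_col EPD0 colE mul0mx.
    by move=> /matrixP/(_ a 0); rewrite !mxE.
  by exists Th; rewrite subrr mulmx0.
rewrite -mulmxA => EPD0.
have [Psi' PsiE] : exists W', Psi *m D m.+1 = E j *m W'.
  apply: right_factor => b.
  have : dual_boundary (col b (Psi *m D m.+1)).
    by apply: Ex => //; rewrite mulmx_col EPD0 colE mul0mx.
  by case=> w _ <-; exists w.
have [||Th /eqP] := IHj m.+1 Psi' _ (ltnW dm); first exact: ltnW.
  by rewrite -PsiE -mulmxA DD mulmx0.
rewrite mulmxBr subr_eq0 -PsiE mulmxA -subr_eq0 -mulmxBl => /eqP/(DxM dm)[Th' PE].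
by exists Th'; rewrite -PE subKr mulmxA EE mul0mx.
Qed.

Variables (B : nzRingType) (aug : {rmorphism A -> B}).
Hypothesis augE : forall i, map_mx aug (E i) = 0.
Hypothesis augD : forall i, map_mx aug (D i) = 0.

(* z e_b kills D_{d+1} up to a boundary; the zigzag corrects it by a boundary so
   that it kills D_{d+1}, hence factors through D_d, which aug sends to 0. *)
Lemma dual_zigzag_rank0 (z : 'cV_(s d)) :
  E d *m z = 0 -> map_mx aug z != 0 ->
  (forall a : A, aug a = 0 -> dual_boundary (z *m a%:M)) -> r d.+1 = 0%N.
Proof.
move=> Ez z0 za; apply/eqP; rewrite -leqn0 leqNgt; apply/negP => rd.
pose b := Ordinal rd; pose Phi := z *m delta_mx 0 b.
have PhiD c : col c (Phi *m D d.+1) = z *m (D d.+1 b c)%:M.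
  rewrite -mulmxA -rowE colE -mulmxA -colE; congr (_ *m _).
  by apply/matrixP => x y; rewrite !mxE !ord1.
have bPhiD c : dual_boundary (col c (Phi *m D d.+1)).
  by rewrite PhiD; apply: za; have /matrixP/(_ b c) := augD d.+1; rewrite !mxE.
suff [Y YD augY] : exists2 Y : 'M_(s d, r d.+1),
    (Phi - Y) *m D d.+1 = 0 & map_mx aug Y = 0.
  (* Exactness above d makes [Phi - Y] a multiple of [D d]; [aug] kills both [D d] and Y, so it
     kills [Phi], whose column b is z. *)
  have [//|G PG] := DxM _ YD.
  case/eqP: z0; have := congr1 (map_mx aug) PG.
  rewrite map_mxB map_mxM augD mulmx0 augY subr0 map_mxM => /(congr1 (col b)).
  rewrite col0 map_delta_mx -mulmx_col.
  rewrite (_ : col b _ = 1%:M) ?mulmx1 //.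
  by apply/matrixP => x y; rewrite !mxE !ord1 !eqxx.
(* The boundary to subtract has the form [E j *m Th], which [aug] kills; in degree 0 there is
   nothing to subtract. *)
have correct i (P : 'M_(s i, r d.+1)) : (i <= d)%N ->
    (forall c, dual_boundary (col c (P *m D d.+1))) ->
    exists2 Y, (P - Y) *m D d.+1 = 0 & map_mx aug Y = 0.
  case: i P => [|j] P jd bP.
    exists 0; last by rewrite map_mx0.
    by rewrite subr0; apply/matrixP => x y; have /matrixP/(_ x 0) := bP y; rewrite !mxE.
  have [Psi PsiE] : exists W', P *m D d.+1 = E j *m W'.
    by apply: right_factor => c; case: (bP c) => w _ <-; exists w.
  have [|Th /eqP] := @dual_zigzag j d.+1 Psi jd (ltnW (ltnSn _)).
    by rewrite -PsiE -mulmxA DD mulmx0.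
  rewrite mulmxBr subr_eq0 -PsiE => /eqP PE.
  exists (E j *m Th); last by rewrite map_mxM augE mul0mx.
  by rewrite mulmxBl PE mulmxA subrr.
exact: correct.
Qed.

End Dual.

Section Balance.
Variables (B : nzRingType) (aug : {rmorphism A -> B}).
Hypothesis augE : forall i, map_mx aug (E i) = 0.
Hypothesis augD : forall i, map_mx aug (D i) = 0.
Hypothesis Ex : forall i (w : 'rV_(s i.+1)), w *m E i = 0 ->
  exists w', w = w' *m E i.+1.
Hypothesis Dx : forall i (w : 'cV_(r i.+1)), D i *m w = 0 ->
  exists w', w = D i.+1 *m w'.
Hypothesis D0 : forall w : 'cV_(r 0), map_mx aug w = 0 -> exists w', w = D 0 *m w'.

Let DxM i p (W : 'M_(r i.+1, p)) : D i *m W = 0 -> exists W', W = D i.+1 *m W'.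
Proof.
move=> WD0; apply: right_factor => c.
by apply: Dx => //; rewrite mulmx_col WD0 col0.
Qed.

Let ExM i p (W : 'M_(p, s i.+1)) : W *m E i = 0 -> exists W', W = W' *m E i.+1.
Proof.
move=> WE0; apply: left_factor => a.
by apply: Ex => //; rewrite -row_mul WE0 row0.
Qed.

(** Walks along an antidiagonal of the double complex of matrices: exactness of D trades (j, m) for
    (j+1, m-1), and the walk stops because the last term reached has [r (j + m).+2] = 0 rows. *)
Lemma tensor_zigzag j m (T : 'M_(r j.+1, s m.+1)) : r (j + m).+2 = 0%N ->
  D j *m T *m E m = 0 -> exists U : 'M_(r j.+1, s m.+2), D j *m (T - U *m E m.+1) = 0.
Proof.
elim: m j T => [|m IHm] j T rj; rewrite -mulmxA => /DxM[T' TE].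
  have r0 : r j.+2 = 0%N by rewrite -rj addn0.
  have [|U ->] := ExM (W := T); last by exists U; rewrite subrr mulmx0.
  rewrite TE; apply/matrixP => x y; rewrite !mxE big1 // => c _.
  by move: (ltn_ord c); rewrite [X in (_ < X)%N]r0.
have [||U' /eqP] := IHm j.+1 T'; first by rewrite addSnnS.
  by rewrite -TE -mulmxA EE mulmx0.
rewrite mulmxBr subr_eq0 -TE mulmxA -subr_eq0 -mulmxBl => /eqP/ExM[U TU].
by exists U; rewrite -TU subKr mulmxA DD mul0mx.
Qed.

(** This balances Tor_{d+1}(k, k). The elementary matrix T, corrected by a multiple of [D 0],
    becomes a cycle for E and hence a multiple of [E d.+1]; [aug] kills this multiple and the
    correction, but not T. *)
Lemma tensor_zigzag_rank0 d (j0 : 'I_(r 0)) : r d.+1 = 0%N -> s d.+1 = 0%N.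
Proof.
move=> rd; apply/eqP; rewrite -leqn0 leqNgt; apply/negP => sd.
pose T : 'M[A]_(r 0, s d.+1) := delta_mx j0 (Ordinal sd).
suff [V] : exists2 V, (T - V) *m E d = 0 & map_mx aug V = 0.
  move=> /ExM[U TU] augV; have := congr1 (map_mx aug) TU.
  rewrite map_mxB map_mxM augE mulmx0 augV subr0 => /matrixP/(_ j0 (Ordinal sd)).
  by rewrite /T !mxE !eqxx /= rmorph1 => /eqP; rewrite oner_eq0.
have [T1 TE] : exists T1, T *m E d = D 0 *m T1.
  apply: right_factor => c; apply: D0.
  by rewrite colE !map_mxM augE mulmx0 mul0mx.
clearbody T; case: d rd sd T T1 TE => [|m] rd sd T T1 TE.
  exists 0; last by rewrite map_mx0.
  rewrite subr0 TE; apply/matrixP => x y; rewrite !mxE big1 // => c _.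
  by move: (ltn_ord c); rewrite [X in (_ < X)%N]rd.
have [||U /eqP] := @tensor_zigzag 0 m T1 => //.
  by rewrite -TE -mulmxA EE mulmx0.
rewrite mulmxBr subr_eq0 -TE => /eqP TE'.
exists (D 0 *m U); last by rewrite map_mxM augD mul0mx.
by rewrite mulmxBl TE' mulmxA subrr.
Qed.

End Balance.
End Zigzag.

(** * Homogeneous components and the augmentation *)

Lemma big_widen_seq (I : eqType) (V : zmodType) (u r : seq I) (g : I -> V) :
  uniq u -> uniq r -> {subset r <= u} -> (forall i, i \notin r -> g i = 0) ->
  \sum_(i <- r) g i = \sum_(i <- u) g i.
Proof.
move=> uu ur ru g0; rewrite [RHS](bigID [in r]) /= [X in _ + X]big1 => [|j /g0//].
rewrite addr0 -[RHS]big_filter; apply: perm_big; apply: uniq_perm => //.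
  by rewrite filter_uniq.
by move=> j; rewrite mem_filter; apply/idP/andP => [jr|[]//]; split=> //; apply: ru.
Qed.

Section Components.
Variables (I : eqType) (V : zmodType) (G : I -> set V) (gG : is_grading G).

Fact grading_dec_fun x : exists f : I -> V, exists s : seq I,
  [/\ uniq s, forall i, G i (f i), forall i, i \notin s -> f i = 0
    & x = \sum_(i <- s) f i].
Proof.
have [s [f [us fG ->]]] := grading_dec gG x.
exists (fun i => if i \in s then f i else 0), s; split=> //.
- by move=> i; case: ifP => // _; apply: grading0.
- by move=> i /negPf->.
- by apply: eq_big_seq => i ->.
Qed.

(** A grading only asserts that decompositions exist, so the projection is obtained by choice;
    [hcomp_unique] makes it independent of that choice. *)
Definition hcomp i x := projT1 (cid (grading_dec_fun x)) i.

Lemma hcomp_homog i x : G i (hcomp i x).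
Proof. by rewrite /hcomp; case: cid => f /= [s []]. Qed.

Lemma hcomp_sum x : exists s : seq I,
  [/\ uniq s, forall i, i \notin s -> hcomp i x = 0 & x = \sum_(i <- s) hcomp i x].
Proof. by rewrite /hcomp; case: cid => f /= [s [us _ f0 xE]]; exists s. Qed.

Lemma hcomp_unique (f : I -> V) (s : seq I) x : uniq s -> (forall i, G i (f i)) ->
  (forall i, i \notin s -> f i = 0) -> x = \sum_(i <- s) f i ->
  forall i, hcomp i x = f i.
Proof.
move=> us fG f0 xE i; have [t [ut c0 xE']] := hcomp_sum x.
pose u := undup (s ++ t).
have e : \sum_(i <- u) (hcomp i x - f i) = 0.
  have su : {subset s <= u} by move=> j js; rewrite mem_undup mem_cat js.
  have tu : {subset t <= u} by move=> j js; rewrite mem_undup mem_cat js orbT.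
  have es := big_widen_seq (undup_uniq _) us su f0.
  have et := big_widen_seq (undup_uniq _) ut tu c0.
  by rewrite sumrB -es -et -xE -xE' subrr.
have gu j : G j (hcomp j x - f j) by apply: gradingB => //; apply: hcomp_homog.
have [iu|] := boolP (i \in u); last first.
  by rewrite mem_undup mem_cat negb_or => /andP[/f0-> /c0->].
apply/eqP; rewrite -subr_eq0; apply/eqP.
by case: gG => _ _ _ /(_ u _ (undup_uniq _) gu e i iu).
Qed.

Lemma hcomp_id i x : G i x -> hcomp i x = x.
Proof.
move=> Gx; rewrite (@hcomp_unique (fun j => if j == i then x else 0) [:: i]) ?eqxx //.
- by move=> j; case: eqP => [->//|_]; apply: grading0.
- by move=> j; rewrite inE => /negPf->.
- by rewrite big_seq1 eqxx.
Qed.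

Lemma hcomp_neq i j x : G i x -> j != i -> hcomp j x = 0.
Proof.
move=> Gx ji; rewrite (@hcomp_unique (fun j => if j == i then x else 0) [:: i]) ?(negPf ji) //.
- by move=> l; case: eqP => [->//|_]; apply: grading0.
- by move=> l; rewrite inE => /negPf->.
- by rewrite big_seq1 eqxx.
Qed.

Lemma hcompE i j x : G i x -> hcomp j x = if j == i then x else 0.
Proof.
by move=> Gx; case: eqP => [->|/eqP]; [apply: hcomp_id|apply: hcomp_neq].
Qed.

Lemma hcomp_is_zmod_morphism i : zmod_morphism (hcomp i).
Proof.
move=> x y; have [s [us s0 xE]] := hcomp_sum x; have [t [ut t0 yE]] := hcomp_sum y.
pose u := undup (s ++ t).
rewrite (@hcomp_unique (fun i => hcomp i x - hcomp i y) u) ?undup_uniq //.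
- by move=> j; apply: gradingB => //; apply: hcomp_homog.
- by move=> j; rewrite mem_undup mem_cat negb_or => /andP[/s0-> /t0->]; rewrite subr0.
have su : {subset s <= u} by move=> j js; rewrite mem_undup mem_cat js.
have tu : {subset t <= u} by move=> j js; rewrite mem_undup mem_cat js orbT.
have es := big_widen_seq (undup_uniq _) us su s0.
have et := big_widen_seq (undup_uniq _) ut tu t0.
by rewrite sumrB -es -et -xE -yE.
Qed.

HB.instance Definition _ i := GRing.isZmodMorphism.Build V V (hcomp i)
  (hcomp_is_zmod_morphism i).

Lemma hcomp_eq0 x : (forall i, hcomp i x = 0) -> x = 0.
Proof. by have [s [_ _ {2}->]] := hcomp_sum x => x0; apply: big1. Qed.

Lemma hcomp_ind (P : V -> Prop) : P 0 -> (forall x y, P x -> P y -> P (x + y)) ->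
  forall x, (forall i, P (hcomp i x)) -> P x.
Proof. by move=> P0 PD x Px; have [s [_ _ ->]] := hcomp_sum x; apply: big_ind. Qed.

Lemma homog_ind (P : V -> Prop) : P 0 -> (forall x y, P x -> P y -> P (x + y)) ->
  (forall i x, G i x -> P x) -> forall x, P x.
Proof. by move=> P0 PD Ph x; apply: hcomp_ind => // i; apply: Ph (hcomp_homog i x). Qed.

End Components.

Lemma hcomp_morph (I : eqType) (V W : zmodType) (G : I -> set V) (H : I -> set W)
    (gG : is_grading G) (gH : is_grading H) (f : V -> W) i x :
  f 0 = 0 -> {morph f : x y / x + y} -> (forall j y, G j y -> H j (f y)) ->
  hcomp gH i (f x) = f (hcomp gG i x).
Proof.
move=> f0 fD fH; elim/(homog_ind gG): x => [|x y xE yE|j x xj].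
- by rewrite !raddf0 !f0 raddf0.
- by rewrite raddfD !fD raddfD /= xE yE.
- by rewrite (hcompE gG _ xj) (hcompE gH _ (fH _ _ xj)); case: eqP.
Qed.

Lemma hcomp_degree0 (k : fieldType) (A : cgAlg k) (M N : grMod A)
    (f : {linear M -> N}) j x : degree0 f ->
  hcomp (@gm_grading _ _ N) j (f x) = f (hcomp (@gm_grading _ _ M) j x).
Proof. by move=> f0; apply: hcomp_morph; [apply: linear0|apply: linearD|]. Qed.

Lemma hcomp_act (k : fieldType) (A : cgAlg k) (M : grMod A) i j a (x : M) :
  cg_homog i a -> hcomp (gm_grading M) (i%:Z + j) (a *: x) = a *: hcomp (gm_grading M) j x.
Proof.
move=> ai; elim/(homog_ind (gm_grading M)): x => [|x y xE yE|l x xl].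
- by rewrite !raddf0.
- by rewrite !raddfD /= xE yE.
- rewrite (hcompE _ _ xl) (hcompE _ _ (gm_act ai xl)) (inj_eq (addrI _)).
  by case: eqP; rewrite ?scaler0.
Qed.

Section Augmentation.
Variables (k : fieldType) (A : cgAlg k).

Fact hcomp0_scalar (x : A) : exists c : k, hcomp (@cg_grading _ A) 0%N x = c%:A.
Proof. by move: (hcomp_homog (@cg_grading _ A) 0%N x) => /cg_conn. Qed.

Definition aug (x : A) : k := projT1 (cid (hcomp0_scalar x)).

Lemma augP x : hcomp (@cg_grading _ A) 0%N x = (aug x)%:A.
Proof. by rewrite /aug; case: cid. Qed.

Lemma scalar_inj : injective (fun c : k => c%:A : A).
Proof.
move=> c e /eqP; rewrite -subr_eq0 -scalerBl scaler_eq0 oner_eq0 orbF subr_eq0.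
by move/eqP.
Qed.

Lemma aug_eq x c : hcomp (@cg_grading _ A) 0%N x = c%:A -> aug x = c.
Proof. by move=> xc; apply: scalar_inj; rewrite -augP. Qed.

Lemma aug_scalar c : aug c%:A = c.
Proof. by apply: aug_eq; apply: hcomp_id; apply/cg_conn; exists c. Qed.

Lemma aug_homog i x : cg_homog i x -> (0 < i)%N -> aug x = 0.
Proof.
move=> xi i0; apply: aug_eq; rewrite scale0r.
by apply: (hcomp_neq _ xi); rewrite neq_ltn i0.
Qed.

Fact aug_is_zmod_morphism : zmod_morphism aug.
Proof. by move=> x y; apply: aug_eq; rewrite raddfB /= !augP scalerBl. Qed.
HB.instance Definition _ := GRing.isZmodMorphism.Build A k aug aug_is_zmod_morphism.

Fact aug_is_monoid_morphism : monoid_morphism aug.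
Proof.
split=> [|x y]; first by rewrite -[X in aug X]scale1r aug_scalar.
elim/(homog_ind (@cg_grading _ A)): x => [|x x' xE xE'|i x xi].
- by rewrite mul0r raddf0 mul0r.
- by rewrite mulrDl !raddfD /= mulrDl xE xE'.
elim/(homog_ind (@cg_grading _ A)): y => [|y y' yE yE'|j y yj].
- by rewrite mulr0 raddf0 mulr0.
- by rewrite mulrDr !raddfD /= mulrDr yE yE'.
have [i0|i0] := posnP i; last first.
  by rewrite (aug_homog xi i0) mul0r; apply: (aug_homog (cg_mul xi yj)); rewrite addn_gt0 i0.
have [j0|j0] := posnP j; last first.
  by rewrite (aug_homog yj j0) mulr0; apply: (aug_homog (cg_mul xi yj)); rewrite addn_gt0 j0 orbT.
move: xi yj; rewrite i0 j0 => /cg_conn[c ->] /cg_conn[e ->].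
by rewrite -scalerAl mul1r scalerA !aug_scalar.
Qed.
HB.instance Definition _ := GRing.isMonoidMorphism.Build A k aug aug_is_monoid_morphism.

Lemma aug_zhomog i x : zhomog i x -> i != 0 -> aug x = 0.
Proof.
case: i => i; first by move=> xi i0; apply: (aug_homog xi); rewrite lt0n.
by move=> -> _; rewrite raddf0.
Qed.

Lemma zhomog_scalar i x : zhomog i x -> i <= 0 -> x = (aug x)%:A.
Proof.
case: i => [[|i]|i] //=; last by move=> -> _; rewrite raddf0 scale0r.
by move=> /cg_conn[c ->] _; rewrite aug_scalar.
Qed.

Lemma aug_ind (P : A -> Prop) : P 0 -> (forall x y, P x -> P y -> P (x + y)) ->
  (forall i x, (0 < i)%N -> cg_homog i x -> P x) -> forall x, aug x = 0 -> P x.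
Proof.
move=> P0 PD Ph x x0; apply: (hcomp_ind (gG := @cg_grading _ A)) => // i.
have [->|i0] := posnP i; last exact: Ph (hcomp_homog _ _ _).
by rewrite augP x0 scale0r.
Qed.

Lemma mem_pos_part (x : A) : (x : A^o) \in @pos_part _ A <-> aug x = 0.
Proof.
split=> [/asboolP[s sG ->]|].
  by rewrite raddf_sum big_seq big1 // => p /sG[p0 ph]; exact: (aug_homog ph p0).
move: x; apply: aug_ind => [|x y xp yp|i x i0 xi].
- exact: rpred0.
- exact: rpredD.
- exact: pos_part_homog xi.
Qed.

End Augmentation.

Lemma aug_opp (k : fieldType) (A : cgAlg k) (x : A) :
  @aug k (opp_alg A) x = @aug k A x.
Proof.
apply: aug_eq.
elim/(homog_ind (@cg_grading _ A)): x => [|x y xE yE|i x xi].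
- by rewrite !raddf0 scale0r.
- by rewrite !raddfD /= scalerDl -xE -yE.
have xi' : @cg_homog _ (opp_alg A) i x by [].
rewrite (hcompE _ _ xi'); have [i0|i0] := posnP i.
  rewrite -i0 eqxx; move: xi; rewrite i0 => /cg_conn[c ->].
  by rewrite aug_scalar.
by rewrite (aug_homog xi i0) scale0r; case: eqP i0 => // <-.
Qed.

(** * Minimal free resolutions over a noetherian algebra *)

Section MatrixGrading.
Variables (k : fieldType) (A : cgAlg k) (m n : nat) (dg : 'I_m -> 'I_n -> int).

(** The matrix unit at (a, b) has degree [dg a b]. Rows take the degrees of a basis, the columns of
    the dual complex take their negatives ([dual_homog]). *)
Definition mx_homog (j : int) : set 'M[A]_(m, n) :=
  [set v | forall a b, zhomog (j - dg a b) (v a b)].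

Fact mx_grading : is_grading mx_homog.
Proof.
have gA := @zhomog_grading k A; split.
- by move=> j a b; rewrite mxE; apply: zhomog0.
- by move=> j x y xj yj a b; rewrite !mxE; apply: (gradingB gA).
- move=> v; rewrite [v]matrix_sum_delta.
  apply: homog_sum_big => a _; apply: homog_sum_big => b _.
  elim/(homog_ind gA): (v a b) => [|x y hx hy|j x xj].
  + by exists [::]; rewrite ?big_nil ?scale0r.
  + by rewrite scalerDl; apply: homog_sumD.
  apply: (@homog_sum1 _ _ _ (j + dg a b)) => a' b'; rewrite !mxE.
  case: eqP => [->|_]; last by rewrite mulr0; apply: zhomog0.
  case: eqP => [->|_]; first by rewrite mulr1 addrK.
  by rewrite mulr0; apply: zhomog0.
- move=> s f us fG sf0 i si; apply/matrixP => a b; rewrite mxE.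
  case: gA => _ _ _.
  move=> /(_ [seq j - dg a b | j <- s] (fun j => f (j + dg a b) a b)).
  rewrite map_inj_uniq; last exact: addIr.
  move=> /(_ us) gA; rewrite -[i](subrK (dg a b)); apply: gA; last exact: map_f.
    by move=> j; have := fG (j + dg a b) a b; rewrite addrK.
  rewrite big_map; have /matrixP/(_ a b) := sf0; rewrite summxE mxE => h; rewrite -[RHS]h.
  by apply: eq_bigr => j _; rewrite subrK.
Qed.

End MatrixGrading.

Section FreeRows.
Variables (k : fieldType) (A : cgAlg k) (n : nat) (dg : 'I_n -> int).

Definition frow_homog : int -> set 'rV[A]_n := mx_homog (fun _ : 'I_1 => dg).

Fact frow_grading : is_grading frow_homog.
Proof. exact: mx_grading. Qed.

Fact frow_act i j a v : cg_homog i a -> frow_homog j v ->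
  frow_homog (i%:Z + j) (a *: v).
Proof. by move=> ai vj c b; rewrite mxE -addrA; apply: (zhomog_mul (ai : zhomog i a)). Qed.

Definition frow : grMod A := GrMod frow_grading frow_act.

Lemma hcomp_frow j (v : frow) a :
  (hcomp (gm_grading frow) j v : 'rV_n) 0 a
  = hcomp (@zhomog_grading k A) (j - dg a) ((v : 'rV_n) 0 a).
Proof.
elim/(homog_ind (gm_grading frow)): v => [|x y xE yE|l x xl].
- by rewrite raddf0 !mxE raddf0.
- by rewrite raddfD !mxE /= raddfD /= xE yE.
rewrite (hcompE _ _ xl) (hcompE _ _ (xl 0 a)) (inj_eq (addIr _)).
by case: eqP => // _; rewrite mxE.
Qed.

Lemma frow_delta a : frow_homog (dg a) (delta_mx 0 a).
Proof.
move=> i b; rewrite mxE ord1 eqxx /=; case: eqP => [->|_]; last exact: zhomog0.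
by rewrite subrr; apply/cg_conn; exists 1; rewrite scale1r.
Qed.

End FreeRows.

Section Noetherian.
Variable R : nzRingType.
Hypothesis noethR : left_noetherian R.

Lemma noetherian_max (F : set (set R)) (I0 : set R) :
  F I0 -> (forall I, F I -> left_ideal I) ->
  exists2 I, F I & forall J, F J -> I `<=` J -> J `<=` I.
Proof.
move=> F0 Fl; apply: contrapT => noMax.
have next (I : set R) : exists J, F I -> [/\ F J, I `<=` J & ~ (J `<=` I)].
  have [FI|nFI] := pselect (F I); last by exists I.
  apply: contrapT => noJ; apply: noMax; exists I => // J FJ IJ.
  by apply: contrapT => nJI; apply: noJ; exists J.
have [f fP] := choice next.
have FI n : F (iter n f I0) by elim: n => //= n /fP[].
have [N /(_ N.+1 (leqnSn _)) NE] := noethR (fun n => Fl _ (FI n))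
  (fun n => let: And3 _ h _ := fP _ (FI n) in h).
by have [_ _] := fP _ (FI N); apply; rewrite -[f _]/(iter N.+1 f I0) NE.
Qed.

Definition row_span m n (M : 'M[R]_(m, n)) : set 'rV[R]_n :=
  [set u *m M | u in setT].

Definition row_submod n (S : set 'rV[R]_n) : Prop :=
  [/\ S 0, forall x y, S x -> S y -> S (x + y) & forall a x, S x -> S (a *: x)].

Lemma row_span_submod m n (M : 'M[R]_(m, n)) : row_submod (row_span M).
Proof.
split; first by exists 0; rewrite ?mul0mx.
- by move=> _ _ [u _ <-] [v _ <-]; exists (u + v); rewrite ?mulmxDl.
- by move=> a _ [u _ <-]; exists (a *: u); rewrite ?scalemxAl.
Qed.

Lemma row_span_row m n (M : 'M[R]_(m, n)) i : row_span M (row i M).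
Proof. by exists (delta_mx 0 i); rewrite ?rowE. Qed.

Lemma row_spanS m n (M : 'M[R]_(m, n)) S : row_submod S ->
  (forall i, S (row i M)) -> row_span M `<=` S.
Proof.
move=> [S0 SD SZ] SM _ [u _ <-]; rewrite mulmx_sum_row.
by elim/big_ind: _ => // i _; apply: SZ.
Qed.

Lemma row_span_ideal m (a : 'cV[R]_m) : left_ideal [set x | row_span a x%:M].
Proof.
have [h0 hD hZ] := row_span_submod a; split=> /=.
- by rewrite raddf0.
- by move=> x y; rewrite raddfD; apply: hD.
- by move=> x y /(hZ x); rewrite scale_scalar_mx.
Qed.

(** A maximal finitely generated left ideal inside I absorbs every x in I, since adjoining x to its
    generators cannot enlarge it. *)
Lemma noetherian_ideal (I : set R) : left_ideal I ->
  exists m (a : 'cV[R]_m), forall x, I x <-> row_span a x%:M.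
Proof.
move=> [I0 ID IM].
pose F : set (set R) := [set J | J `<=` I /\
  exists m (a : 'cV[R]_m), J = [set x | row_span a x%:M]].
have [||J [JI [m [a JE]]] Jmax] := @noetherian_max F [set 0].
- split=> [_ ->//|]; exists 0%N, 0; apply/seteqP; split=> x /=.
    by move=> ->; exists 0; rewrite // mulmx0 raddf0.
  by case=> u _ /matrixP/(_ 0 0); rewrite mulmx0 !mxE mulr1n.
- by move=> J [_ [m [a ->]]]; apply: row_span_ideal.
exists m, a => x; split=> [Ix|]; last by move: x; rewrite -/([set x | _] `<=` I) -JE.
pose b := col_mx a x%:M.
suff : [set x | row_span b x%:M] `<=` J.
  rewrite JE; apply; exists (row_mx 0 1%:M) => //.
  by rewrite mul_row_col mul0mx mul1mx add0r.
apply: (Jmax [set x | row_span b x%:M]); [split; last by exists (m + 1)%N, b|].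
- move=> y [u _ yE]; have -> : y = (lsubmx u *m a + rsubmx u *m x%:M) 0 0.
    by rewrite -mul_row_col hsubmxK yE mxE eqxx mulr1n.
  rewrite mxE; apply: ID; last by rewrite mxE big_ord1 [X in _ * X]mxE eqxx mulr1n; apply: IM.
  apply: JI; rewrite JE; exists (lsubmx u) => //.
  by apply/matrixP => i j; rewrite !ord1 [RHS]mxE eqxx mulr1n.
- rewrite JE => y [u _ uE]; exists (row_mx u 0) => //.
  by rewrite mul_row_col mul0mx addr0.
Qed.

(** Induction on the number of coordinates: take generators of the ideal of first entries, lifted to
    S, together with generators of the part of S whose first entry is 0. *)
Lemma noetherian_row n (S : set 'rV[R]_n) : row_submod S ->
  exists m (M : 'M[R]_(m, n)), S = row_span M.
Proof.
elim: n S => [|n IHn]; last change (forall S : set 'rV[R]_(1 + n), row_submod S ->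
  exists m (M : 'M[R]_(m, 1 + n)), S = row_span M); move=> S [S0 SD SZ].
  exists 0%N, 0; apply/seteqP; split=> v; first by exists 0; rewrite // mul0mx thinmx0.
  by rewrite [v]thinmx0.
pose I : set R := [set x | exists v : 'rV_n, S (row_mx x%:M v)].
have Iideal : left_ideal I.
  split; first by exists 0; rewrite raddf0 row_mx0.
  - move=> x y [u Su] [v Sv]; exists (u + v).
    by rewrite raddfD -add_row_mx; apply: SD.
  - move=> a x [u Su]; exists (a *: u).
    by rewrite -scale_scalar_mx -scale_row_mx; apply: SZ.
have [p [a Ia]] := noetherian_ideal Iideal.
have aI i : I (a i 0).
  apply/Ia; rewrite (_ : _%:M = row i a); first exact: row_span_row.
  by apply/matrixP => x y; rewrite !ord1 !mxE eqxx.
have [f fP] := choice aI.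
pose S' : set 'rV_n := [set v | S (row_mx 0 v)].
have [|m [M' S'E]] := IHn S'.
  split; first by rewrite /S' /= row_mx0.
  - by move=> x y Sx Sy; rewrite /S' /= -[0]addr0 -add_row_mx; apply: SD.
  - by move=> c x Sx; rewrite /S' /= -[0](scaler0 _ c) -scale_row_mx; apply: SZ.
pose V : 'M_(p, n) := \matrix_i f i.
exists (p + m)%N, (col_mx (row_mx a V) (row_mx 0 M')).
have Ssub : row_submod S by [].
have Srow : row_span (row_mx a V) `<=` S.
  apply: row_spanS => // i; rewrite row_row_mx rowK.
  rewrite (_ : row i a = (a i 0)%:M); first exact: fP.
  by apply/matrixP => x y; rewrite !ord1 !mxE eqxx.
apply/seteqP; split=> [v Sv|_ [u _ <-]].
  have [|w _ wE] := (Ia (v 0 0)).1.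
    exists (rsubmx v); rewrite (_ : _%:M = lsubmx v) ?hsubmxK //.
    apply/matrixP => x y; rewrite !ord1 !mxE eqxx mulr1n; congr (v _ _).
    exact: val_inj.
  have vE : lsubmx v = w *m a.
    rewrite wE; apply/matrixP => x y; rewrite !ord1 !mxE eqxx mulr1n; congr (v _ _).
    exact: val_inj.
  have : S' (rsubmx v - w *m V).
    rewrite /S' /= (_ : row_mx _ _ = v + (-1) *: (w *m row_mx a V)); last first.
      rewrite mul_mx_row scale_row_mx -{2}[v]hsubmxK vE add_row_mx.
      by rewrite !scaleN1r subrr.
    by apply: SD => //; apply/SZ/Srow; exists w.
  rewrite S'E => -[w' _ w'E]; exists (row_mx w w') => //.
  rewrite mul_row_col !mul_mx_row mulmx0 w'E add_row_mx addr0 addrC subrK -vE.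
  exact: hsubmxK.
rewrite -[u]hsubmxK mul_row_col; apply: SD; first by apply: Srow; exists (lsubmx u).
rewrite mul_mx_row mulmx0; suff : S' (rsubmx u *m M') by [].
by rewrite S'E; exists (rsubmx u).
Qed.

End Noetherian.

Lemma hcomp_zhomog0 (k : fieldType) (A : cgAlg k) (x : A) :
  hcomp (@zhomog_grading k A) 0 x = (aug x)%:A.
Proof.
elim/(homog_ind (@zhomog_grading k A)): x => [|x y xE yE|i x xi].
- by rewrite !raddf0 scale0r.
- by rewrite !raddfD /= scalerDl xE yE.
rewrite (hcompE _ _ xi); case: eqP => [i0|/eqP i0].
  by apply: (zhomog_scalar xi); rewrite -i0.
by rewrite (aug_zhomog xi) ?scale0r // eq_sym.
Qed.

Section MinimalGenerators.
Variables (k : fieldType) (A : cgAlg k) (n : nat) (dg : 'I_n -> nat).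
Hypothesis noethA : left_noetherian A.

Let F : grMod A := frow A (fun a => (dg a)%:Z).
Let gF : is_grading (@gm_homog _ _ F) := gm_grading F.

Definition hom_gens (S : set 'rV[A]_n) m (M : 'M[A]_(m, n)) (e : 'I_m -> int) :=
  (forall i, frow_homog (fun a => (dg a)%:Z) (e i) (row i M)) /\ S = row_span M.

Lemma exists_hom_gens (S : set 'rV[A]_n) : row_submod S ->
  (forall j (v : F), S v -> S (hcomp gF j v)) ->
  exists m (M : 'M[A]_(m, n)) e, hom_gens S M e.
Proof.
move=> Ssub Scomp; have [p [M SE]] := noetherian_row noethA Ssub.
have /choice[d dP] : forall i : 'I_p, exists s : seq int,
    (row i M : F) = \sum_(j <- s) hcomp gF j (row i M : F).
  by move=> i; have [s [_ _ sE]] := hcomp_sum gF (row i M : F); exists s.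
pose L := flatten [seq [seq (j, hcomp gF j (row i M : F)) | j <- d i] | i <- enum 'I_p].
pose x0 : int * F := (0, 0).
have LP q : q \in L -> gm_homog q.1 q.2 /\ S q.2.
  case/flatten_mapP => i _ /mapP[j _ ->] /=; split; first exact: (hcomp_homog gF).
  by apply: Scomp; rewrite SE; apply: row_span_row.
pose M' : 'M[A]_(size L, n) := \matrix_i (nth x0 L i).2.
exists (size L), M', (fun i => (nth x0 L i).1); split.
  by move=> i; rewrite rowK; exact: (LP _ (mem_nth _ (ltn_ord i))).1.
apply/seteqP; split; last first.
  by apply: row_spanS => // i; rewrite rowK; apply: (LP _ (mem_nth _ _)).2.
rewrite SE; apply: row_spanS; first exact: row_span_submod.
move=> i; rewrite [row i M]dP.
have [s0 sD _] := row_span_submod M'.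
rewrite big_seq; apply: (big_ind (row_span M') s0 sD) => j ji.
have jL : (j, hcomp gF j (row i M : F)) \in L.
  by apply/flatten_mapP; exists i; rewrite ?mem_enum //; apply: map_f.
have lt : (index (j, hcomp gF j (row i M : F)) L < size L)%N by rewrite index_mem.
have := row_span_row M' (Ordinal lt).
by rewrite rowK /= nth_index.
Qed.

(* With the least possible number of generators, a relation with a unit entry
   would make one of them redundant. *)
Lemma exists_min_gens (S : set 'rV[A]_n) : row_submod S ->
  (forall j (v : F), S v -> S (hcomp gF j v)) ->
  exists m (M : 'M[A]_(m, n)) (e : 'I_m -> nat),
    hom_gens S M (fun i => (e i)%:Z) /\
    forall u : 'rV_m, u *m M = 0 -> map_mx (@aug k A) u = 0.
Proof.
move=> Ssub Scomp.
have hex : exists m, `[< exists (M : 'M[A]_(m, n)) e, hom_gens S M e >].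
  have [m [M [e h]]] := exists_hom_gens Ssub Scomp.
  by exists m; apply/asboolP; exists M, e.
case: (ex_minnP hex) => m /asboolP[M [e [Mh SM]]] m_min.
have drop (a : 'I_m) (u : 'rV_m) : u *m M = 0 -> u 0 a = 1 -> False.
  case: m M e a u Mh SM m_min => [|m] M e a u Mh SM m_min; first by case: a.
  move=> uM ua; suff /m_min : `[< exists (M : 'M[A]_(m, n)) e, hom_gens S M e >].
    by rewrite ltnn.
  apply/asboolP; exists (row' a M), (fun i => e (fintype.lift a i)); split.
    move=> i; have := Mh (fintype.lift a i); congr (frow_homog _ _ _).
    by apply/rowP => j; rewrite !mxE.
  rewrite SM; apply/seteqP; split; last first.
    apply: row_spanS => [|i]; first exact: row_span_submod.
    rewrite (_ : row i _ = row (fintype.lift a i) M); first exact: row_span_row.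
    by apply/rowP => j; rewrite !mxE.
  have rlift i : row_span (row' a M) (row (fintype.lift a i) M).
    rewrite (_ : row _ M = row i (row' a M)); first exact: row_span_row.
    by apply/rowP => j; rewrite !mxE.
  apply: row_spanS => [|i]; first exact: row_span_submod.
  case: (unliftP a i) => [j|] ->; first exact: rlift.
  have [s0 sD sZ] := row_span_submod (row' a M).
  have -> : row a M = - \sum_(i | i != a) u 0 i *: row i M.
    apply/eqP; rewrite -addr_eq0; move: uM; rewrite mulmx_sum_row (bigD1 a) //=.
    by rewrite ua scale1r => ->.
  rewrite -scaleN1r; apply: (sZ (-1)); apply: (big_ind (row_span _) s0 sD) => j ja; apply: sZ.
  by case: (unliftP a j) ja => [b|] ->; rewrite ?eqxx // => _; apply: rlift.
have unit0 (u : 'rV_m) a : u *m M = 0 -> aug (u 0 a) = 0.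
  move=> uM; apply/eqP; apply: contrapT => /negP ua0.
  (* In the component of degree [e a] of the relation u, the entry at a is the scalar [aug (u 0 a)];
     rescaling turns it into 1, so [drop] applies. *)
  pose E := frow A e; pose u' := hcomp (gm_grading E) (e a) (u : E).
  have M0 : @degree0 _ _ E F (mulmxr M).
    move=> j v vj i b; rewrite ord1 /= mxE; apply: (grading_sum (@zhomog_grading k A)) => c _ _.
    rewrite -(subrK (e c) j) -addrA; apply: zhomog_mul; first exact: vj.
    by have := Mh c 0 b; rewrite mxE.
  have u'M : (u' : 'rV_m) *m M = 0.
    by have := hcomp_degree0 (e a) (u : E) M0; rewrite /= uM raddf0.
  have u'a : (u' : 'rV_m) 0 a = (aug (u 0 a))%:A.
    by rewrite hcomp_frow subrr hcomp_zhomog0.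
  apply: (drop a ((aug (u 0 a))^-1%:A *: (u' : 'rV_m))).
    by rewrite -scalemxAl u'M scaler0.
  by rewrite mxE u'a -scalerAl mul1r scalerA mulVf // scale1r.
(* The degrees [dg] are natural numbers, so a generator of negative degree is the zero row, and the
   basis vector at a is a relation with entry 1. *)
have e0 a : 0 <= e a.
  rewrite leNgt; apply/negP => ea; apply: (drop a (delta_mx 0 a)).
    rewrite -rowE; apply/rowP => b; rewrite [LHS]mxE [RHS]mxE.
    have : zhomog (e a - (dg b)%:Z) (M a b) by have := Mh a 0 b; rewrite mxE.
    have : e a - (dg b)%:Z < 0 by rewrite subr_lt0 (lt_le_trans ea).
    by case: (e a - _).
  by rewrite mxE !eqxx.
exists m, M, (fun i => `|e i|%N); split; last first.
  by move=> u uM; apply/rowP => a; rewrite !mxE; apply: unit0.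
by split=> // i; rewrite gez0_abs.
Qed.

End MinimalGenerators.

(* A minimal graded free resolution of the left module k: its i-th term is the
   module of rows of length mr_rank i, on a basis of degrees mr_deg, and the
   differential is right multiplication by mr_mx i. *)
Record minres (k : fieldType) (A : cgAlg k) := MinRes {
  mr_rank : nat -> nat;
  mr_deg : forall i, 'I_(mr_rank i) -> nat;
  mr_mx : forall i, 'M[A]_(mr_rank i.+1, mr_rank i);
  mr_homog : forall i a b,
    zhomog ((mr_deg a)%:Z - (mr_deg b)%:Z) (mr_mx i a b);
  mr_exact0 : forall v : 'rV_(mr_rank 0),
    map_mx (@aug k A) v = 0 <-> exists w, v = w *m mr_mx 0;
  mr_exact : forall i (v : 'rV_(mr_rank i.+1)),
    v *m mr_mx i = 0 <-> exists w, v = w *m mr_mx i.+1;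
  mr_min : forall i, map_mx (@aug k A) (mr_mx i) = 0;
  mr_base : 'I_(mr_rank 0);
  mr_base_unique : forall a, a = mr_base;
  mr_base_deg : mr_deg mr_base = 0%N
}.

Lemma dependent_sequence (T : nat -> Type) (Q : forall i, T i -> T i.+1 -> Prop)
    (t0 : T 0%N) : (forall i t, exists t', Q i t t') ->
  exists t : forall i, T i, t 0%N = t0 /\ forall i, Q i (t i) (t i.+1).
Proof.
move=> Qex; pose f := fix f i : T i :=
  if i is j.+1 return T i then projT1 (cid (Qex j (f j))) else t0.
by exists f; split=> // i; rewrite /=; case: cid.
Qed.

Section ExistsMinRes.
Variables (k : fieldType) (A : cgAlg k).
Hypothesis noethA : left_noetherian A.

Lemma exists_step n (dg : 'I_n -> nat) (S : set 'rV[A]_n) : row_submod S ->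
  (forall j (v : frow A (fun a => (dg a)%:Z)), S v -> S (hcomp (gm_grading _) j v)) ->
  exists m (M : 'M[A]_(m, n)) (e : 'I_m -> nat),
  [/\ forall a b, zhomog ((e a)%:Z - (dg b)%:Z) (M a b),
      forall u : 'rV_m, u *m M = 0 -> map_mx (@aug k A) u = 0
    & forall v, S v <-> exists w, v = w *m M].
Proof.
move=> Ssub Scomp; have [m [M [e [[Mh SM] Mmin]]]] := exists_min_gens noethA Ssub Scomp.
exists m, M, e; split=> //.
- by move=> a b; have := Mh a 0 b; rewrite mxE.
- by move=> v; rewrite SM; split=> [[u _ <-]|[u ->]]; exists u.
Qed.

(* The data of one term of the resolution: a graded free module and the submodule
   to be covered by the next term. *)
Record mr_term := MRTerm {
  mt_rank : nat;
  mt_deg : 'I_mt_rank -> nat;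
  mt_ker : set 'rV[A]_mt_rank;
  mt_ker_submod : row_submod mt_ker;
  mt_ker_comp : forall j (v : frow A (fun a => (mt_deg a)%:Z)),
    mt_ker v -> mt_ker (hcomp (gm_grading _) j v);
  mt_ker_aug : forall v, mt_ker v -> map_mx (@aug k A) v = 0
}.

Arguments mt_ker : clear implicits.

Definition mt_covers (s t : mr_term) (M : 'M[A]_(mt_rank t, mt_rank s)) : Prop :=
  [/\ forall a b, zhomog ((mt_deg a)%:Z - (mt_deg b)%:Z) (M a b),
      forall v, mt_ker s v <-> exists w, v = w *m M
    & forall w : 'rV_(mt_rank t), mt_ker t w <-> w *m M = 0].

Lemma exists_next_term (s : mr_term) : exists t M, @mt_covers s t M.
Proof.
have [m [M [e [Mh Mmin MP]]]] := exists_step (@mt_ker_submod s) (@mt_ker_comp s).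
pose E := frow A (fun a => (e a)%:Z).
pose F := frow A (fun a => (@mt_deg s a)%:Z).
have M0 : @degree0 _ _ E F (mulmxr M).
  move=> j v vj i b; rewrite ord1 /= mxE.
  apply: (grading_sum (@zhomog_grading k A)) => c _ _.
  rewrite -(subrK (e c)%:Z j) -addrA; apply: zhomog_mul (Mh c b); exact: vj.
have ksub : row_submod [set w : 'rV_m | w *m M = 0].
  split=> [|x y /= x0 y0|a x /= x0]; first by rewrite /= mul0mx.
    by rewrite mulmxDl x0 y0 addr0.
  by rewrite -scalemxAl x0 scaler0.
have kcomp j (v : E) : (v : 'rV_m) *m M = 0 -> (hcomp (gm_grading E) j v : 'rV_m) *m M = 0.
  by move=> v0; have := hcomp_degree0 j v M0; rewrite /= v0 raddf0.
by exists (MRTerm ksub kcomp Mmin), M.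
Qed.

Lemma exists_first_term : exists (s : mr_term) (b : 'I_(mt_rank s)),
  [/\ forall a, a = b, mt_deg b = 0%N & forall v, mt_ker s v <-> map_mx (@aug k A) v = 0].
Proof.
pose S := [set v : 'rV[A]_1 | map_mx (@aug k A) v = 0].
have Ssub : row_submod S.
  split=> [|x y /= x0 y0|a x /= x0]; first by rewrite /S /= map_mx0.
    by rewrite /S /= map_mxD x0 y0 addr0.
  by rewrite /S /= map_mxZ x0 scaler0.
have Scomp j (v : frow A (fun=> 0%N%:Z)) : S v -> S (hcomp (gm_grading _) j v).
  move=> /rowP v0; apply/rowP => b; have := v0 b; rewrite !mxE hcomp_frow subr0.
  have [->|j0] := eqVneq j 0; first by rewrite hcomp_zhomog0 => ->; rewrite scale0r raddf0.
  by move=> _; apply: aug_zhomog j0; apply: hcomp_homog.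
exists (@MRTerm 1 (fun=> 0%N) S Ssub Scomp (fun _ h => h)), ord0; split=> // a.
exact: ord1.
Qed.

Lemma exists_minres : inhabited (minres A).
Proof.
have [s [b [bu bd s0]]] := exists_first_term.
have [t [t0 tP]] := @dependent_sequence (fun=> mr_term)
  (fun _ s t => exists M, @mt_covers s t M) s (fun _ => exists_next_term).
pose M i := projT1 (cid (tP i)).
have MP i : mt_covers (M i) := projT2 (cid (tP i)).
rewrite -{s}t0 in b bu bd s0.
split; apply: (@MinRes k A (fun i => mt_rank (t i)) (fun i => @mt_deg (t i)) M _ _ _ _ b) => //.
- by move=> i; case: (MP i).
- by move=> v; rewrite -s0; case: (MP 0%N).
- by move=> i v; case: (MP i) => _ _ <-; case: (MP i.+1).
- move=> i; apply/row_matrixP => a; rewrite row0 -map_row; apply: mt_ker_aug.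
  by case: (MP i) => _ -> _; exists (delta_mx 0 a); rewrite -rowE.
Qed.

End ExistsMinRes.

(** * Comparison of graded resolutions *)

Section GradedProjective.
Variables (k : fieldType) (A : cgAlg k).

Lemma gm_zact (M : grMod A) i j a (x : M) : zhomog i a -> gm_homog j x ->
  gm_homog (i + j) (a *: x).
Proof.
case: i => i ai; first exact: gm_act.
by rewrite (ai : a = 0) scale0r => _; apply: (grading0 (gm_grading M)).
Qed.

(** Only the image of f has to lie in the image of p, so that exactness of a complex gives lifts
    without passing to kernels. *)
Definition gr_projective (P : grMod A) : Prop :=
  forall (X Y : grMod A) (p : {linear X -> Y}) (f : {linear P -> Y}),
    degree0 p -> degree0 f -> (forall x, exists y, p y = f x) ->
  exists2 g : {linear P -> X}, degree0 g & forall x, p (g x) = f x.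

Lemma homog_lift (X Y : grMod A) (p : {linear X -> Y}) j y : degree0 p ->
  gm_homog j y -> (exists x, p x = y) -> exists2 x, gm_homog j x & p x = y.
Proof.
move=> p0 yj [x px]; exists (hcomp (gm_grading X) j x); first exact: hcomp_homog.
by rewrite -(hcomp_degree0 j x p0) px hcomp_id.
Qed.

Lemma free_cover_projective (M : grMod A) : gr_projective (free_cover M).
Proof.
move=> X Y p f p0 f0 fp.
have /choice[g gP] : forall h : homog_elt M, exists x : X,
    gm_homog (val h).1 x /\ p x = f << h >>.
  move=> h; have [|x xj px] := homog_lift p0 (j := (val h).1) (y := f << h >>) _ (fp _).
    apply: f0 => h'; rewrite coeffU mul1r; case: eqP => [<-|_]; last exact: zhomog0.
    by rewrite subrr; apply/cg_conn; exists 1; rewrite scale1r.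
  by exists x.
exists (fglift g) => [j x xj|x].
  rewrite -[x]freeg_sumE raddf_sum /=; apply: (grading_sum (gm_grading X)) => h _ _.
  by rewrite liftU -[j](subrK (val h).1); apply: gm_zact => //; apply: (gP h).1.
rewrite -[x]freeg_sumE !raddf_sum; apply: eq_bigr => h _.
rewrite /= liftU linearZ (gP h).2 -linearZ; congr (f _).
by apply/eqP/freeg_eqP => h'; rewrite coeffZ !coeffU mul1r.
Qed.

Lemma frow_projective n (dg : 'I_n -> int) : gr_projective (frow A dg).
Proof.
move=> X Y p f p0 f0 fp.
have /choice[g gP] : forall a : 'I_n, exists x : X,
    gm_homog (dg a) x /\ p x = f (delta_mx 0 a).
  move=> a; have [|x xj px] := homog_lift p0 (j := dg a) (y := f (delta_mx 0 a)) _ (fp _).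
    by apply: f0; apply: frow_delta.
  by exists x.
pose G (v : frow A dg) : X := \sum_a (v : 'rV_n) 0 a *: g a.
have Glin : linear G.
  move=> c u v; rewrite /G scaler_sumr -big_split /=; apply: eq_bigr => a _.
  by rewrite !mxE scalerDl scalerA.
pose GL := GRing.isLinear.Build A (frow A dg) X _ G Glin.
pose g' : {linear frow A dg -> X} := HB.pack G GL.
exists g' => [j v vj|v].
  apply: (grading_sum (gm_grading X)) => a _ _.
  by rewrite -[j](subrK (dg a)); apply: gm_zact (gP a).1; apply: vj.
rewrite [in RHS](row_sum_delta (v : 'rV_n)) !linear_sum; apply: eq_bigr => a _.
by rewrite !linearZ /= (gP a).2.
Qed.

Record grres (M : grMod A) := GrRes {
  rs_mod :> nat -> grMod A;
  rs_aug : {linear rs_mod 0%N -> M};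
  rs_d : forall i, {linear rs_mod i.+1 -> rs_mod i};
  rs_aug0 : degree0 rs_aug;
  rs_d0 : forall i, degree0 (rs_d i);
  rs_surj : forall y, exists x, rs_aug x = y;
  rs_exact0 : forall y, rs_aug y = 0 <-> exists x, rs_d 0%N x = y;
  rs_exact : forall i y, rs_d i y = 0 <-> exists x, rs_d i.+1 x = y;
  rs_proj : forall i, gr_projective (rs_mod i)
}.

Variable M : grMod A.

Lemma rs_augd (P : grres M) x : rs_aug P (rs_d P 0%N x) = 0.
Proof. by apply/rs_exact0; exists x. Qed.

Lemma rs_dd (P : grres M) i x : rs_d P i (rs_d P i.+1 x) = 0.
Proof. by apply/rs_exact; exists x. Qed.

Lemma comparison (P Q : grres M) : exists u : forall i, {linear P i -> Q i},
  [/\ forall i, degree0 (u i), forall x, rs_aug Q (u 0%N x) = rs_aug P x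
    & forall i x, rs_d Q i (u i.+1 x) = u i (rs_d P i x)].
Proof.
(* The invariant carried through the recursion says that f after the differential of P lands in the
   image of the next differential of Q; this is what the next lift needs. *)
pose T i := {f : {linear P i -> Q i} |
  degree0 f /\ forall x, exists y, rs_d Q i y = f (rs_d P i x)}.
have [|f f0 fP] := rs_proj (i := 0%N) (@rs_aug0 _ Q) (@rs_aug0 _ P).
  by move=> x; apply: rs_surj.
have t0P : degree0 f /\ forall x, exists y, rs_d Q 0 y = f (rs_d P 0 x).
  by split=> // x; apply/rs_exact0; rewrite fP rs_augd.
pose R i (t : T i) (t' : T i.+1) := forall x, rs_d Q i (sval t' x) = sval t (rs_d P i x).
have [i [g [g0 gP]]|t [t0E tR]] := @dependent_sequence T R (exist _ f t0P).
  have [|//|g' g'0 g'P] := rs_proj (i := i.+1) (@rs_d0 _ Q i) (f := g \o rs_d P i).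
    by move=> j x xj; apply/g0/rs_d0.
  have tP : degree0 g' /\ forall x, exists y, rs_d Q i.+1 y = g' (rs_d P i.+1 x).
    by split=> // x; apply/rs_exact; rewrite g'P /= rs_dd linear0.
  by exists (exist _ g' tP).
exists (fun i => sval (t i)); split=> [i|x|i x]; last exact: tR.
  by case: (svalP (t i)).
by rewrite t0E.
Qed.

Lemma null_homotopy (P Q : grres M) (f : forall i, {linear P i -> Q i}) :
  (forall i, degree0 (f i)) -> (forall x, rs_aug Q (f 0%N x) = 0) ->
  (forall i x, rs_d Q i (f i.+1 x) = f i (rs_d P i x)) ->
  exists h : forall i, {linear P i -> Q i.+1},
  [/\ forall i, degree0 (h i), forall x, f 0%N x = rs_d Q 0%N (h 0%N x)
    & forall i x, f i.+1 x = rs_d Q i.+1 (h i.+1 x) + h i (rs_d P i x)].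
Proof.
move=> f0 faug fd.
pose T i := {h : {linear P i -> Q i.+1} |
  degree0 h /\ forall x, exists y, rs_d Q i.+1 y = f i.+1 x - h (rs_d P i x)}.
have [|h h0 hP] := rs_proj (i := 0%N) (@rs_d0 _ Q 0%N) (@f0 0%N).
  by move=> x; apply/rs_exact0; rewrite faug.
have t0P : degree0 h /\ forall x, exists y, rs_d Q 1 y = f 1%N x - h (rs_d P 0 x).
  by split=> // x; apply/rs_exact; rewrite linearB hP fd subrr.
pose R i (t : T i) (t' : T i.+1) :=
  forall x, f i.+1 x = rs_d Q i.+1 (sval t' x) + sval t (rs_d P i x).
have [i [g [g0 gP]]|t [t0E tR]] := @dependent_sequence T R (exist _ h t0P).
  have [|//|g' g'0 g'P] := rs_proj (i := i.+1) (@rs_d0 _ Q i.+1)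
      (f := f i.+1 \- (g \o rs_d P i)).
    by move=> j x xj; apply: (gradingB (gm_grading _)); [apply: f0|apply/g0/rs_d0].
  have tP : degree0 g' /\
      forall x, exists y, rs_d Q i.+2 y = f i.+2 x - g' (rs_d P i.+1 x).
    split=> // x; apply/rs_exact.
    by rewrite linearB g'P /= rs_dd linear0 subr0 fd subrr.
  by exists (exist _ g' tP) => x /=; rewrite g'P /= subrK.
exists (fun i => sval (t i)); split=> [i|x|i x]; last exact: tR.
  by case: (svalP (t i)).
by rewrite t0E hP.
Qed.

Lemma chain_homotopy (P Q : grres M) (u : forall i, {linear P i -> Q i})
    (v : forall i, {linear Q i -> P i}) :
  (forall i, degree0 (u i)) -> (forall x, rs_aug Q (u 0%N x) = rs_aug P x) ->
  (forall i x, rs_d Q i (u i.+1 x) = u i (rs_d P i x)) ->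
  (forall i, degree0 (v i)) -> (forall x, rs_aug P (v 0%N x) = rs_aug Q x) ->
  (forall i x, rs_d P i (v i.+1 x) = v i (rs_d Q i x)) ->
  exists h : forall i, {linear P i -> P i.+1},
  [/\ forall i, degree0 (h i), forall x, v 0%N (u 0%N x) = x + rs_d P 0%N (h 0%N x)
    & forall i x, v i.+1 (u i.+1 x) = x + rs_d P i.+1 (h i.+1 x) + h i (rs_d P i x)].
Proof.
move=> u0 uaug ud v0 vaug vd.
have [||i x|h [h0 hP0 hP]] := @null_homotopy P P (fun i => (v i \o u i) \- idfun).
- by move=> i j x xj; apply: (gradingB (gm_grading _)) => //; apply/v0/u0.
- by move=> x; rewrite linearB /= vaug uaug subrr.
- by rewrite linearB /= vd ud.
exists h; split=> // [x|i x].
  by rewrite -hP0 /= addrC subrK.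
by rewrite -addrA -hP /= addrC subrK.
Qed.
End GradedProjective.

Section Resolutions.
Variables (k : fieldType) (A : cgAlg k).

Definition free_grres (M : grMod A) : grres M :=
  GrRes (@cover_map_degree0 _ _ M) (@res_diff_degree0 _ _ M) (@cover_map_surj _ _ M)
    (@res_exact0 _ _ M) (@res_exact _ _ M) (fun i => @free_cover_projective _ _ _).

Variable F : minres A.

Definition mr_mod i : grMod A := frow A (fun a => (@mr_deg _ _ F i a)%:Z).

Definition mr_d i : {linear mr_mod i.+1 -> mr_mod i} := mulmxr (mr_mx F i).

Fact mr_d0 i : degree0 (mr_d i).
Proof.
move=> j v vj a b; rewrite mxE; apply: (grading_sum (@zhomog_grading k A)) => c _ _.
rewrite -(subrK (mr_deg c)%:Z j) -addrA; apply: zhomog_mul; first exact: vj.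
exact: mr_homog.
Qed.

Definition mr_aug_fun (v : mr_mod 0) : triv_mod A :=
  lquot_pi (@pos_part _ A) ((v : 'rV_(mr_rank F 0)) 0 (mr_base F)).

Fact mr_aug_linear : linear mr_aug_fun.
Proof. by move=> a u v; rewrite /mr_aug_fun !mxE linearD linearZ_LR. Qed.
HB.instance Definition _ := GRing.isLinear.Build A (mr_mod 0) (triv_mod A) _
  mr_aug_fun mr_aug_linear.

Lemma triv_pi_eq0 (x : A^o) : lquot_pi (@pos_part _ A) x = 0 <-> aug x = 0.
Proof.
rewrite -mem_pos_part -[0](linear0 (lquot_pi (@pos_part _ A))).
by split=> [/lquot_piP|h]; rewrite ?subr0 //; apply/lquot_piP; rewrite subr0.
Qed.

Fact min_grres_subproof :
  [/\ degree0 mr_aug_fun, forall y, exists x, mr_aug_fun x = y,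
    forall y, mr_aug_fun y = 0 <-> exists x, mr_d 0 x = y
  & forall i y, mr_d i y = 0 <-> exists x, mr_d i.+1 x = y].
Proof.
split.
- move=> j v vj; exists ((v : 'rV_(mr_rank F 0)) 0 (mr_base F)) => //.
  by have := vj 0 (mr_base F); rewrite mr_base_deg subr0.
- move=> y; exists (repr (y : @Quotient.quot _ (zpred (@pos_part _ A)))
      *: (delta_mx 0 (mr_base F) : 'rV_(mr_rank F 0))).
  by rewrite /mr_aug_fun !mxE !eqxx mulr1; apply: lquot_reprK.
- move=> y; rewrite triv_pi_eq0; have -> : (exists x, mr_d 0 x = y) <->
      exists w, (y : 'rV_(mr_rank F 0)) = w *m mr_mx F 0.
    by split=> [[x <-]|[w ->]]; [exists x|exists w].
  rewrite -mr_exact0; split=> [y0|/matrixP/(_ 0 (mr_base F))]; last by rewrite !mxE.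
  by apply/matrixP => a b; rewrite !mxE ord1 (mr_base_unique b).
move=> i y; have -> : (exists x, mr_d i.+1 x = y) <->
    exists w, (y : 'rV_(mr_rank F i.+1)) = w *m mr_mx F i.+1.
  by split=> [[x <-]|[w ->]]; [exists x|exists w].
exact: mr_exact.
Qed.

Definition min_grres : grres (triv_mod A) :=
  @GrRes _ _ _ mr_mod mr_aug_fun mr_d
    (let: And4 h _ _ _ := min_grres_subproof in h) mr_d0
    (let: And4 _ h _ _ := min_grres_subproof in h)
    (let: And4 _ _ h _ := min_grres_subproof in h)
    (let: And4 _ _ _ h := min_grres_subproof in h)
    (fun i => @frow_projective _ _ _ _).

End Resolutions.

(** * Ext and Tor through the minimal resolution *)

Section HomologyElements.
Variables (R : nzRingType) (U V W : lmodType R).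
Variables (f : {linear U -> V}) (g : {linear V -> W}).

Lemma homology_pi_eq0 (v : submod (lker g)) :
  lquot_pi (@boundary _ _ _ _ f g) v = 0 <-> exists u, val v = f u.
Proof.
rewrite -[0](linear0 (lquot_pi (@boundary _ _ _ _ f g))).
split=> [/lquot_piP|h]; first by rewrite subr0 => /asboolP.
by apply/lquot_piP; rewrite subr0; apply/asboolP.
Qed.

Lemma homology_eq0 : (forall x : homology f g, x = 0) ->
  forall v, g v = 0 -> exists u, v = f u.
Proof.
move=> h0 v gv; have vk : v \in lker g by rewrite unfold_in gv.
exact/(homology_pi_eq0 (Submod vk)).
Qed.

Lemma homology_neq0 (x : homology f g) : x <> 0 ->
  exists2 v, g v = 0 & ~ exists u, v = f u.
Proof.
move=> x0; pose v := repr (x : @Quotient.quot _ (zpred (@boundary _ _ _ _ f g))).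
exists (val v); first exact/eqP/(submodP v).
by move=> /homology_pi_eq0 v0; apply: x0; rewrite -v0; apply/esym/lquot_reprK.
Qed.

End HomologyElements.

Section ExtCocycles.
Variables (k : fieldType) (A : cgAlg k) (M N : grMod A) (n : int).

Definition dgHom (P : grMod A) (phi : P -> N) : Prop :=
  (forall a x y, phi (a *: x + y) = a *: phi x + phi y) /\
  forall j x, gm_homog j x -> gm_homog (j + n) (phi x).

Definition coboundary i : (free_res M i -> N) -> Prop :=
  if i is j.+1 return (free_res M i -> N) -> Prop then
    fun phi => exists psi : free_res M j -> N,
      dgHom psi /\ forall x, phi x = psi (res_diff M j x)
  else fun phi => forall x, phi x = 0.

Lemma Ext_eq0 i (phi : free_res M i -> N) : (forall x : Ext M N i n, x = 0) ->
  dgHom phi -> (forall x, phi (res_diff M i x) = 0) -> coboundary phi.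
Proof.
case: i phi => [|i] phi /homology_eq0 E0 dphi cphi.
  have ph : phi \in @hom_pred _ _ (free_res M 0) N n by apply/asboolP.
  have [|u /(congr1 val) /= uE] := E0 (Submod ph).
    by apply: val_inj; apply/funext => x; apply: cphi.
  by move=> x; rewrite uE.
have ph : phi \in @hom_pred _ _ (free_res M i.+1) N n by apply/asboolP.
have [|u /(congr1 val) /= uE] := E0 (Submod ph).
  by apply: val_inj; apply/funext => x; apply: cphi.
exists (val u); split; first exact/asboolP/(submodP u).
by move=> x; rewrite uE.
Qed.

Lemma Ext_neq0 i (x : Ext M N i n) : x <> 0 -> exists phi : free_res M i -> N,
  [/\ dgHom phi, forall x, phi (res_diff M i x) = 0 & ~ coboundary phi].
Proof.
case: i x => [|i] x /homology_neq0[v gv nv].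
  exists (val v); split.
  - exact/asboolP/(submodP v).
  - by move=> y; have /(congr1 val) /(congr1 (@^~ y)) := gv.
  - move=> v0; apply: nv; exists 0; apply: val_inj; apply/funext => y; exact: v0.
exists (val v); split.
- exact/asboolP/(submodP v).
- by move=> y; have /(congr1 val) /(congr1 (@^~ y)) := gv.
- move=> [psi [dpsi vE]]; apply: nv.
  have ph : psi \in @hom_pred _ _ (free_res M i) N n by apply/asboolP.
  by exists (Submod ph); apply: val_inj; apply/funext => y; apply: vE.
Qed.

End ExtCocycles.

Section ExtMinimal.
Variables (k : fieldType) (A : cgAlg k) (F : minres A).
Let k_ := triv_mod A.
Let P := min_grres F.
Let Q := free_grres k_.

Definition dual_homog i n : set 'cV[A]_(mr_rank F i) :=
  mx_homog (fun a _ => - (mr_deg a)%:Z) n.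

(** The cocycle w is moved to the functorial resolution along v and bounded there by psi; psi is
    then brought back along u and corrected by the homotopy between v u and the identity. *)
Lemma Ext_eq0_min i n (w : 'cV_(mr_rank F i)) :
  (forall x : Ext k_ (reg_mod A) i n, x = 0) -> dual_homog n w ->
  mr_mx F i *m w = 0 -> dual_boundary (mr_mx F) w.
Proof.
move=> E0 wn Ew.
have [u [u0 uaug ud]] := comparison P Q.
have [v [v0 vaug vd]] := comparison Q P.
have [h [h0 hP0 hP]] := chain_homotopy u0 uaug ud v0 vaug vd.
pose phi (x : free_res k_ i) : reg_mod A := ((v i x : 'rV_(mr_rank F i)) *m w) 0 0.
have dphi : dgHom n phi.
  split=> [a x y|j x xj].
    by rewrite /phi linearP mulmxDl -scalemxAl !mxE.
  rewrite /phi mxE; apply: (grading_sum (@zhomog_grading k A)) => b _ _.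
  rewrite -(subrK (mr_deg b)%:Z j) -addrA; apply: zhomog_mul.
    by have := v0 i j x xj 0 b.
  by have := wn b 0; rewrite opprK addrC.
have cphi x : phi (res_diff k_ i x) = 0.
  rewrite /phi; have := vd i x; rewrite /= => <-.
  by rewrite -mulmxA Ew mulmx0 mxE.
have := Ext_eq0 E0 dphi cphi.
have dw (x : 'rV_(mr_rank F i.+1)) : x *m mr_mx F i *m w = 0.
  by rewrite -mulmxA Ew mulmx0.
clear E0 wn Ew dphi cphi; rewrite {}/phi; case: i w dw => [|i] w dw.
  move=> phi0; apply/matrixP => a b; rewrite [RHS]mxE ord1.
  have := phi0 (u 0%N (delta_mx 0 a : 'rV_(mr_rank F 0))).
  by rewrite hP0 mulmxDl dw addr0 -rowE !mxE.
move=> [psi [[psil _] psiE]].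
(* Since w vanishes on boundaries, evaluating it on v u x = x + d h x + h d x gives w(x) = psi(u d
   x) - w(h d x), which is [theta] at d x. *)
pose theta (x : 'rV_(mr_rank F i)) : A :=
  psi (u i x) - ((h i x : 'rV_(mr_rank F i.+1)) *m w) 0 0.
have thl : forall a x y, theta (a *: x + y) = a * theta x + theta y.
  move=> a x y; rewrite /theta linearP psil linearP mulmxDl -scalemxAl !mxE.
  by rewrite mulrBr opprD addrACA.
have th0 : theta 0 = 0.
  by have := thl (-1) 0 0; rewrite scaler0 addr0 mulN1r addNr.
have thE (x : 'rV_(mr_rank F i)) : theta x = \sum_b x 0 b * theta (delta_mx 0 b).
  rewrite {1}[x]row_sum_delta.
  elim: (index_enum _) => [|b r IHr]; first by rewrite !big_nil.
  by rewrite !big_cons thl IHr.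
exists (\col_b theta (delta_mx 0 b)) => //; apply/matrixP => a b; rewrite ord1 {b}.
transitivity (theta (row a (mr_mx F i))).
  by rewrite thE mxE; apply: eq_bigr => b _; rewrite !mxE.
have := psiE (u i.+1 (delta_mx 0 a : 'rV_(mr_rank F i.+1))).
have -> : res_diff k_ i (u i.+1 (delta_mx 0 a : 'rV_(mr_rank F i.+1)))
    = u i (row a (mr_mx F i)) by rewrite rowE; apply: ud.
rewrite hP /theta => <-; rewrite !mulmxDl dw addr0 -rowE [(row _ _ + _) _ _]mxE.
by rewrite -[rs_d _ _ _]rowE addrK mxE.
Qed.

(* A non-bounding cocycle pulls back to a nonzero one: otherwise the homotopy on
   the functorial resolution would exhibit it as a coboundary. *)
Lemma Ext_neq0_min i n (x : Ext k_ (reg_mod A) i n) : x <> 0 ->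
  exists w : 'cV_(mr_rank F i), [/\ dual_homog n w, mr_mx F i *m w = 0 & w <> 0].
Proof.
move=> /Ext_neq0[phi [[phil phih] cphi nphi]].
have [u [u0 uaug ud]] := comparison P Q.
have [v [v0 vaug vd]] := comparison Q P.
have [h [h0 hP0 hP]] := chain_homotopy v0 vaug vd u0 uaug ud.
have phi0 : phi 0 = 0.
  by have := phil (-1) 0 0; rewrite scaler0 addr0 scaleN1r addNr.
have phiD y z : phi (y + z) = phi y + phi z.
  by have := phil 1 y z; rewrite !scale1r.
pose w : 'cV_(mr_rank F i) := \col_b phi (u i (delta_mx 0 b : 'rV_(mr_rank F i))).
have wE (y : 'rV_(mr_rank F i)) : (y *m w) 0 0 = phi (u i y).
  rewrite {2}[y]row_sum_delta linear_sum mxE.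
  elim: (index_enum _) => [|b r IHr]; first by rewrite !big_nil.
  by rewrite !big_cons linearZ_LR phil IHr mxE.
exists w; split.
- move=> b c; rewrite mxE opprK addrC; apply: phih; apply: u0; exact: frow_delta.
- apply/matrixP => a b; rewrite [RHS]mxE ord1.
  transitivity ((row a (mr_mx F i) *m w) 0 0); first by rewrite -row_mul [RHS]mxE.
  rewrite wE rowE; have := ud i (delta_mx 0 a : 'rV_(mr_rank F i.+1)).
  by move=> /= <-; apply: cphi.
move=> w0; apply: nphi.
have phiuv y : phi (u i (v i y)) = 0 by rewrite -wE w0 mulmx0 mxE.
case: i phi cphi w w0 phil phih phi0 phiD wE phiuv {x} =>
    [|i] phi cphi w w0 phil phih phi0 phiD wE phiuv.
  by move=> y; have := phiuv y; rewrite hP0 phiD cphi addr0.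
exists (fun y => - phi (h i y)); split; first split.
- by move=> a y z; rewrite linearP phil opprD scalerN.
- move=> j y yj; apply: (gradingN (gm_grading (reg_mod A))).
  by apply: phih; apply: h0.
- move=> y; have := phiuv y; rewrite hP !phiD cphi addr0 => /eqP.
  by rewrite addr_eq0 => /eqP.
Qed.

End ExtMinimal.

Section TensorFunctional.
Variables (k : fieldType) (A : cgAlg k) (M : grMod (opp_alg A)) (N : grMod A).

Lemma tensDr (m : M) (x y : N) : tens m (x + y) = tens m x + tens m y.
Proof.
apply/eqP; rewrite -subr_eq0 opprD addrA -!linearB; apply/eqP/tens_rel0.
by constructor 2; exists m, x, y.
Qed.

Lemma tensDl (m m' : M) (x : N) : tens (m + m') x = tens m x + tens m' x.
Proof.
apply/eqP; rewrite -subr_eq0 opprD addrA -!linearB; apply/eqP/tens_rel0.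
by constructor 1; exists m, m', x.
Qed.

Lemma tens0l (x : N) : tens (0 : M) x = 0.
Proof. by apply: (addrI (tens 0 x)); rewrite -tensDl !addr0. Qed.

Lemma tens0r (m : M) : tens m (0 : N) = 0.
Proof. by apply: (addrI (tens m 0)); rewrite -tensDr !addr0. Qed.

Lemma tens_ract (m : M) a (x : N) : tens (ract m a) x = tens m (a *: x).
Proof.
apply/eqP; rewrite -subr_eq0 -!linearB; apply/eqP/tens_rel0.
by constructor 3; exists m, a, x.
Qed.

Variable b : M -> N -> k.
Hypotheses (bDl : forall m m' x, b (m + m') x = b m x + b m' x)
  (bDr : forall m x y, b m (x + y) = b m x + b m y)
  (b_ract : forall m a x, b (ract m a) x = b m (a *: x))
  (b_scale : forall m c x, b (ract m c%:A) x = c * b m x).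

Let b_pre : {linear {freeg (M * N)%type / k} -> k^o} :=
  fglift (fun p : M * N => b p.1 p.2 : k^o).

Fact tensor_functional_subproof x : x \in lspan (@tensor_rel _ _ M N) -> b_pre x = 0.
Proof.
have bU c m y : b_pre << c *g (m, y) >> = c * b m y by rewrite /= liftU.
move=> /asboolP[s sR ->]; rewrite linear_sum big_seq big1 // => p /sR pR.
rewrite linearZ_LR; suff -> : b_pre p.2 = 0 by rewrite scaler0.
case: pR => [[m [m' [y ->]]]|[m [y [y' ->]]]|[m [a [y ->]]]|[c [m [y ->]]]].
- by rewrite !linearB !bU !mul1r bDl addrAC addrK subrr.
- by rewrite !linearB !bU !mul1r bDr addrAC addrK subrr.
- by rewrite !linearB !bU !mul1r b_ract subrr.
- by rewrite !linearB !bU mul1r b_scale subrr.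
Qed.

Definition tensor_functional : {linear tensor M N -> k^o} :=
  lquot_map tensor_functional_subproof.

Lemma tensor_functionalE m y : tensor_functional (tens m y) = b m y.
Proof.
by rewrite [LHS](lquot_map_pi tensor_functional_subproof) /= liftU scale1r.
Qed.

End TensorFunctional.

Lemma tensor_ind (k : fieldType) (A : cgAlg k) (M : grMod (opp_alg A)) (N : grMod A)
    (f g : {linear tensor M N -> k^o}) :
  (forall m x, f (tens m x) = g (tens m x)) -> f =1 g.
Proof.
move=> fg t; rewrite -[t]lquot_reprK; set z := repr _; rewrite -[z]freeg_sumE !linear_sum.
apply: eq_bigr => -[m x] _.
have -> : << coeff (m, x) z *g (m, x) >> = coeff (m, x) z *: << (m, x) >>
    :> {freeg (M * N)%type / k}.
  by apply/eqP/freeg_eqP => p; rewrite coeffZ !coeffU mul1r.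
by rewrite !linearZ_LR; congr (_ *: _); apply: fg.
Qed.

Section TorMinimal.
Variables (k : fieldType) (A : cgAlg k) (F : minres A).
Let k_ := triv_mod A.
Let kop := triv_mod (opp_alg A).
Let P := min_grres F.
Let Q := free_grres k_.

Definition triv_aug (m : kop) : k :=
  aug (repr (m : @Quotient.quot _ (zpred (@pos_part _ (opp_alg A)))) : A).

Lemma triv_aug_pi (x : opp_alg A) :
  triv_aug (lquot_pi (@pos_part _ (opp_alg A)) x) = aug (x : A).
Proof.
rewrite /triv_aug; set y := repr _.
have /lquot_piP/mem_pos_part : lquot_pi (@pos_part _ (opp_alg A)) y
  = lquot_pi (@pos_part _ (opp_alg A)) x by apply: lquot_reprK.
by rewrite aug_opp raddfB => /eqP; rewrite subr_eq0 => /eqP.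
Qed.

Lemma triv_augD m m' : triv_aug (m + m') = triv_aug m + triv_aug m'.
Proof.
rewrite -[m]lquot_reprK -[m']lquot_reprK -linearD !triv_aug_pi.
by rewrite [LHS]raddfD.
Qed.

Lemma triv_aug_ract m (a : A) : triv_aug (ract m a) = triv_aug m * aug a.
Proof.
rewrite -[m]lquot_reprK /ract -linearZ_LR !triv_aug_pi.
by rewrite [LHS](rmorphM (@aug k A)).
Qed.

(** The witness is the class of 1 (x) u(e_a). The functional sending m (x) y to aug(m) aug((v y)_a)
    takes the value 1 on it, and vanishes on boundaries because the matrices of F have entries in
    A_{>=1}. *)
Lemma Tor_neq0_min i (a : 'I_(mr_rank F i)) :
  exists x : Tor kop k_ i (mr_deg a)%:Z, x <> 0.
Proof.
have [u [u0 uaug ud]] := comparison P Q.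
have [v [v0 vaug vd]] := comparison Q P.
have [h [h0 hP0 hP]] := chain_homotopy u0 uaug ud v0 vaug vd.
pose one : kop := lquot_pi (@pos_part _ (opp_alg A)) 1.
have one0 : gm_homog 0 one.
  by exists 1 => //; apply/cg_conn; exists 1; rewrite scale1r.
pose e (j : nat) b : mr_mod F j := (delta_mx 0 b : 'rV_(mr_rank F j)).
have tx : tens one (u i (e i a)) \in @tensor_homog _ _ kop (free_res k_ i) (mr_deg a)%:Z.
  apply: mem_lspan; exists 0, (mr_deg a)%:Z, one, (u i (e i a)); split=> //.
    by apply: u0; apply: frow_delta.
pose x : grTensor kop (free_res k_ i) (mr_deg a) := Submod tx.
have cyc j (b : 'I_(mr_rank F j.+1)) :
    tens one (res_diff k_ j (u j.+1 (e j.+1 b))) = 0.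
  have := ud j (e j.+1 b); rewrite /= => ->.
  rewrite -rowE (row_sum_delta (row b _)) linear_sum.
  rewrite (big_morph (tens one) (@tensDr _ _ _ _ one) (@tens0r _ _ _ _ one)) big1 // => c _.
  rewrite linearZ_LR -tens_ract.
  suff -> : ract one ((row b (mr_mx F j)) 0 c) = 0 by rewrite tens0l.
  rewrite /ract /one -linearZ_LR; apply/triv_pi_eq0; rewrite aug_opp.
  set c' := (row _ _) _ _; rewrite (_ : aug _ = aug c'); last first.
    by congr aug; exact: (@mul1r A c').
  by have /matrixP/(_ b c) := mr_min F j; rewrite /c' !mxE.
pose beta (m : kop) (y : free_res k_ i) : k :=
  triv_aug m * aug ((v i y : 'rV_(mr_rank F i)) 0 a).
have bDl m m' y : beta (m + m') y = beta m y + beta m' y.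
  by rewrite /beta triv_augD mulrDl.
have bDr m y y' : beta m (y + y') = beta m y + beta m y'.
  by rewrite /beta linearD mxE raddfD /= mulrDr.
have br m c y : beta (ract m c) y = beta m (c *: y).
  by rewrite /beta triv_aug_ract linearZ_LR mxE rmorphM /= mulrA.
have bs m c y : beta (ract m c%:A) y = c * beta m y.
  by rewrite /beta triv_aug_ract aug_scalar mulrAC mulrC.
pose L := tensor_functional bDl bDr br bs.
have Lx : L (tens one (u i (e i a))) = 1.
  rewrite tensor_functionalE /beta triv_aug_pi rmorph1 mul1r.
  have mz j (y : 'rV_(mr_rank F j.+1)) b : aug ((y *m mr_mx F j) 0 b) = 0.
    have : map_mx (@aug k A) (y *m mr_mx F j) = 0 by rewrite map_mxM mr_min mulmx0.
    by move=> /matrixP/(_ 0 b); rewrite !mxE.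
  have augD j (y z : 'rV[A]_j) b : aug ((y + z) 0 b) = aug (y 0 b) + aug (z 0 b).
    by rewrite mxE raddfD.
  have augZ j c (y : 'rV[A]_j) b : aug ((c *: y) 0 b) = aug c * aug (y 0 b).
    by rewrite mxE rmorphM.
  have aug1 j (b : 'I_j) : aug ((delta_mx 0 b : 'rV[A]_j) 0 b) = 1.
    by rewrite mxE !eqxx rmorph1.
  case: i a {tx x beta bDl bDr br bs L} => [|i] a.
    by rewrite hP0 augD mz addr0 aug1.
  rewrite hP !augD mz addr0 aug1 -[RHS]addr0; congr (_ + _).
  rewrite [rs_d _ _ _](row_sum_delta (e i.+1 a *m mr_mx F i)) linear_sum summxE raddf_sum.
  apply: big1 => c _; rewrite linearZ_LR.
  by apply: etrans (augZ _ _ _ _) _; rewrite mz mul0r.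
have Ld (t : tensor kop (free_res k_ i.+1)) : L (tensor_map kop (res_diff k_ i) t) = 0.
  pose g : {linear tensor kop (free_res k_ i.+1) -> k^o} := L \o tensor_map kop (res_diff k_ i).
  rewrite -[LHS]/(g t) (@tensor_ind _ _ _ _ g \0) // => m y.
  rewrite -[LHS]/(L (tensor_map kop (res_diff k_ i) (tens m y))) tensor_mapE.
  rewrite tensor_functionalE /beta; have := vd i y; rewrite /= => <-.
  suff -> : aug ((v i.+1 y *m mr_mx F i : 'rV_(mr_rank F i)) 0 a) = 0 by rewrite mulr0.
  have : map_mx (@aug k A) ((v i.+1 y : 'rV_(mr_rank F i.+1)) *m mr_mx F i) = 0.
    by rewrite map_mxM mr_min mulmx0.
  by move=> /matrixP/(_ 0 a); rewrite !mxE.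
have nb y : x <> grTensor_map kop (@res_diff_degree0 _ _ k_ i) _ y.
  move=> xy; have e1 : val x = tensor_map kop (res_diff k_ i) (val y) by rewrite xy.
  have := Lx; rewrite -[X in L X]/(val x) e1 Ld => /eqP.
  by rewrite eq_sym oner_eq0.
have xE : val x = tens one (u i (e i a)) by [].
case: i a {Ld Lx tx beta bDl bDr br bs L} x nb xE => [|i] a x nb xE.
  have xk : x \in lker (\0 : {linear grTensor kop (free_res k_ 0) (mr_deg a) ->
      grTensor kop (free_res k_ 0) (mr_deg a)}) by rewrite unfold_in.
  exists (lquot_pi _ (Submod xk)) => /homology_pi_eq0[y]; exact: nb.
have xk : x \in lker (grTensor_map kop (@res_diff_degree0 _ _ k_ i) (mr_deg a)).
  rewrite unfold_in; apply/eqP/val_inj.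
  rewrite -[LHS]/(tensor_map kop (res_diff k_ i) (val x)) xE.
  by rewrite tensor_mapE cyc.
exists (lquot_pi _ (Submod xk)) => /homology_pi_eq0[y]; exact: nb.
Qed.

End TorMinimal.

(** * Finiteness of the minimal resolutions *)

Section Vanishing.
Variables (k : fieldType) (A : cgAlg k) (F : minres A).

Lemma dual_boundary0 i : @dual_boundary A (mr_rank F) (mr_mx F) i 0.
Proof. by case: i => // i; exists 0; rewrite ?mulmx0. Qed.

Lemma dual_boundaryD i v w : @dual_boundary A (mr_rank F) (mr_mx F) i v ->
  dual_boundary (mr_mx F) w -> dual_boundary (mr_mx F) (v + w).
Proof.
case: i v w => [|i] v w; first by move=> -> ->; rewrite /= addr0.
by move=> [x _ <-] [y _ <-]; exists (x + y); rewrite ?mulmxDr.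
Qed.

Lemma mr_mxM0 i : mr_mx F i.+1 *m mr_mx F i = 0.
Proof.
apply/row_matrixP => a; rewrite row_mul row0; apply/mr_exact.
by exists (delta_mx 0 a); rewrite -rowE.
Qed.

Lemma dual_homogM i n (w : 'cV_(mr_rank F i)) : dual_homog n w ->
  @dual_homog _ _ F i.+1 n (mr_mx F i *m w).
Proof.
move=> wn a b; rewrite mxE; apply: (grading_sum (@zhomog_grading k A)) => c _ _.
rewrite opprK (_ : n + _ = (mr_deg a)%:Z - (mr_deg c)%:Z + (n + (mr_deg c)%:Z)); last first.
  by rewrite addrCA subrK addrC.
by apply: zhomog_mul; [apply: mr_homog|have := wn c b; rewrite opprK].
Qed.

Lemma Ext_vanish_min i : gr_zero (Ext (triv_mod A) (reg_mod A) i) ->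
  forall w : 'cV_(mr_rank F i), mr_mx F i *m w = 0 -> dual_boundary (mr_mx F) w.
Proof.
move=> E0 w Ew.
pose gr j := mx_grading A (fun a (_ : 'I_1) => - (@mr_deg _ _ F j a)%:Z).
apply: (hcomp_ind (gG := gr i)); first exact: dual_boundary0.
  exact: dual_boundaryD.
move=> n; apply: (@Ext_eq0_min _ _ _ _ n) => [x||]; first exact: E0.
  exact: (hcomp_homog (gr i)).
rewrite -(hcomp_morph (gr i) (gr i.+1) (f := mulmx (mr_mx F i))).
- by rewrite Ew raddf0.
- exact: mulmx0.
- by move=> x y; apply: mulmxDr.
- by move=> j y; apply: dual_homogM.
Qed.

End Vanishing.

Section FiniteResolution.
Variables (k : fieldType) (A : cgAlg k) (F : minres A) (G : minres (opp_alg A)).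

(* The transposes of the matrices of G, that is a resolution of the right module k
   by columns over A. *)
Definition tr_mx i : 'M[A]_(mr_rank G i, mr_rank G i.+1) := (mr_mx G i)^T.

Lemma tr_mulmx m n p (X : 'M[opp_alg A]_(m, n)) (Y : 'M[opp_alg A]_(n, p)) :
  (X *m Y)^T = (Y^T : 'M[A]_(p, n)) *m (X^T : 'M[A]_(n, m)) :> 'M[A]_(p, m).
Proof. by apply/matrixP => i j; rewrite !mxE; apply: eq_bigr => c _; rewrite !mxE. Qed.

Lemma tr_mxM0 i : tr_mx i *m tr_mx i.+1 = 0.
Proof. by rewrite /tr_mx -tr_mulmx (@mr_mxM0 _ _ G) trmx0. Qed.

Lemma tr_mx_min i : map_mx (@aug k A) (tr_mx i) = 0.
Proof.
apply/matrixP => a b; have /matrixP/(_ b a) := mr_min G i.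
by rewrite !mxE aug_opp.
Qed.

Lemma tr_mx_exact i (w : 'cV[A]_(mr_rank G i.+1)) : tr_mx i *m w = 0 ->
  exists w', w = tr_mx i.+1 *m w'.
Proof.
move=> Dw; have /(@mr_exact _ _ G i)[v wE] : (w^T : 'rV[opp_alg A]_ _) *m mr_mx G i = 0.
  by apply: trmx_inj; rewrite trmx0 tr_mulmx trmxK.
exists v^T; apply: trmx_inj.
by rewrite -[LHS]/(w^T : 'rV[opp_alg A]_ _) wE /tr_mx -tr_mulmx trmxK.
Qed.

Lemma tr_mx_exact0 (w : 'cV[A]_(mr_rank G 0)) : map_mx (@aug k A) w = 0 ->
  exists w', w = tr_mx 0 *m w'.
Proof.
move=> aw; have /mr_exact0[v wE] : map_mx (@aug k (opp_alg A)) (w^T : 'rV[opp_alg A]_ _) = 0.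
  apply/matrixP => a b; have /matrixP/(_ b a) := aw.
  by rewrite !mxE aug_opp.
exists v^T; apply: trmx_inj.
by rewrite -[LHS]/(w^T : 'rV[opp_alg A]_ _) wE /tr_mx -tr_mulmx trmxK.
Qed.

Variables (d : nat) (l : int).
Hypothesis Ext_left : forall i, i <> d -> gr_zero (Ext (triv_mod A) (reg_mod A) i).
Hypothesis Ext_left_d :
  gr_isom (Ext (triv_mod A) (reg_mod A) d) (gr_shift (gr_unit k) l).
Hypothesis Ext_right : forall i, i <> d ->
  gr_zero (Ext (triv_mod (opp_alg A)) (reg_mod (opp_alg A)) i).
Hypothesis deg_le : forall a : 'I_(mr_rank F d), (mr_deg a)%:Z <= l.

Lemma tr_mx_dual_exact i (w : 'rV[A]_(mr_rank G i.+1)) : (d < i.+1)%N ->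
  w *m tr_mx i.+1 = 0 -> exists w', w = w' *m tr_mx i.
Proof.
move=> di wD; have Ew : mr_mx G i.+1 *m (w^T : 'cV[opp_alg A]_ _) = 0.
  by apply: trmx_inj; rewrite trmx0 tr_mulmx trmxK.
have [] := Ext_vanish_min (Ext_right _) Ew; first by apply/eqP; rewrite gtn_eqF.
move=> v _ vE; exists v^T; apply: trmx_inj.
by rewrite -[LHS]/(w^T : 'cV[opp_alg A]_ _) -vE /tr_mx -tr_mulmx trmxK.
Qed.

Lemma right_rank0 : mr_rank G d.+1 = 0%N.
Proof.
(* [k(l)] is concentrated in degree -l. *)
have [f fbij] := Ext_left_d (- l); have [g fK gK] := fbij.
have [z [zh Ez z0]] : exists w : 'cV_(mr_rank F d),
    [/\ dual_homog (- l) w, mr_mx F d *m w = 0 & w <> 0].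
  move: f fbij g fK gK; rewrite /gr_shift addNr /gr_unit eqxx => f fbij g fK gK.
  apply: (@Ext_neq0_min _ _ F d (- l) (g 1)) => g0.
  by have := gK 1; rewrite g0 linear0 => /eqP; rewrite eq_sym oner_eq0.
(* Entry a of z has degree [mr_deg a] - l, which is at most 0, so it is a scalar. *)
have zaug : z = map_mx (fun c => c%:A) (map_mx (@aug k A) z).
  apply/matrixP => a b; rewrite !mxE; have := zh a b; rewrite opprK.
  move=> /zhomog_scalar; apply; by rewrite addrC subr_le0.
apply: (@dual_zigzag_rank0 A (mr_rank F) (mr_rank G) (mr_mx F) tr_mx _ _ d _ _ k
  (@aug k A) _ _ z) => //.
- exact: mr_mxM0.
- exact: tr_mxM0.
- move=> i w di; apply: Ext_vanish_min; apply: Ext_left.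
  by apply/eqP; rewrite ltn_eqF.
- exact: tr_mx_dual_exact.
- exact: mr_min.
- exact: tr_mx_min.
- apply/eqP => az0; apply: z0; rewrite zaug az0.
  by apply/matrixP => a b; rewrite !mxE scale0r.
apply: aug_ind => [|x y xb yb|i x i0 xi].
- rewrite raddf0 mulmx0; exact: dual_boundary0.
- rewrite raddfD mulmxDr; exact: dual_boundaryD.
(* For x of degree i > 0 the cocycle z x has degree i - l, where Ext^d vanishes. *)
apply: (@Ext_eq0_min _ _ F d (i%:Z - l)).
- have [h /bij_inj hinj] := Ext_left_d (i%:Z - l).
  move=> y; apply: hinj; move: h y; rewrite /gr_shift subrK /gr_unit.
  case: eqP => [i0'|_ h y]; last by rewrite [LHS]thinmx0 [RHS]thinmx0.
  by move: i0; case: i i0' {xi}.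
- move=> a b; rewrite opprK mxE big_ord1 (ord1 b) (_ : x%:M 0 0 = x); last first.
    by rewrite mxE eqxx mulr1n.
  rewrite (_ : _ + _ = (- l + (mr_deg a)%:Z) + i%:Z); last by rewrite [RHS]addrC addrA.
  by apply: (zhomog_mul _ (xi : zhomog i%:Z x)); have := zh a 0; rewrite opprK.
- by rewrite mulmxA Ez mul0mx.
Qed.

Lemma left_rank0 : mr_rank F d.+1 = 0%N.
Proof.
apply: (@tensor_zigzag_rank0 A (mr_rank F) (mr_rank G) (mr_mx F) tr_mx _ _ k
  (@aug k A) _ _ _ _ _ d (mr_base G) right_rank0).
- exact: mr_mxM0.
- exact: tr_mxM0.
- exact: mr_min.
- exact: tr_mx_min.
- by move=> i w /mr_exact.
- exact: tr_mx_exact.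
- exact: tr_mx_exact0.
Qed.

End FiniteResolution.

(** * Global dimension *)

Section ProjectiveDimension.
Variable R : nzRingType.
Implicit Types M N X Y Z P L : lmodType R.

(** Projective dimension at most n in a recursive form, suited to induction along short exact
    sequences; [pdim_projdim] converts it back to resolutions. *)
Fixpoint pdim n M : Prop :=
  if n is n'.+1 then exists P (f : {linear P -> M}),
    [/\ projective_module P, forall x, exists y, f y = x & pdim n' (submod (lker f))]
  else projective_module M.

Lemma linear_exists M N (f : M -> N) : linear f -> exists g : {linear M -> N}, g =1 f.
Proof.
move=> fl; pose fL := GRing.isLinear.Build R M N _ f fl.
by exists (HB.pack f fL : {linear M -> N}).
Qed.

Lemma freeg_projective (C : choiceType) : projective_module {freeg C / R}.
Proof.
move=> X Y p f ps; have [g gP] := choice (fun c => ps (f << c >>)); exists (fglift g) => x.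
rewrite -[x]freeg_sumE !raddf_sum; apply: eq_bigr => c _.
rewrite /= liftU linearZ gP -linearZ; congr (f _).
by apply/eqP/freeg_eqP => c'; rewrite coeffZ !coeffU mul1r.
Qed.

Lemma linear_factor X L M (i : {linear X -> L}) (f : {linear M -> L}) : injective i ->
  (forall y, exists x, i x = f y) -> exists t : {linear M -> X}, forall y, i (t y) = f y.
Proof.
move=> i_inj /choice[t tP].
have tl : linear t by move=> a x y; apply: i_inj; rewrite linearP !tP linearP.
by have [g gE] := linear_exists tl; exists g => y; rewrite gE tP.
Qed.

Lemma projective_prod P Q : projective_module P -> projective_module Q ->
  projective_module (P * Q)%type.
Proof.
move=> pP pQ X Y p f ps.
have l1 : linear (fun x : P => (x, 0 : Q)).
  by move=> a x y; congr pair; rewrite /= scaler0 addr0.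
have l2 : linear (fun x : Q => (0 : P, x)).
  by move=> a x y; congr pair; rewrite /= scaler0 addr0.
have [i1 i1E] := linear_exists l1; have [i2 i2E] := linear_exists l2.
have [g gP] := pP X Y p (f \o i1) ps.
have [h hP] := pQ X Y p (f \o i2) ps.
exists ((g \o fst) \+ (h \o snd)) => -[x y].
rewrite /= linearD gP hP -[LHS]/(f (i1 x) + f (i2 y)) -linearD.
by rewrite i1E i2E -[X in f X]/(x + 0, 0 + y) addr0 add0r.
Qed.

Lemma projective_zero M : (forall x : M, x = 0) -> projective_module M.
Proof.
by move=> M0 X Y p f _; exists \0 => x; rewrite (M0 x) !linear0.
Qed.

Lemma pdimS n M : pdim n M -> pdim n.+1 M.
Proof.
elim: n M => [|n IHn] M; last first.
  by move=> [P [f [pP fs Kn]]]; exists P, f; split=> //; apply: IHn.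
move=> pM; exists M, idfun; split=> // [x|]; first by exists x.
by apply: projective_zero => x; apply: val_inj; apply/eqP/(submodP x).
Qed.

(** Horseshoe lemma: the sum of covers of X and Y covers L, and the three kernels form a short exact
    sequence again. *)
Lemma pdim_extension n X L Y (i : {linear X -> L}) (p : {linear L -> Y}) :
  injective i -> (forall y, exists x, p x = y) -> exact_at i p ->
  pdim n X -> pdim n Y -> pdim n L.
Proof.
elim: n X L Y i p => [|n IHn] X L Y i p i_inj p_surj ip.
  move=> /= pX pY X' Y' q f qs.
  have [s sP] := pY _ _ p idfun p_surj.
  have [t tP] : exists t : {linear L -> X}, forall y, i (t y) = y - s (p y).
    have [|t tP] := linear_factor (f := idfun \- (s \o p)) i_inj; last by exists t.
    by move=> y; apply/ip; rewrite linearB sP subrr.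
  have [g gP] := pX _ _ q (f \o i) qs.
  have [h hP] := pY _ _ q (f \o s) qs.
  exists ((g \o t) \+ (h \o p)) => x.
  by rewrite /= linearD gP hP /= tP -linearD subrK.
move=> [P [f [pP fs Kn]]] [Q [g [pQ gs Kn']]].
have [h hP] := pQ _ _ p g p_surj.
pose F : {linear (P * Q)%type -> L} := (i \o f \o fst) \+ (h \o snd).
have FE a b : F (a, b) = i (f a) + h b by [].
exists (P * Q)%type, F; split; first exact: projective_prod.
  move=> x; have [b bP] := gs (p x).
  have [y yP] : exists y, i y = x - h b by apply/ip; rewrite linearB hP bP subrr.
  by have [a aP] := fs y; exists (a, b); rewrite FE aP yP subrK.
have kF a : a \in lker f -> (a, 0 : Q) \in lker F.
  by rewrite !unfold_in FE => /eqP->; rewrite !linear0 addr0.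
have lkF : linear (fun a : submod (lker f) => Submod (kF _ (submodP a))).
  by move=> c a b; apply: val_inj; congr pair; rewrite /= scaler0 addr0.
have [i' i'E] := linear_exists lkF.
have kg (x : P * Q) : x \in lker F -> x.2 \in lker g.
  case: x => a b; rewrite !unfold_in FE => /eqP Fab; rewrite -hP.
  have : p (i (f a) + h b) = 0 by rewrite Fab linear0.
  by rewrite linearD (ip (i (f a))).2 ?add0r => [->//|]; exists (f a).
have lkg : linear (fun a : submod (lker F) => Submod (kg _ (submodP a))).
  by move=> c a b; apply: val_inj.
have [p' p'E] := linear_exists lkg.
apply: (IHn _ _ _ i' p') => //.
- by move=> a b; rewrite !i'E => /(congr1 val) [ab]; apply: val_inj.
- move=> y; have [x xP] : exists x, i x = h (val y).
    by apply/ip; rewrite hP; apply/eqP/(submodP y).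
  have [a aP] := fs x.
  have Fk : (- a, val y) \in lker F.
    by rewrite unfold_in FE !linearN aP xP addNr.
  by exists (Submod Fk); rewrite p'E; apply: val_inj.
- move=> x; split=> [|[a <-]]; last by rewrite p'E i'E; apply: val_inj.
  rewrite p'E => /(congr1 val) /= x0.
  have xF := submodP x; move: x0 xF; case E: (val x) => [a b] /= b0; rewrite b0 in E *.
  rewrite unfold_in FE linear0 addr0 => /eqP ia.
  have ak : a \in lker f by rewrite unfold_in; apply/eqP/i_inj; rewrite ia linear0.
  by exists (Submod ak); rewrite i'E; apply: val_inj; rewrite /= E.
Qed.

Lemma pdim_iso n X L (i : {linear X -> L}) : injective i ->
  (forall y, exists x, i x = y) -> pdim n X -> pdim n L.
Proof.
move=> i_inj i_surj pX.
have pY : pdim n 'rV[R]_0.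
  by elim: n {pX} => [|n /pdimS//]; apply: projective_zero => x; apply: thinmx0.
apply: (pdim_extension i_inj (p := \0)) pX pY.
- by move=> y; exists 0; rewrite [RHS]thinmx0.
- by move=> y; split=> // _; apply: i_surj.
Qed.

(** A projective cover f of Y also covers Z, and the kernel of p f is an extension of X by the
    kernel of f. *)
Lemma pdim_quotient n X Y Z (i : {linear X -> Y}) (p : {linear Y -> Z}) :
  injective i -> (forall y, exists x, p x = y) -> exact_at i p ->
  pdim n X -> pdim n Y -> pdim n.+1 Z.
Proof.
move=> i_inj p_surj ip; case: n => [|n] pX.
  move=> pY; exists Y, p; split=> //.
  have kp x : i x \in lker p by rewrite unfold_in; apply/eqP/ip; exists x.
  have lkp : linear (fun x => Submod (kp x)).
    by move=> c a b; apply: val_inj; rewrite /= linearP.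
  have [i' i'E] := linear_exists lkp.
  apply: (@pdim_iso 0 _ _ i') => //; first by move=> a b; rewrite !i'E => /(congr1 val) /i_inj.
  move=> y; have [x xy] : exists x, i x = val y by apply/ip/eqP/(submodP y).
  by exists x; rewrite i'E; apply: val_inj.
move=> [P [f [pP fs Kn]]].
exists P, (p \o f); split=> //.
  by move=> z; have [y <-] := p_surj z; have [x <-] := fs y; exists x.
have [t tP] := linear_factor (f := f \o (val : submod (lker (p \o f)) -> P)) i_inj
  (fun y => (ip _).1 (eqP (submodP y))).
have kf a : a \in lker f -> a \in lker (p \o f).
  by rewrite !unfold_in /= => /eqP->; rewrite linear0.
have lkf : linear (fun a : submod (lker f) => Submod (kf _ (submodP a))).
  by move=> c a b; apply: val_inj.
have [j jE] := linear_exists lkf.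
apply: (pdim_extension (i := j) (p := t)) pX => //.
- by move=> a b; rewrite !jE => /(congr1 val) /= /val_inj.
- move=> x; have [y yP] := fs (i x).
  have yk : y \in lker (p \o f) by rewrite unfold_in /= yP; apply/eqP/ip; exists x.
  by exists (Submod yk); apply: i_inj; rewrite tP.
- move=> y; split=> [y0|[x <-]].
    have yf : val y \in lker f.
      by rewrite unfold_in; have := tP y; rewrite y0 linear0 /= => <-.
    by exists (Submod yf); rewrite jE; apply: val_inj.
  apply: i_inj; rewrite tP linear0 jE; exact/eqP/(submodP x).
- exact: pdimS.
Qed.

Lemma pdim_projdim n M : pdim n M -> projdim_le M n.
Proof.
elim: n M => [|n IHn] M pM.
  pose P i : lmodType R := if i is 0%N then M else 'rV[R]_0.
  exists P, idfun, (fun i => \0); split.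
  - by case=> [//|i]; apply: projective_zero => x; apply: thinmx0.
  - by move=> x; exists x.
  - move=> y; split=> [y0|[x <-]//]; by exists 0; rewrite linear0; apply: esym.
  - by move=> i y; split=> // _; exists 0; rewrite [RHS]thinmx0.
  - by case=> // i _ x; apply: thinmx0.
case: pM => P0 [f [pP fs /IHn[P [e [d [pPi es e0 ex Pn]]]]]].
pose P' i : lmodType R := if i is j.+1 then P j else P0.
pose d' i : {linear P' i.+1 -> P' i} := match i with
  | 0%N => (val : submod (lker f) -> P0) \o e
  | j.+1 => d j end.
exists P', f, d'; split=> //.
- by case.
- move=> y; split=> [y0|[x <-]]; last exact/eqP/(submodP (e x)).
  have yk : y \in lker f by rewrite unfold_in y0.
  by have [x xP] := es (Submod yk); exists x; rewrite /= xP.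
- case=> [|i] y; last exact: ex.
  rewrite -e0 /=; split=> [y0|->//]; by apply: val_inj.
- by case=> // i; rewrite ltnS => /Pn.
Qed.

End ProjectiveDimension.

(** * Graded modules bounded below: free modules, Nakayama, bases modulo A_{>=1}M *)

Section GradedFree.
Variables (k : fieldType) (A : cgAlg k) (C : choiceType) (deg : C -> nat).

Definition gfree_homog (n : int) : set {freeg C / A} :=
  [set D | forall c, zhomog (n - (deg c)%:Z) (coeff c D)].

Fact gfree_grading : is_grading gfree_homog.
Proof.
have gA := @zhomog_grading k A; split.
- by move=> n c; rewrite coeff0; apply: zhomog0.
- by move=> n x y xn yn c; rewrite coeffB; apply: (gradingB gA).
- move=> D; rewrite -[D]freeg_sumE; apply: homog_sum_big => c _.
  elim/(homog_ind gA): (coeff c D) => [|x y hx hy|j x xj].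
  + by exists [::]; rewrite ?big_nil ?freegU0.
  + by rewrite -freegUD; apply: homog_sumD.
  apply: (@homog_sum1 _ _ _ (j + (deg c)%:Z)) => c'; rewrite coeffU.
  have [<-|_] := eqVneq c c'; first by rewrite mulr1 addrK.
  by rewrite mulr0; apply: zhomog0.
- move=> s f us fG sf0 i si; apply/eqP/freeg_eqP => c; rewrite coeff0.
  case: gA => _ _ _.
  move=> /(_ [seq j - (deg c)%:Z | j <- s] (fun j => coeff c (f (j + (deg c)%:Z)))).
  rewrite map_inj_uniq; last exact: addIr.
  move=> /(_ us) gA; rewrite -[i](subrK (deg c)%:Z); apply: gA; last exact: map_f.
    by move=> j; have := fG (j + (deg c)%:Z) c; rewrite addrK.
  rewrite big_map -[RHS](coeff0 _ c) -sf0 raddf_sum /=.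
  by apply: eq_bigr => j _; rewrite subrK.
Qed.

Fact gfree_act i j a x : cg_homog i a -> gfree_homog j x ->
  gfree_homog (i%:Z + j) (a *: x).
Proof.
by move=> ai xj c; rewrite coeffZ -addrA; apply: (@zhomog_mul _ _ i%:Z) (xj c).
Qed.

Definition gfree : grMod A := GrMod gfree_grading gfree_act.

Definition gr_nonneg (M : grMod A) := forall n (x : M), gm_homog (Negz n) x -> x = 0.

Lemma gfree_nonneg : gr_nonneg gfree.
Proof.
move=> n x xn; apply/eqP/freeg_eqP => c; rewrite coeff0; have := xn c.
have : Negz n - (deg c)%:Z < 0 by rewrite subr_lt0.
by case: (_ - _).
Qed.

Variables (M : grMod A) (g : C -> M).
Hypothesis gP : forall c, gm_homog (deg c)%:Z (g c).

Definition gfree_map : {linear gfree -> M} := fglift g.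

Lemma gfree_map0 : degree0 gfree_map.
Proof.
move=> j x xj; rewrite -[x]freeg_sumE raddf_sum /=.
apply: (grading_sum (gm_grading M)) => c _ _.
by rewrite liftU -[j](subrK (deg c)%:Z); apply: gm_zact.
Qed.

Lemma gfree_mapU a c : gfree_map << a *g c >> = a *: g c.
Proof. by rewrite /= liftU. Qed.

End GradedFree.

Section GradedNakayama.
Variables (k : fieldType) (A : cgAlg k).

(* A_{>=1} M *)
Definition pos_span (M : grMod A) : set M :=
  [set x | exists2 s : seq (A * M), (forall p, p \in s -> aug p.1 = 0) &
    x = \sum_(p <- s) p.1 *: p.2].

Lemma pos_span0 (M : grMod A) : @pos_span M 0.
Proof. by exists [::]; rewrite ?big_nil. Qed.

Lemma pos_spanD (M : grMod A) x y : @pos_span M x -> pos_span y -> pos_span (x + y).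
Proof.
move=> [s sP ->] [t tP ->]; exists (s ++ t); last by rewrite big_cat.
by move=> p; rewrite mem_cat => /orP[/sP|/tP].
Qed.

Lemma pos_span1 (M : grMod A) a (x : M) : aug a = 0 -> pos_span (a *: x).
Proof.
by move=> a0; exists [:: (a, x)]; [move=> p; rewrite inE => /eqP->|rewrite big_seq1].
Qed.

Lemma pos_spanZ (M : grMod A) a x : @pos_span M x -> pos_span (a *: x).
Proof.
move=> [s sP ->]; rewrite scaler_sumr big_seq; apply: big_ind => [||p /sP p0].
- exact: pos_span0.
- exact: pos_spanD.
- by rewrite scalerA; apply: pos_span1; rewrite rmorphM /= p0 mulr0.
Qed.

(** The degree j component of an element of A_{>=1}M is a sum of products a y with y homogeneous of
    degree below j; the inductions on the degree rest on this. *)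
Lemma pos_span_comp (M : grMod A) (j : int) (S : set M) x :
  S 0 -> (forall y z, S y -> S z -> S (y + z)) ->
  (forall i a y, (0 < i)%N -> cg_homog i a -> gm_homog (j - i%:Z) y -> S (a *: y)) ->
  pos_span x -> S (hcomp (gm_grading M) j x).
Proof.
move=> S0 SD Sa.
have h y a : aug a = 0 -> S (hcomp (gm_grading M) j (a *: y)).
  move: a; apply: aug_ind => [|a b Sx Sy|i a i0 ai].
  - by rewrite scale0r raddf0.
  - by rewrite scalerDl raddfD; apply: SD.
  rewrite (_ : hcomp _ _ _ = a *: hcomp (gm_grading M) (j - i%:Z) y).
    by apply: Sa i0 ai _; apply: hcomp_homog.
  by rewrite -(hcomp_act _ _ ai) addrC subrK.
move=> [s sP ->]; rewrite raddf_sum big_seq; apply: big_ind => // p /sP; exact: h.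
Qed.

Lemma nakayama (M : grMod A) : gr_nonneg M -> (forall x : M, pos_span x) ->
  forall x : M, x = 0.
Proof.
move=> M0 Mpos.
have h (n : nat) (x : M) : gm_homog n%:Z x -> x = 0.
  elim/ltn_ind: n x => n IHn x xn.
  rewrite -(hcomp_id (gm_grading M) xn); apply: (pos_span_comp (S := [set 0])) => //.
    by move=> y z -> ->; rewrite /= addr0.
  move=> i a y i0 ai; case E: (_ - _) => [m|m] ym; last by rewrite (M0 _ _ ym) scaler0.
  rewrite /= (IHn m _ y) ?scaler0 //.
  by rewrite -ltz_nat -E ltrBlDr ltrDl ltz_nat.
apply: (homog_ind (gm_grading M)) => // [x y -> ->|[n|n] x]; rewrite ?addr0 //.
  exact: h.
exact: M0.
Qed.

(** Nakayama in the form of a spanning criterion. As S is not assumed to be graded, the hypothesis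
    asks for the degree j component of the approximating y. *)
Lemma lin_span_ind (M : grMod A) (S : set M) : gr_nonneg M ->
  S 0 -> (forall y z, S y -> S z -> S (y + z)) -> (forall a y, S y -> S (a *: y)) ->
  (forall j (x : M), gm_homog j x ->
     exists2 y, S (hcomp (gm_grading M) j y) & pos_span (x - y)) -> forall x, S x.
Proof.
move=> M0 S0 SD SZ Sx.
have h (n : nat) (x : M) : gm_homog n%:Z x -> S x.
  elim/ltn_ind: n x => n IHn x xn; have [y Sy xy] := Sx _ _ xn.
  rewrite -(hcomp_id (gm_grading M) xn) -(subrK y x) raddfD; apply: (SD _ _) => //.
  apply: (pos_span_comp S0 SD) xy => i a z i0 ai.
  case E: (_ - _) => [m|m] zm; last by rewrite (M0 _ _ zm) scaler0.
  apply: SZ; apply: IHn zm.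
  by rewrite -ltz_nat -E ltrBlDr ltrDl ltz_nat.
apply: (homog_ind (gm_grading M)) => // [[n|n] x]; first exact: h.
by move=> /M0->.
Qed.

Definition indep_mod (M : grMod A) (B : set (nat * M)) : Prop :=
  (forall p, B p -> gm_homog p.1%:Z p.2) /\
  forall (s : seq (nat * M)) (c : nat * M -> k), uniq s -> (forall p, p \in s -> B p) ->
    pos_span (\sum_(p <- s) (c p)%:A *: p.2) -> forall p, p \in s -> c p = 0.

(** Zorn: if x were outside the span of a maximal B modulo A_{>=1}M, a relation involving x would
    have coefficient 0 at x, so (n, x) could be adjoined to B. *)
Lemma exists_homog_basis (M : grMod A) : gr_nonneg M ->
  exists2 B : set (nat * M), indep_mod B &
  forall (n : nat) (x : M), gm_homog n%:Z x -> exists (s : seq (nat * M)) c,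
    [/\ uniq s, forall p, p \in s -> B p & pos_span (x - \sum_(p <- s) (c p)%:A *: p.2)].
Proof.
move=> M0.
have [|B [[Bh Bi] maxB]] := @Zorn_bigcup (nat * M)%type (@indep_mod M).
  move=> F Find Ftot; split; first by move=> p [X FX]; apply: (Find X FX).1.
  move=> s c us sF sp p ps.
  have [X FX sX] : exists2 X, F X & forall q, q \in s -> X q.
    have [X FX pX] := sF _ ps.
    elim: s sF {us sp ps} => [|q s IHs] sF; first by exists X.
    have [|Y FY sY] := IHs; first by move=> z zs; apply: sF; rewrite inE zs orbT.
    have [Z FZ qZ] := sF q (mem_head _ _).
    have [YZ|ZY] := Ftot _ _ FY FZ.
      by exists Z => // z; rewrite inE => /orP[/eqP->//|/sY/YZ].
    by exists Y => // z; rewrite inE => /orP[/eqP->|/sY//]; apply: ZY.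
  exact: (Find X FX).2 s c us sX sp p ps.
exists B => // n x xn; apply: contrapT => nsp.
have scM (a b : k) : a%:A * b%:A = (a * b)%:A :> A by rewrite -scalerAl mul1r scalerA.
have nB : ~ B (n, x).
  move=> xB; apply: nsp; exists [:: (n, x)], (fun=> 1); split=> //.
    by move=> p; rewrite inE => /eqP->.
  by rewrite big_seq1 !scale1r subrr; apply: pos_span0.
apply: (maxB (B `|` [set (n, x)])); first split.
- by move=> p Bp; left.
- by move=> h; apply: nB; apply: h; right.
split=> [p [/Bh//|->]//|s c us sB sp].
have rest t : uniq t -> {subset t <= s} -> (n, x) \notin t ->
    pos_span (\sum_(p <- t) (c p)%:A *: p.2) -> forall p, p \in t -> c p = 0.
  move=> ut ts xt; apply: Bi => // p pt.
  by case: (sB p (ts p pt)) => // px; rewrite (px : p = _) in pt; rewrite pt in xt.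
have [xs|xs] := boolP ((n, x) \in s); last exact: (rest s).
pose t := rem (n, x) s.
have pt := perm_to_rem xs.
have xt : (n, x) \notin t by rewrite mem_rem_uniq // inE eqxx.
have ts : {subset t <= s} by apply: mem_rem.
have ut : uniq t by apply: rem_uniq.
have sE : \sum_(p <- s) (c p)%:A *: p.2
    = (c (n, x))%:A *: x + \sum_(p <- t) (c p)%:A *: p.2.
  by rewrite (perm_big _ pt) big_cons.
have cx : c (n, x) = 0.
  apply/eqP; apply: contrapT => /negP cx0; apply: nsp.
  exists t, (fun p => - (c (n, x))^-1 * c p); split=> //.
    move=> p pt'; case: (sB p (ts p pt')) => // px.
    by rewrite (px : p = _) in pt'; rewrite pt' in xt.
  have -> : x - \sum_(p <- t) (- (c (n, x))^-1 * c p)%:A *: p.2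
      = (c (n, x))^-1%:A *: \sum_(p <- s) (c p)%:A *: p.2.
    rewrite sE scalerDr scalerA scM mulVf // !scale1r; congr (_ + _).
    rewrite -sumrN scaler_sumr; apply: eq_bigr => p _.
    by rewrite scalerA scM mulNr scaleNr scaleNr opprK.
  exact: pos_spanZ.
move=> p ps; have [->//|px] := eqVneq p (n, x).
apply: (rest t) => //; last by rewrite mem_rem_uniq // inE px.
by move: sp; rewrite sE cx scale0r scale0r add0r.
Qed.

End GradedNakayama.

Section MatrixAction.
Variables (R : nzRingType).

(** X is read as a map of free right modules of columns, and [mact X] is that map tensored with
    V. *)
Definition mact (V : lmodType R) m n (X : 'M[R]_(m, n)) (y : 'I_n -> V) (a : 'I_m) : V :=
  \sum_b X a b *: y b.

Lemma mact_mul (V : lmodType R) m n p (X : 'M[R]_(m, n)) (Y : 'M[R]_(n, p)) (y : 'I_p -> V) a :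
  mact (X *m Y) y a = mact X (mact Y y) a.
Proof.
rewrite /mact; under [RHS]eq_bigr do rewrite scaler_sumr.
rewrite exchange_big; apply: eq_bigr => c _; rewrite mxE scaler_suml.
by apply: eq_bigr => b _; rewrite scalerA.
Qed.

Lemma mact_linear (V W : lmodType R) m n (X : 'M[R]_(m, n)) (y : 'I_n -> V)
    (f : {linear V -> W}) a : f (mact X y a) = mact X (f \o y) a.
Proof. by rewrite linear_sum; apply: eq_bigr => b _; rewrite linearZ. Qed.

(** A free module is a direct sum of copies of R, so the system is solved one coordinate c at a
    time; only the finitely many c in the supports of the [y a] matter. *)
Lemma mact_freeg (C : choiceType) m n (X : 'M[R]_(m, n)) (y : 'I_m -> {freeg C / R}) :
  (forall c, exists w : 'cV_n, \col_a coeff c (y a) = X *m w) ->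
  exists z, forall a, y a = mact X z a.
Proof.
move=> /choice[f fP]; pose U := undup (flatten [seq dom (y a) | a <- enum 'I_m]).
have yU c a : c \notin U -> coeff c (y a) = 0.
  move=> cU; apply: coeff_outdom; apply: contra cU => ca.
  by rewrite mem_undup; apply/flatten_mapP; exists a; rewrite ?mem_enum.
exists (fun b => \sum_(c <- U) << f c b 0 *g c >>) => a.
apply/eqP/freeg_eqP => c; rewrite raddf_sum /=.
have cz b : coeff c (\sum_(c <- U) << f c b 0 *g c >>) = if c \in U then f c b 0 else 0.
  rewrite raddf_sum /=; under eq_bigr do rewrite coeffU.
  case: ifP => cU; last first.
    rewrite big_seq big1 // => c' c'U; case: eqP => [e|_]; last by rewrite mulr0.
    by rewrite -e c'U in cU.
  rewrite (bigD1_seq c) ?undup_uniq //= eqxx mulr1 big1 ?addr0 // => c' c'c.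
  by rewrite (negPf c'c) mulr0.
under eq_bigr do rewrite coeffZ cz.
case: (boolP (c \in U)) => cU; last by rewrite yU // big1 // => b _; rewrite mulr0.
by have /matrixP/(_ a 0) := fP c; rewrite !mxE => ->.
Qed.

Lemma freeg_linear_ext (C : choiceType) (V : lmodType R) (f g : {linear {freeg C / R} -> V}) :
  (forall c, f << c >> = g << c >>) -> f =1 g.
Proof.
move=> fg x; rewrite -[x]freeg_sumE !linear_sum; apply: eq_bigr => c _.
rewrite (_ : << _ *g _ >> = coeff c x *: << c >>) ?linearZ ?fg //.
by apply/eqP/freeg_eqP => c'; rewrite coeffZ !coeffU mul1r.
Qed.

End MatrixAction.

Section SubGraded.
Variables (k : fieldType) (A : cgAlg k) (M : grMod A) (S : submodClosed M).
Hypothesis Scomp : forall j x, x \in S -> hcomp (gm_grading M) j x \in S.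

Definition sub_homog (j : int) : set (submod S) := [set x | gm_homog j (val x)].

Fact sub_grading : is_grading sub_homog.
Proof.
pose gM := @gm_grading _ _ M; split.
- by move=> j; apply: (grading0 gM).
- by move=> j x y; apply: (gradingB gM).
- move=> x; have [s [us _ xE]] := hcomp_sum gM (val x).
  pose h i : submod S := Submod (Scomp i (submodP x)).
  have -> : x = \sum_(i <- s) h i by apply: val_inj; rewrite raddf_sum; apply: xE.
  apply: homog_sum_big => i _; apply: (@homog_sum1 _ _ _ i).
  exact: hcomp_homog.
- move=> s f us fG sf0 i si; apply: val_inj.
  case: (gM) => _ _ _ /(_ s (val \o f) us); apply => //=.
  by have := congr1 val sf0; rewrite raddf_sum raddf0.
Qed.

Fact sub_act i j a x : cg_homog i a -> sub_homog j x -> sub_homog (i%:Z + j) (a *: x).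
Proof. exact: gm_act. Qed.

Definition gr_sub : grMod A := GrMod sub_grading sub_act.

Lemma gr_sub_nonneg : gr_nonneg M -> gr_nonneg gr_sub.
Proof. by move=> M0 n x xn; apply: val_inj; apply: M0 xn. Qed.

End SubGraded.

(** * Projective dimension of graded modules from the vanishing of Tor *)

Section GlobalDimension.
Variables (k : fieldType) (A : cgAlg k) (r : nat -> nat).
Variable D : forall i, 'M[A]_(r i, r i.+1).
Hypothesis DD : forall i, D i *m D i.+1 = 0.
Hypothesis Dexact : forall i (w : 'cV_(r i.+1)), D i *m w = 0 -> exists w', w = D i.+1 *m w'.
Hypothesis Daug : forall w : 'cV_(r 0), map_mx (@aug k A) w = 0 -> exists w', w = D 0 *m w'.
Hypothesis Dmin : map_mx (@aug k A) (D 0) = 0.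
Variable j0 : 'I_(r 0).

(* Tor_{j+1}^A(k, V) = 0, where k is resolved by the matrices D. *)
Definition tor_vanish (V : lmodType A) j : Prop :=
  forall y : 'I_(r j.+1) -> V, (forall a, mact (D j) y a = 0) ->
  exists z, forall b, y b = mact (D j.+1) z b.

Lemma tor_vanish_freeg (C : choiceType) j : tor_vanish {freeg C / A} j.
Proof.
move=> y Dy; apply: mact_freeg => c; apply: Dexact; apply/matrixP => a b.
have := congr1 (coeff c) (Dy a); rewrite raddf_sum coeff0 !mxE => h; rewrite -[RHS]h.
by apply: eq_bigr => b' _; rewrite /= coeffZ mxE.
Qed.

(** Dimension shift along 0 -> ker p -> free -> V -> 0. *)
Lemma tor_vanish_ker (C : choiceType) (V : lmodType A) (p : {linear {freeg C / A} -> V}) j :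
  (forall y, exists x, p x = y) -> tor_vanish V j.+1 -> tor_vanish (submod (lker p)) j.
Proof.
move=> p_surj torV y Dy.
have [z yz] : exists z, forall b, val (y b) = mact (D j.+1) z b.
  apply: tor_vanish_freeg => a; have := congr1 val (Dy a).
  by rewrite -(mact_linear (D j) y (val : submod (lker p) -> _) a).
have [|w' zw] := torV (p \o z).
  by move=> a; rewrite -mact_linear -yz; apply/eqP/(submodP (y a)).
have [w wP] := choice (fun b => p_surj (w' b)).
have zk b : z b - mact (D j.+2) w b \in lker p.
  rewrite unfold_in linearB mact_linear -[p (z b)]/((p \o z) b) zw; apply/eqP.
  rewrite (_ : mact _ (p \o w) b = mact (D j.+2) w' b) ?subrr //.
  by apply: eq_bigr => c _; rewrite /= wP.
exists (fun b => Submod (zk b)) => b; apply: val_inj.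
rewrite (mact_linear (D j.+1) _ (val : submod (lker p) -> _) b) yz.
rewrite /mact /=; under [RHS]eq_bigr do rewrite scalerBr.
rewrite sumrB -[X in _ - X]/(mact (D j.+1) (mact (D j.+2) w) b) -mact_mul DD.
by rewrite [X in _ - X]big1 ?subr0 // => c _; rewrite mxE scale0r.
Qed.

(* Lifts of a basis of Z / A_{>=1} Z form a free basis: they generate by Nakayama,
   and Tor_1(k, Z) = 0 makes the kernel K of the free cover satisfy K = A_{>=1} K. *)
Lemma tor_vanish_projective (Z : grMod A) : gr_nonneg Z -> tor_vanish Z 0 ->
  projective_module Z.
Proof.
move=> Z0 torZ; have [B [Bh Bi] Bs] := exists_homog_basis Z0.
pose C := {p : nat * Z | `[< B p >]}.
have BC (c : C) : B (val c) by apply/asboolP/(valP c).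
pose deg (c : C) := (val c).1; pose g (c : C) := (val c).2.
pose Q := gfree A deg.
pose p : {linear Q -> Z} := gfree_map deg g.
have p0 : degree0 p by apply: gfree_map0 => c; apply: Bh (BC c).
have pU a c : p << a *g c >> = a *: g c by apply: gfree_mapU.
have p_surj : forall y, exists x, p x = y.
  apply: (lin_span_ind Z0).
  - by exists 0; rewrite linear0.
  - by move=> _ _ [x <-] [y <-]; exists (x + y); rewrite linearD.
  - by move=> a _ [x <-]; exists (a *: x); rewrite linearZ.
  move=> [n|n] x xn; last first.
    rewrite (Z0 _ _ xn); exists 0; last by rewrite subr0; apply: pos_span0.
    by rewrite raddf0; exists 0; rewrite linear0.
  have [s [c [us sB xs]]] := Bs n x xn; exists (\sum_(q <- s) (c q)%:A *: q.2) => //.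
  rewrite raddf_sum /= big_seq; apply: (big_ind (fun y => exists x, p x = y)).
  - by exists 0; rewrite linear0.
  - by move=> _ _ [u <-] [v <-]; exists (u + v); rewrite linearD.
  move=> q qs; have Bq := sB q qs.
  have qh : gm_homog q.1%:Z ((c q)%:A *: q.2).
    rewrite -[q.1%:Z]add0r; apply: (@gm_act _ _ _ 0%N) (Bh _ Bq).
    by apply/cg_conn; exists (c q).
  rewrite (hcompE _ _ qh); case: eqP => _; last by exists 0; rewrite linear0.
  pose qC : C := exist _ q (asboolT Bq).
  by exists << (c q)%:A *g qC >>; rewrite pU.
(* Modulo A_{>=1}Z the equation p x = 0 becomes a relation with scalar coefficients between basis
   elements, so these coefficients vanish. *)
have ker_aug (x : Q) c : p x = 0 -> aug (coeff c x) = 0.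
  move=> px; have [cx|cx] := boolP (c \in dom x); last by rewrite coeff_outdom // raddf0.
  pose e (q : nat * Z) := if insub q is Some c then aug (coeff c x) else 0.
  have eE c' : e (val c') = aug (coeff c' x) by rewrite /e valK.
  rewrite -eE; apply: (Bi [seq val c' | c' <- dom x]) => [|q /mapP[c' _ ->]||].
  - by rewrite map_inj_uniq ?uniq_dom //; apply: val_inj.
  - exact: BC.
  - rewrite big_map; move: px; rewrite -{1}[x]freeg_sumE linear_sum /= => px.
    rewrite -[X in pos_span X]subr0 -[X in _ - X]px -sumrB big_seq.
    apply: big_ind => [||c' c'x]; [exact: pos_span0|exact: pos_spanD|].
    rewrite pU -scalerBl; apply: pos_span1.
    by rewrite raddfB /= eE aug_scalar subrr.
  - exact: map_f.
pose K := gr_ker p0.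
have K0 : gr_nonneg K.
  by move=> n x xn; apply: val_inj; apply: (@gfree_nonneg _ _ _ deg) xn.
have Kpos (x : K) : pos_span x.
  have px : p (val x) = 0 by apply/eqP/(submodP x).
  (* The coefficients of x have augmentation 0, so the constant tuple x is [D 0] applied to some z.
     Vanishing of Tor_1 lets z be corrected, by a multiple of [D 1], to a tuple in K; row [j0] then
     writes x with coefficients in A_{>=1}. *)
  have [|z xz] := @mact_freeg A C _ _ (D 0) (fun=> val x).
    move=> c; apply: Daug; apply/matrixP => a b; rewrite !mxE; exact: ker_aug.
  have [|w' zw] := torZ (p \o z).
    by move=> a; rewrite -mact_linear -xz.
  have [w wP] := choice (fun b => p_surj (w' b)).
  have zk b : z b - mact (D 1) w b \in lker p.
    rewrite unfold_in linearB mact_linear -[p (z b)]/((p \o z) b) zw; apply/eqP.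
    rewrite (_ : mact _ (p \o w) b = mact (D 1) w' b) ?subrr //.
    by apply: eq_bigr => c _; rewrite /= wP.
  have -> : x = \sum_b D 0 j0 b *: (Submod (zk b) : K).
    apply: val_inj; rewrite (xz j0) raddf_sum /mact /=.
    under [RHS]eq_bigr do rewrite scalerBr.
    rewrite sumrB -[X in _ - X]/(mact (D 0) (mact (D 1) w) j0) -mact_mul DD.
    by rewrite [X in _ - X]big1 ?subr0 // => c _; rewrite mxE scale0r.
  apply: big_ind => [||b _]; [exact: pos_span0|exact: pos_spanD|].
  by apply: pos_span1; have /matrixP/(_ j0 b) := Dmin; rewrite !mxE.
have p_inj : injective p.
  move=> x y xy; apply/eqP; rewrite -subr_eq0; apply/eqP.
  have xyk : x - y \in lker p by rewrite unfold_in linearB xy subrr.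
  by have /(congr1 val) := nakayama K0 Kpos (Submod xyk).
apply: (@pdim_iso _ 0 _ _ p p_inj p_surj); exact: freeg_projective.
Qed.

Lemma tor_vanish_pdim (N : grMod A) j : gr_nonneg N -> tor_vanish N j -> pdim j N.
Proof.
elim: j N => [|j IHj] N N0 torN; first exact: tor_vanish_projective.
pose C := {q : nat * N | `[< gm_homog q.1%:Z q.2 >]}.
pose deg (c : C) := (val c).1; pose g (c : C) := (val c).2.
pose p : {linear gfree A deg -> N} := gfree_map deg g.
have p0 : degree0 p by apply: gfree_map0 => c; apply/asboolP/(valP c).
have p_surj : forall y, exists x, p x = y.
  apply: (homog_ind (gm_grading N)) => [|_ _ [x <-] [y <-]|[n|n] x xn].
  - by exists 0; rewrite linear0.
  - by exists (x + y); rewrite linearD.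
  - exists << (exist _ (n, x) (asboolT xn) : C) >>.
    by rewrite /p gfree_mapU scale1r.
  - by rewrite (N0 _ _ xn); exists 0; rewrite linear0.
exists (gfree A deg), p; split=> //; first exact: freeg_projective.
apply: (IHj (gr_ker p0)); last exact: tor_vanish_ker.
by move=> n x xn; apply: val_inj; apply: (@gfree_nonneg _ _ _ deg) xn.
Qed.

End GlobalDimension.

(** * Arbitrary modules by homogenization *)

Section Homogenization.
Variables (k : fieldType) (A : cgAlg k) (M : lmodType A).

(* gfree on M * nat is P[t], where P is the free module on M; ev is the map
   P[t] -> M with t = 1, shift is multiplication by t, and hker is the kernel of
   P[t] -> M[t]. *)
Definition hfree : grMod A := gfree A (C := (M * nat)%type) (fun c => c.2).

Let gH : is_grading (@gm_homog _ _ hfree) := gm_grading hfree.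

Definition ev : {linear hfree -> M} := fglift (fun c : M * nat => c.1).

Definition shift : {linear hfree -> hfree} :=
  fglift (fun c : M * nat => << (c.1, c.2.+1) >> : hfree).

Lemma ev_shift x : ev (shift x) = ev x.
Proof.
apply: (freeg_linear_ext (f := ev \o shift)) => c.
by rewrite /= liftU scale1r !liftU !scale1r.
Qed.

Lemma shift_homog j x : gm_homog j x -> gm_homog (j + 1) (shift x).
Proof.
move=> xj; rewrite -[x]freeg_sumE linear_sum; apply: (grading_sum gH) => c _ _.
rewrite /= liftU -[j](subrK c.2%:Z) -addrA; apply: (@gm_zact _ _ hfree); first exact: xj.
move=> c'; rewrite coeffU mul1r; case: eqP => [<-|_]; last exact: zhomog0.
by rewrite /= -addn1 PoszD subrr; apply/cg_conn; exists 1; rewrite scale1r.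
Qed.

Lemma hcomp_shift j x : hcomp gH (j + 1) (shift x) = shift (hcomp gH j x).
Proof.
elim/(homog_ind gH): x => [|x y xE yE|i x xi].
- by rewrite !raddf0.
- by rewrite !raddfD /= xE yE.
rewrite (hcompE gH _ xi) (hcompE gH _ (shift_homog xi)) (inj_eq (addIr _)).
by case: eqP; rewrite ?linear0.
Qed.

(** The degree j part of P[t] maps to M t^j, and there evaluation at t = 1 loses nothing; so the
    kernel is tested on each component separately. *)
Definition hker : {pred hfree} := fun x => `[< forall j, ev (hcomp gH j x) = 0 >].

Lemma hkerP x : reflect (forall j, ev (hcomp gH j x) = 0) (x \in hker).
Proof. exact: asboolP. Qed.

Lemma hcompK i j x : hcomp gH i (hcomp gH j x) = if i == j then hcomp gH j x else 0.
Proof. exact: (hcompE gH _ (hcomp_homog gH j x)). Qed.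

Fact hker_submod_closed : submod_closed hker.
Proof.
split; first by apply/hkerP => j; rewrite raddf0 linear0.
move=> a x y /hkerP x0 /hkerP y0; apply/hkerP => j.
rewrite raddfD linearD /= y0 addr0.
elim/(homog_ind (@cg_grading _ A)): a => [|a b ha hb|i a ai].
- by rewrite scale0r raddf0 linear0.
- by rewrite scalerDl raddfD linearD /= ha hb addr0.
rewrite (_ : hcomp gH j _ = a *: hcomp gH (j - i%:Z) x).
  by rewrite linearZ_LR x0 scaler0.
by rewrite -(hcomp_act _ _ ai) addrC subrK.
Qed.
HB.instance Definition _ := GRing.isSubmodClosed.Build A hfree hker hker_submod_closed.

Lemma hker_comp j x : x \in hker -> hcomp gH j x \in hker.
Proof.
move=> /hkerP x0; apply/hkerP => i; rewrite hcompK.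
by case: eqP; rewrite ?linear0.
Qed.

Definition hker_mod : grMod A := gr_sub hker_comp.

Lemma hker_nonneg : gr_nonneg hker_mod.
Proof. by apply: gr_sub_nonneg; apply: gfree_nonneg. Qed.

Lemma hker_ev x : x \in hker -> ev x = 0.
Proof.
move=> /hkerP x0; have [s [_ _ ->]] := hcomp_sum gH x.
by rewrite linear_sum big1.
Qed.

Lemma shift_hker x : x \in hker -> shift x \in hker.
Proof.
move=> /hkerP x0; apply/hkerP => j; rewrite -(subrK 1 j) hcomp_shift ev_shift.
exact: x0.
Qed.

(** Injectivity of t - 1 on M[t]: the evaluation of the degree j component does not depend on j, and
    it vanishes for j < 0. *)
Lemma hker_shift x : shift x - x \in hker -> x \in hker.
Proof.
move=> /hkerP x0.
have e j : ev (hcomp gH (j - 1) x) = ev (hcomp gH j x).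
  have h : hcomp gH j (shift x) = shift (hcomp gH (j - 1) x).
    by rewrite -hcomp_shift subrK.
  have := x0 j; rewrite raddfB linearB /= h ev_shift.
  by move=> /eqP; rewrite subr_eq0 => /eqP.
have neg n : ev (hcomp gH (Negz n) x) = 0.
  by rewrite (gfree_nonneg (hcomp_homog gH (Negz n) x)) linear0.
apply/hkerP => -[n|n]; last exact: neg.
elim: n => [|n IHn]; first by rewrite -e; apply: (neg 0%N).
by rewrite -e -addn1 PoszD addrK.
Qed.

(** Modulo the image of t - 1, each homogeneous part may be multiplied by powers of t, so that all
    parts meet in one large degree. *)
Lemma shift_decomp x : exists N : nat, forall n, (N <= n)%N ->
  exists x' y, gm_homog n%:Z x' /\ x = x' + (shift y - y).
Proof.
elim/(homog_ind gH): x => [|x y [N xN] [N' yN']|[i|i] x xi].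
- exists 0%N => n _; exists 0, 0; split; first exact: (grading0 gH).
  by rewrite linear0 subrr addr0.
- exists (maxn N N') => n; rewrite geq_max => /andP[/xN[x1 [x2 [x1n ->]]] /yN'[y1 [y2 [y1n ->]]]].
  exists (x1 + y1), (x2 + y2); split; first exact: (gradingD gH).
  by rewrite linearD opprD addrACA (addrACA (shift x2)).
- exists i => n /subnK <-; elim: (n - i)%N => [|m [x' [y [x'm ->]]]].
    by exists x, 0; split=> //; rewrite linear0 subrr addr0.
  exists (shift x'), (y - x'); split.
    by rewrite addSn -addn1 PoszD; apply: shift_homog.
  by rewrite linearB opprB [shift y - shift x']addrC -addrA addNKr addrCA.
- rewrite (gfree_nonneg xi); exists 0%N => n _; exists 0, 0.
  by split; [exact: (grading0 gH)|rewrite linear0 subrr addr0].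
Qed.

Lemma ker_ev_decomp x : ev x = 0 -> exists2 x', x' \in hker & exists y, x = x' + (shift y - y).
Proof.
move=> ex; have [N /(_ N (leqnn N))[x' [y [x'N xE]]]] := shift_decomp x.
exists x'; last by exists y.
have ex' : ev x' = 0 by move: ex; rewrite xE linearD linearB ev_shift subrr addr0.
by apply/hkerP => j; rewrite (hcompE gH _ x'N); case: eqP; rewrite ?linear0.
Qed.

(** The sequence 0 -> M[t] -> M[t] -> M -> 0 is used on the level of kernels: 0 -> hker -> hker x
    P[t] -> ker ev -> 0, with maps y -> (y - t y, y) and (x, y) -> x + t y - y. One extra dimension
    comes from this quotient, the other from the cover [ev]. *)
Lemma pdim_homogenization n : pdim n hker_mod -> pdim n.+2 M.
Proof.
move=> pK; exists hfree, ev; split; first exact: freeg_projective.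
  by move=> m; exists << (m, 0%N) >>; rewrite /= liftU scale1r.
have pH : pdim n hfree by elim: n {pK} => [|n /pdimS//]; apply: freeg_projective.
pose T : lmodType A := (hker_mod * hfree)%type.
have i1k (y : hker_mod) : val y - shift (val y) \in hker.
  by rewrite rpredB ?shift_hker //; apply: (submodP y).
pose i1 (y : hker_mod) : T := (Submod (i1k y), val y).
have i1l : linear i1.
  move=> a x y; congr pair; apply: val_inj => /=.
  by rewrite linearP scalerBr opprD addrACA.
have [i iE] := linear_exists i1l.
have Fk (x : T) : val x.1 + (shift x.2 - x.2) \in lker ev.
  by rewrite unfold_in !linearD linearN ev_shift subrr addr0 hker_ev //; apply: (submodP x.1).
have Fl : linear (fun x : T => Submod (Fk x) : submod (lker ev)).
  move=> a x y; apply: val_inj => /=.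
  rewrite linearP opprD scalerDr scalerBr [RHS]addrACA; congr (_ + _).
  exact: addrACA.
have [F FE] := linear_exists Fl.
have j1l : linear (fun x : hker_mod => (x, 0) : T).
  by move=> a x y; congr pair; rewrite /= scaler0 addr0.
have [j jE] := linear_exists j1l.
have pT : pdim n T.
  apply: (pdim_extension (i := j) (p := snd)) pK pH.
  - by move=> x y; rewrite !jE => -[].
  - by move=> y; exists (0, y).
  - move=> [x y] /=; split=> [->|[z]]; first by exists x; rewrite jE.
    by rewrite jE => -[_ <-].
apply: (pdim_quotient (i := i) (p := F)) pK pT.
- by move=> x y; rewrite !iE => -[_ /val_inj].
- move=> y; have [x xk [z yE]] := ker_ev_decomp (eqP (submodP y)).
  by exists (Submod xk, z); rewrite FE; apply: val_inj.
- move=> [x y]; rewrite FE; split=> [/(congr1 val) /= xy|[z <-]]; last first.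
    by apply: val_inj; rewrite iE /= addrA subrK subrr.
  have yk : y \in hker.
    apply: hker_shift; have <- : - val x = shift y - y.
      by apply/eqP; rewrite eq_sym -addr_eq0 addrC xy.
    by rewrite rpredN; apply: (submodP x).
  exists (Submod yk); rewrite iE /i1; congr pair; apply: val_inj => /=.
  by apply/esym/eqP; rewrite -subr_eq0 opprB; apply/eqP.
Qed.

End Homogenization.

Section FiniteGlobalDimension.
Variables (k : fieldType) (A : cgAlg k).

Lemma pdim_finite_gldim d : (forall N : grMod A, gr_nonneg N -> pdim d N) ->
  finite_left_gldim A.
Proof.
move=> pd; exists d.+2 => M; apply/pdim_projdim/pdim_homogenization/pd.
exact: hker_nonneg.
Qed.

(** Tor of k with left modules is computed by resolving k as a right module, so the right resolution
    bounds the left global dimension. *)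
Lemma finite_gldim_left (G : minres (opp_alg A)) d :
  mr_rank G d.+1 = 0%N -> finite_left_gldim A.
Proof.
move=> rd; apply: (@pdim_finite_gldim d) => N N0.
apply: (@tor_vanish_pdim _ _ _ (tr_mx G)) (mr_base G) _ _ N0 _.
- exact: tr_mxM0.
- exact: tr_mx_exact.
- exact: tr_mx_exact0.
- exact: tr_mx_min.
- move=> y _; exists (fun=> 0) => b.
  by move: (ltn_ord b); rewrite [X in (_ < X)%N]rd.
Qed.

End FiniteGlobalDimension.

Section OppositeResolution.
Variables (k : fieldType) (A : cgAlg k) (F : minres A).

Let AA := opp_alg (opp_alg A).

Lemma map_aug_opp m n (X : 'M[A]_(m, n)) :
  map_mx (@aug k AA) (X : 'M[AA]_(m, n)) = map_mx (@aug k A) X.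
Proof. by apply/matrixP => i j; rewrite !mxE !aug_opp. Qed.

(** The data of F serve unchanged; only the augmentation of the double opposite has to be identified
    with that of A. *)
Definition opp_minres : minres AA.
Proof.
refine (@MinRes k AA (mr_rank F) (@mr_deg _ _ F) (mr_mx F) _ _ _ _ (mr_base F)
  (@mr_base_unique _ _ F) (mr_base_deg F)).
- exact: (@mr_homog _ _ F).
- by move=> v; rewrite map_aug_opp; exact: (@mr_exact0 _ _ F v).
- by move=> i v; exact: (@mr_exact _ _ F i v).
- by move=> i; rewrite map_aug_opp; exact: (@mr_min _ _ F i).
Defined.

End OppositeResolution.

Lemma finite_gldim_minres (k : fieldType) (A : cgAlg k) (F : minres A)
    (G : minres (opp_alg A)) d :
  mr_rank F d.+1 = 0%N -> mr_rank G d.+1 = 0%N -> finite_gldim A.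
Proof.
move=> rF rG; split; first exact: (finite_gldim_left rG).
exact: (@finite_gldim_left _ (opp_alg A) (opp_minres F) d rF).
Qed.

(** * Hilbert series and growth *)

Section Dimension.
Variables (k : fieldType) (A : algType k).

Definition klinear n (V : lmodType A) (f : 'rV[k]_n -> V) : Prop :=
  forall c u v, f (c *: u + v) = c%:A *: f u + f v.

(** Dimension through a parametrization, because S is a mere subset of an A-module that may be
    infinite-dimensional over k. *)
Definition hasdim (V : lmodType A) (S : set V) (n : nat) : Prop :=
  exists f : 'rV[k]_n -> V, [/\ klinear f, injective f & forall x, S x <-> exists u, f u = x].

Section KLinear.
Variables (n : nat) (V : lmodType A) (f : 'rV[k]_n -> V).
Hypothesis fl : klinear f.

Lemma klinear0 : f 0 = 0.
Proof. by have := fl (-1) 0 0; rewrite scaler0 addr0 !scaleN1r addNr. Qed.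

Lemma klinearD u v : f (u + v) = f u + f v.
Proof. by have := fl 1 u v; rewrite !scale1r. Qed.

Lemma klinearZ c u : f (c *: u) = c%:A *: f u.
Proof. by have := fl c u 0; rewrite klinear0 !addr0. Qed.

Lemma klinearN u : f (- u) = - f u.
Proof. by rewrite -[- u]scaleN1r klinearZ !scaleN1r. Qed.

Lemma klinear_sum (I : Type) (r : seq I) (F : I -> 'rV[k]_n) :
  f (\sum_(i <- r) F i) = \sum_(i <- r) f (F i).
Proof. exact: (big_morph f klinearD klinear0). Qed.

Lemma klinear_comp (W : lmodType A) (g : {linear V -> W}) : klinear (g \o f).
Proof. by move=> c u v; rewrite /= fl linearP. Qed.

Lemma klinear_mulmx m (X : 'M[k]_(m, n)) : klinear (fun u => f (u *m X)).
Proof. by move=> c u v; rewrite mulmxDl -scalemxAl fl. Qed.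

Lemma klinear_dependent m (x : 'I_m -> V) : (n < m)%N ->
  (forall i, exists u, f u = x i) ->
  exists2 c : 'rV[k]_m, c != 0 & \sum_i (c 0 i)%:A *: x i = 0.
Proof.
move=> nm /choice[u uP]; pose U := \matrix_i u i.
have /rowV0Pn[c] : kermx U != 0.
  by rewrite kermx_eq0 /row_free neq_ltn (leq_ltn_trans (rank_leq_col U)).
move=> /sub_kermxP cU c0; exists c => //.
transitivity (f (c *m U)); last by rewrite cU klinear0.
rewrite mulmx_sum_row klinear_sum; apply: eq_bigr => i _.
by rewrite klinearZ rowK uP.
Qed.

End KLinear.

Lemma hasdim_le (V : lmodType A) (S T : set V) n m : S `<=` T -> hasdim S n -> hasdim T m ->
  (n <= m)%N.
Proof.
move=> ST [f [fl fi fS]] [g [gl gi gT]]; rewrite leqNgt; apply/negP => mn.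
have [|c c0] := klinear_dependent gl (x := fun i => f (delta_mx 0 i)) mn.
  by move=> i; apply/gT/ST/fS; exists (delta_mx 0 i).
rewrite (eq_bigr (fun i => f (c 0 i *: delta_mx 0 i))) => [|i _]; last by rewrite klinearZ.
rewrite -klinear_sum // -row_sum_delta -(klinear0 fl) => /fi ce.
by rewrite ce eqxx in c0.
Qed.

Lemma hasdim_unique (V : lmodType A) (S : set V) n m : hasdim S n -> hasdim S m -> n = m.
Proof.
by move=> Sn Sm; apply/eqP; rewrite eqn_leq (hasdim_le _ Sn Sm) // (hasdim_le _ Sm Sn).
Qed.

(** Take a matrix of maximal rank whose row space lies in S: adding a vector of S cannot raise the
    rank. *)
Lemma subspace_rowspace n (S : set 'rV[k]_n) : S 0 ->
  (forall c u v, S u -> S v -> S (c *: u + v)) ->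
  exists M : 'M[k]_n, forall v, S v <-> (v <= M)%MS.
Proof.
move=> S0 SP; pose P m := `[< exists M : 'M[k]_n, \rank M = m /\ forall v, (v <= M)%MS -> S v >].
have Pex : exists m, P m.
  exists 0%N; apply/asboolP; exists 0; split; first exact: mxrank0.
  by move=> v; rewrite submx0 => /eqP->.
have Pub m : P m -> (m <= n)%N by move=> /asboolP[M [<- _]]; apply: rank_leq_col.
case: (ex_maxnP Pex Pub) => m /asboolP[M [rM MS]] m_max.
exists M => v; split=> [Sv|/MS//].
have /m_max : P (\rank (M + v)%MS).
  apply/asboolP; exists (M + v)%MS; split=> // w /sub_addsmxP[[u1 u2] /= ->].
  rewrite addrC (mx11_scalar u2) mul_scalar_mx; apply: SP => //.
  by apply: MS; apply: submxMl.
rewrite -rM => le.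
have := mxrank_leqif_sup (addsmxSl M v) => -[le'].
rewrite eqn_leq le' le /= => /esym h.
by apply: submx_trans h; apply: addsmxSr.
Qed.

(** Rank-nullity: in coordinates the kernel is the row space of a matrix M, and the complement [M^C]
    maps isomorphically onto the image. *)
Lemma hasdim_exact (V W : lmodType A) (g : {linear V -> W}) (S : set V) n : hasdim S n ->
  exists a b, [/\ hasdim [set x | S x /\ g x = 0] a, hasdim [set g x | x in S] b
    & (a + b)%N = n].
Proof.
move=> [f [fl fi fS]].
have gfl := klinear_comp fl g.
have [||M MP] := @subspace_rowspace n [set u | g (f u) = 0].
- by rewrite /= klinear0 // linear0.
- by move=> c u v /= u0 v0; rewrite fl linearP u0 v0 scaler0 addr0.
exists (\rank M), (\rank (M^C)%MS); split; last first.
- by rewrite mxrank_compl subnKC // rank_leq_col.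
- exists (fun u => g (f (u *m row_base (M^C)%MS))); split.
  + exact: (klinear_mulmx gfl).
  + move=> u v; set X := row_base _ => uv.
    have : ((u - v) *m X <= M)%MS.
      apply/MP; rewrite /= mulmxBl klinearD // klinearN // linearB uv subrr //.
    have : ((u - v) *m X <= M^C)%MS by rewrite (submx_trans (submxMl _ _)) ?eq_row_base.
    move=> h1 h2; have : ((u - v) *m X <= M :&: M^C)%MS by rewrite sub_capmx h2.
    rewrite (capmx_compl M) submx0 => /eqP uvX; apply/eqP; rewrite -subr_eq0; apply/eqP.
    by apply: (row_free_inj (row_base_free _)); rewrite uvX mul0mx.
  + move=> y; split=> [[x /fS[u <-] <-]|[u <-]]; last first.
      by eexists; [|reflexivity]; apply/fS; eexists; reflexivity.
    have /sub_addsmxP[[u1 u2] /= uE] : (u <= M + M^C)%MS by rewrite submx_full ?addsmx_compl_full.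
    have /submxP[w wE] : (u2 *m (M^C)%MS <= row_base (M^C)%MS)%MS.
      by rewrite eq_row_base submxMl.
    exists w; rewrite -wE uE klinearD // linearD.
    have -> : g (f (u1 *m M)) = 0 by apply/MP/submxMl.
    by rewrite add0r.
exists (fun u => f (u *m row_base M)); split; first exact: klinear_mulmx.
- by move=> u v /fi; apply: row_free_inj; apply: row_base_free.
move=> x; split=> [[/fS[u <-] u0]|[u <-]].
  have /submxP[w wE] : (u <= row_base M)%MS by rewrite eq_row_base; apply/MP.
  by exists w; rewrite -wE.
split; first by apply/fS; eexists; reflexivity.
by apply/MP; rewrite (submx_trans (submxMl _ _)) ?eq_row_base.
Qed.

Lemma hasdim_row1 (S : set A) n : hasdim (S : set A^o) n ->
  hasdim [set v : 'rV[A]_1 | S (v 0 0)] n.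
Proof.
move=> [f [fl fi fS]]; exists (fun u => (f u)%:M); split.
- by move=> c u v; rewrite fl raddfD /= scale_scalar_mx.
- by move=> u v /matrixP/(_ 0 0); rewrite !mxE eqxx !mulr1n; apply: fi.
move=> x; split=> [/fS[u uE]|[u <-]].
  by exists u; rewrite uE; apply/matrixP => a b; rewrite !ord1 mxE eqxx mulr1n.
by rewrite /= mxE eqxx mulr1n; apply/fS; exists u.
Qed.

Lemma hasdim_row_mx m1 m2 (S1 : set 'rV[A]_m1) (S2 : set 'rV[A]_m2) n1 n2 :
  hasdim S1 n1 -> hasdim S2 n2 ->
  hasdim [set v | S1 (lsubmx v) /\ S2 (rsubmx v)] (n1 + n2).
Proof.
move=> [f [fl fi fS]] [g [gl gi gS]].
exists (fun u => row_mx (f (lsubmx u)) (g (rsubmx u))); split.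
- move=> c u v; rewrite !linearP /= fl gl -add_row_mx -scale_row_mx //.
- move=> u v /eq_row_mx[/fi lu /gi ru]; by rewrite -[u]hsubmxK lu ru hsubmxK.
move=> x; split=> [[/fS[u uE] /gS[v vE]]|[u <-]].
  by exists (row_mx u v); rewrite row_mxKl row_mxKr uE vE hsubmxK.
by rewrite /= row_mxKl row_mxKr; split; [apply/fS|apply/gS]; eexists; reflexivity.
Qed.

Lemma hasdim_row m (S : 'I_m -> set A) (n : 'I_m -> nat) :
  (forall i, hasdim (S i : set A^o) (n i)) ->
  hasdim [set v : 'rV[A]_m | forall i, S i (v 0 i)] (\sum_i n i).
Proof.
elim: m S n => [|m IHm] S n Sn.
  rewrite big_ord0; exists (fun=> 0); split.
  - by move=> c u v; rewrite scaler0 addr0.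
  - by move=> u v _; rewrite [u]thinmx0 [v]thinmx0.
  - move=> x; split=> [_|_ []//]; by exists 0; rewrite [RHS]thinmx0.
rewrite big_ord_recl.
have := hasdim_row_mx (hasdim_row1 (Sn ord0)) (IHm _ _ (fun i => Sn (fintype.lift ord0 i))).
congr (hasdim _ _); apply/seteqP; split=> v /=.
- move=> [v0 v1] i; case: (unliftP ord0 i) => [j|] ->.
    by have := v1 j; rewrite mxE; congr (S _ (v _ _)); apply: val_inj.
  by move: v0; rewrite mxE; congr (S _ (v _ _)); apply: val_inj.
- move=> vS; split=> [|i].
    by have := vS ord0; rewrite mxE; congr (S _ (v _ _)); apply: val_inj.
  by have := vS (fintype.lift ord0 i); rewrite mxE; congr (S _ (v _ _)); apply: val_inj.
Qed.

End Dimension.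

Section HilbertSeries.
Variables (k : fieldType) (A : cgAlg k) (F : minres A).

(** A generator of degree 0 would map to a scalar of augmentation 0, that is to 0, and so give a
    relation with a unit entry, against minimality. *)
Lemma mr_deg_gt0 (a : 'I_(mr_rank F 1)) : (0 < mr_deg a)%N.
Proof.
rewrite lt0n; apply/eqP => a0.
have ra : row a (mr_mx F 0) = 0.
  apply/rowP => b; rewrite !mxE; have := mr_homog a b.
  rewrite a0 (mr_base_unique b) mr_base_deg => /zhomog_scalar->//.
  by have /matrixP/(_ a (mr_base F)) := mr_min F 0; rewrite !mxE => ->; rewrite scale0r.
have /mr_exact[w wE] : (delta_mx 0 a : 'rV[A]_(mr_rank F 1)) *m mr_mx F 0 = 0.
  by rewrite -rowE.
have := congr1 (map_mx (@aug k A)) wE; rewrite map_mxM mr_min mulmx0.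
move=> /matrixP/(_ 0 a); rewrite !mxE !eqxx rmorph1 => /eqP.
by rewrite oner_eq0.
Qed.

Lemma hasdim_set0 (V : lmodType A) : hasdim [set 0 : V] 0.
Proof.
exists (fun=> 0); split.
- by move=> c u v; rewrite scaler0 addr0.
- by move=> u v _; rewrite [u]thinmx0 [v]thinmx0.
- by move=> x; split=> [->|[_ <-//]]; exists 0.
Qed.

Lemma mr_homog_lift0 j (v : mr_mod F 0) : gm_homog j v ->
  map_mx (@aug k A) (v : 'rV_(mr_rank F 0)) = 0 -> exists2 w, gm_homog j w & mr_d F 0 w = v.
Proof.
move=> vj /mr_exact0[w wE]; apply: homog_lift vj _; first exact: mr_d0.
by exists w.
Qed.

Lemma zhomog0_hasdim : hasdim (@zhomog k A 0 : set A^o) 1.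
Proof.
exists (fun u : 'rV_1 => (u 0 0)%:A); split.
- move=> c u v; rewrite !mxE scalerDl; congr (_ + _).
  by rewrite -[RHS]/(c%:A * (u 0 0)%:A) -scalerAl mul1r scalerA.
- by move=> u v /scalar_inj uv; apply/rowP => a; rewrite !ord1.
- move=> x; split=> [/cg_conn[c ->]|[u <-]]; last by apply/cg_conn; eexists.
  by exists c%:M; rewrite mxE eqxx mulr1n.
Qed.

(** For n > 0, A_n is the image of the degree n part of F_1, which is built from the A_{n - deg a}
    with deg a > 0; hence the induction on n. *)
Lemma zhomog_hasdim j : exists h, hasdim (@zhomog k A j : set A^o) h.
Proof.
case: j => [n|n]; last by exists 0%N; apply: hasdim_set0.
elim/ltn_ind: n => n IHn; have [->|n0] := posnP n.
  by exists 1%N; apply: zhomog0_hasdim.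
have /choice[h hP] : forall a : 'I_(mr_rank F 1), exists h,
    hasdim (@zhomog k A (n%:Z - (mr_deg a)%:Z) : set A^o) h.
  move=> a; case E: (_ - _) => [m|m]; last by exists 0%N; apply: hasdim_set0.
  by apply: IHn; rewrite -ltz_nat -E ltrBlDr ltrDl ltz_nat mr_deg_gt0.
have gl : linear (fun v : 'rV[A]_(mr_rank F 1) => (v *m mr_mx F 0) 0 (mr_base F) : A^o).
  by move=> c u v; rewrite mulmxDl -scalemxAl !mxE.
have [g gE] := linear_exists gl.
have [_ [b [_ Tb _]]] := hasdim_exact g (hasdim_row hP).
exists b; move: Tb; congr (hasdim _ _); apply/seteqP; split=> x.
  move=> [v /= vn <-]; rewrite gE.
  have := @mr_d0 _ _ F 0 n%:Z v _ 0 (mr_base F); rewrite mr_base_deg subr0; apply.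
  by move=> i a; rewrite ord1.
move=> xn; have xa : aug x = 0 by apply: (aug_homog xn).
have [||w wn wE] := @mr_homog_lift0 n%:Z (const_mx x).
- by move=> i a; rewrite mxE (mr_base_unique a) mr_base_deg subr0.
- by rewrite map_const_mx xa; apply/matrixP => i a; rewrite !mxE.
- exists w; first by move=> a; apply: wn.
  by rewrite gE; have /matrixP/(_ 0 (mr_base F)) := wE; rewrite [in RHS]mxE.
Qed.

Definition hilb (j : int) : nat := projT1 (cid (zhomog_hasdim j)).

Lemma hilbP j : hasdim (@zhomog k A j : set A^o) (hilb j).
Proof. by rewrite /hilb; case: cid. Qed.

Lemma hilb_neg n : hilb (Negz n) = 0%N.
Proof. by apply: (hasdim_unique (hilbP (Negz n))); apply: hasdim_set0. Qed.

Lemma frow_hasdim n (dg : 'I_n -> int) j :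
  hasdim (@gm_homog _ _ (frow A dg) j) (\sum_a hilb (j - dg a)).
Proof.
have := hasdim_row (fun a => hilbP (j - dg a)); congr (hasdim _ _).
apply/seteqP; split=> v /= vj; last by move=> a; apply: vj.
by move=> i a; rewrite ord1.
Qed.

Definition mr_hilb i j : nat := \sum_a hilb (j - (@mr_deg _ _ F i a)%:Z).

Definition mr_image i j : set (mr_mod F i) :=
  [set mr_d F i x | x in @gm_homog _ _ (mr_mod F i.+1) j].
Arguments mr_image : clear implicits.

Lemma mr_image_ker i j : [set x | gm_homog j x /\ mr_d F i x = 0] = mr_image i.+1 j.
Proof.
apply/seteqP; split=> x.
  move=> [xj /mr_exact[w wE]].
  have [|y yj yE] := homog_lift (@mr_d0 _ _ F i.+1) xj; first by exists w.
  by exists y.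
move=> [w wj <-]; split; first exact: mr_d0.
by apply/mr_exact; exists w.
Qed.

Lemma exists_mr_image_dim : exists kap : nat -> int -> nat,
  (forall i j, hasdim (mr_image i j) (kap i j)) /\
  forall i j, mr_hilb i.+1 j = (kap i.+1 j + kap i j)%N.
Proof.
have /choice[kap kapP] : forall i, exists kap, forall j, hasdim (mr_image i j) (kap j).
  move=> i; suff /choice[f fP] : forall j, exists h, hasdim (mr_image i j) h by exists f.
  move=> j; have [_ [b [_ Tb _]]] := hasdim_exact (mr_d F i) (frow_hasdim _ j).
  by exists b.
exists kap; split=> // i j.
have [a [b [Ka Tb ab]]] := hasdim_exact (mr_d F i) (frow_hasdim _ j).
rewrite /mr_hilb -ab; congr addn; last exact: hasdim_unique Tb (kapP i j).
by rewrite mr_image_ker in Ka; apply: hasdim_unique Ka (kapP i.+1 j).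
Qed.

Lemma hilb0 : hilb 0 = 1%N.
Proof. exact: hasdim_unique (hilbP 0) zhomog0_hasdim. Qed.

Lemma mr_hilb0 j : mr_hilb 0 j = hilb j.
Proof.
rewrite /mr_hilb (bigD1 (mr_base F)) //= mr_base_deg subr0 big1 ?addn0 // => a.
by rewrite (mr_base_unique a) eqxx.
Qed.

Lemma mr_image0_dim kap j : hasdim (mr_image 0 j) kap -> hilb j = (kap + (j == 0%R))%N.
Proof.
have [->|j0] := eqVneq j 0.
  rewrite hilb0 => Kd; suff <- : 0%N = kap by [].
  apply: hasdim_unique Kd; rewrite (_ : mr_image 0 0 = [set 0]); first exact: hasdim_set0.
  apply/seteqP; split=> x; last first.
    by move=> ->; exists 0; [exact: (grading0 (gm_grading _))|rewrite linear0].
  move=> [w w0 <-]; apply/rowP => a; rewrite [RHS]mxE.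
  have := @mr_d0 _ _ F 0 0 w w0 0 a; rewrite (mr_base_unique a) mr_base_deg subr0.
  move=> /zhomog_scalar->//; suff -> : aug ((mr_d F 0 w : 'rV_ _) 0 (mr_base F)) = 0.
    by rewrite scale0r.
  have : map_mx (@aug k A) ((w : 'rV_ _) *m mr_mx F 0) = 0 by rewrite map_mxM mr_min mulmx0.
  by move=> /matrixP/(_ 0 (mr_base F)); rewrite [LHS]mxE [RHS]mxE.
rewrite addn0 -mr_hilb0 => Kd; apply: hasdim_unique (frow_hasdim _ j) _.
move: Kd; congr (hasdim _ _); apply/seteqP; split=> x.
  by move=> [w wj <-]; apply: mr_d0.
move=> xj; have [|w wj wE] := mr_homog_lift0 xj; last by exists w.
apply/matrixP => i a; rewrite !mxE ord1; have := xj 0 a.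
by rewrite (mr_base_unique a) mr_base_deg subr0 => /aug_zhomog->.
Qed.

(** Euler characteristic in degree j: the dimensions of the images telescope, and the last one is 0
    because F_{d+1} = 0. *)
Lemma hilbert_identity d j : mr_rank F d.+1 = 0%N ->
  \sum_(i < d.+1) (-1) ^+ i * (mr_hilb i j)%:Z = (j == 0)%:Z.
Proof.
have [kap [kapP kapE]] := exists_mr_image_dim.
move=> rd; suff h m : \sum_(i < m.+1) (-1) ^+ i * (mr_hilb i j)%:Z
    = (j == 0)%:Z + (-1) ^+ m * (kap m j)%:Z.
  rewrite h; suff -> : kap d j = 0%N by rewrite mulr0 addr0.
  apply: hasdim_unique (kapP d j) _; rewrite (_ : mr_image d j = [set 0]).
    exact: hasdim_set0.
  apply/seteqP; split=> x; last first.
    by move=> ->; exists 0; [exact: (grading0 (gm_grading _))|rewrite linear0].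
  move=> [w _ <-]; apply/rowP => a; rewrite !mxE big1 // => b _.
  by move: (ltn_ord b); rewrite [X in (_ < X)%N]rd.
elim: m => [|m IHm].
  by rewrite big_ord1 !mul1r mr_hilb0 (mr_image0_dim (kapP 0%N j)) PoszD addrC.
rewrite big_ord_recr IHm /= kapE PoszD exprS mulN1r !mulNr mulrDr.
by rewrite opprD [- _ - _]addrC addrA addrK.
Qed.

End HilbertSeries.

(** * Subexponential and polynomial growth *)

Section Geometric.
Variable R : archiNumFieldType.

Lemma bernoulli_ge (x : R) n : 0 <= x -> 1 + n%:R * x <= (1 + x) ^+ n.
Proof.
move=> x0; elim: n => [|n IHn]; first by rewrite mul0r addr0.
rewrite exprS -natr1 mulrDl mul1r addrA [X in _ <= X]mulrDl mul1r.
apply: lerD => //; apply: ler_peMr => //; apply: le_trans IHn.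
by rewrite lerDl mulr_ge0.
Qed.

Lemma geometric_small (y e : R) : 0 <= y -> y < 1 -> 0 < e ->
  exists N, forall n, (N <= n)%N -> y ^+ n < e.
Proof.
move=> y0 y1 e0; have [->|yn0] := eqVneq y 0.
  by exists 1%N => -[//|n] _; rewrite expr0n.
have {}y0 : 0 < y by rewrite lt0r yn0.
pose x := y^-1 - 1; have x0 : 0 < x by rewrite subr_gt0 invf_gt1.
have ye : y^-1 = 1 + x by rewrite addrC subrK.
have b0 : 0 <= (e * x)^-1 by rewrite invr_ge0 mulr_ge0 // ltW.
exists (Num.bound (e * x)^-1) => n Nn.
rewrite -[y ^+ n]invrK invf_plt ?posrE ?invr_gt0 ?exprn_gt0 //.
rewrite -exprVn ye; apply: lt_le_trans (bernoulli_ge n (ltW x0)).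
apply: (@lt_le_trans _ _ (n%:R * x)); last by rewrite lerDr.
rewrite -ltr_pdivrMr // -invfM (lt_le_trans (archi_boundP b0)) //.
by rewrite ler_nat.
Qed.

End Geometric.

Section SubexponentialGrowth.
Variables (k : fieldType) (A : cgAlg k) (F : minres A).
Hypothesis noethA : left_noetherian A.

Lemma hilb_le_gens m (a : 'cV[A]_m) (e : 'I_m -> nat) (n : nat) :
  (forall i, cg_homog (e i) (a i 0)) ->
  (forall x, cg_homog n x -> row_span a x%:M) ->
  (hilb F n <= \sum_i hilb F (n%:Z - (e i)%:Z))%N.
Proof.
move=> ae an.
have gl : linear (fun v : frow A (fun i => (e i)%:Z) => ((v : 'rV_m) *m a) 0 0 : reg_mod A).
  by move=> c u v; rewrite mulmxDl -scalemxAl !mxE.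
have [g gE] := linear_exists gl.
have g0 : @degree0 _ _ (frow A (fun i => (e i)%:Z)) (reg_mod A) g.
  move=> j v vj; rewrite gE mxE; apply: (grading_sum (@zhomog_grading k A)) => i _ _.
  by rewrite -(subrK (e i)%:Z j); apply: zhomog_mul; [apply: vj|apply: ae].
have [c [b [_ Tb cb]]] := hasdim_exact g (frow_hasdim F (fun i => (e i)%:Z) n%:Z).
apply: (@leq_trans b); last by rewrite -cb leq_addl.
apply: hasdim_le (hilbP F n%:Z) Tb => x xn.
have [u _ ux] := an x xn.
have [|v vn gv] := homog_lift (j := n%:Z) g0 xn.
  exists u; rewrite gE /= ux mxE eqxx mulr1n //.
by exists v.
Qed.

(* Among the left ideals generated by homogeneous elements of degrees e_i with
   sum of r^(e_i) < 1, a maximal one contains A_n for all large n, so that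
   h_n <= sum of h_(n - e_i). *)
Lemma hilb_subexponential (r : rat) : 0 < r -> r < 1 ->
  exists C : rat, forall n : nat, (hilb F n)%:R * r ^+ n <= C.
Proof.
move=> r0 r1.
pose gens I m (a : 'cV[A]_m) (e : 'I_m -> nat) :=
  [/\ forall i, cg_homog (e i) (a i 0), \sum_i r ^+ e i < 1 & I = [set x | row_span a x%:M]].
pose Fam : set (set A) := [set I | exists m a e, @gens I m a e].
have [||I [m [a [e [ae we IE]]]] Imax] :=
    @noetherian_max A noethA Fam [set x | row_span (0 : 'cV[A]_0) x%:M].
- by exists 0%N, 0, (fun=> 0%N); split=> //; [case|rewrite big_ord0].
- by move=> I [m [a [e [_ _ ->]]]]; apply: row_span_ideal.
(* From N on, r^n is smaller than the slack in the sum of weights, so an element of degree n may be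
   adjoined within the family; maximality then puts it in I. *)
have [N NP] : exists N, forall n, (N <= n)%N -> r ^+ n < 1 - \sum_i r ^+ e i.
  by apply: geometric_small; rewrite ?subr_gt0 // ltW.
have AnI n x : (N <= n)%N -> cg_homog n x -> row_span a x%:M.
  move=> Nn xn; pose b := col_mx a x%:M.
  pose e' (i : 'I_(m + 1)) := match fintype.split i with inl i => e i | inr _ => n end.
  have bI : [set x | row_span b x%:M] `<=` I.
    apply: Imax.
      exists (m + 1)%N, b, e'; split=> //.
        move=> i; rewrite /b /e' mxE; case: (fintype.split i) => j; first exact: ae.
        by rewrite mxE ord1 eqxx mulr1n.
      rewrite big_split_ord big_ord1 /=.
      under eq_bigr do rewrite /e' (unsplitK (inl _)).
      by rewrite /e' (unsplitK (inr _)) addrC -ltrBrDr; apply: NP.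
    rewrite IE => y [u _ uE]; exists (row_mx u 0) => //.
    by rewrite mul_row_col mul0mx addr0.
  have : I x.
    apply: bI; exists (row_mx 0 1%:M) => //.
    by rewrite mul_row_col mul0mx mul1mx add0r.
  by rewrite IE.
have e_gt0 i : (0 < e i)%N.
  rewrite lt0n; apply/eqP => ei; have : r ^+ e i <= \sum_i r ^+ e i.
    rewrite (bigD1 i) //= lerDl; apply: sumr_ge0 => j _; exact/exprn_ge0/ltW.
  by rewrite ei expr0 leNgt we.
pose b n := (hilb F (Posz n))%:R * r ^+ n.
have b0 n : 0 <= b n by rewrite mulr_ge0 // exprn_ge0 // ltW.
(* This bounds the first N terms trivially, and it propagates because the weights r^(e_i) sum to
   less than 1. *)
exists (\sum_(n < N) b n) => n; rewrite -/(b n).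
have C0 : 0 <= \sum_(n < N) b n by apply: sumr_ge0.
elim/ltn_ind: n => n IHn; have [nN|Nn] := ltnP n N.
  by rewrite (bigD1 (Ordinal nN)) //= lerDl; apply: sumr_ge0.
apply: (@le_trans _ _ (\sum_i (hilb F (n%:Z - (e i)%:Z))%:R * r ^+ n)).
  rewrite -mulr_suml -natr_sum ler_wpM2r ?exprn_ge0 ?(ltW r0) // ler_nat.
  by apply: hilb_le_gens ae _ => x; apply: AnI.
apply: (@le_trans _ _ (\sum_i r ^+ e i * \sum_(n < N) b n)); last first.
  by rewrite -mulr_suml ler_piMl // ltW.
apply: ler_sum => i _; have [en|ne] := leqP (e i) n; last first.
  have : n%:Z - (e i)%:Z < 0 by rewrite subr_lt0.
  case: (_ - _) => // l _; rewrite hilb_neg mul0r mulr_ge0 ?exprn_ge0 //; exact: ltW.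
rewrite subzn // -{2}(subnK en) exprD mulrA mulrC ler_wpM2l ?exprn_ge0 ?(ltW r0) //.
by apply: IHn; rewrite ltn_subrL e_gt0 (leq_trans (e_gt0 i)).
Qed.

End SubexponentialGrowth.

Section PolynomialGrowth.
Implicit Types (g q : {poly algC}) (N n : nat).

(** Dividing by X - rho costs one power of n + 1: as |rho| >= 1, |g_n| exceeds |g_{n-1}| by at most
    the n-th coefficient of the product, and there are n + 1 such increments. *)
Lemma coef_bound_linear rho g N m (B : algC) : 1 <= `|rho| -> 0 <= B ->
  (forall n, (n < N)%N -> `|(('X - rho%:P) * g)`_n| <= B * n.+1%:R ^+ m) ->
  forall n, (n < N)%N -> `|g`_n| <= B * n.+1%:R ^+ m.+1.
Proof.
move=> rho1 B0 Bg.
have h n : (n < N)%N -> `|g`_n| <= \sum_(i < n.+1) B * i.+1%:R ^+ m.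
  elim: n => [|n IHn] nN.
    rewrite big_ord1; apply: le_trans (Bg 0%N nN).
    by rewrite mulrBl coefB coefXM coefCM sub0r normrN normrM ler_peMl.
  rewrite big_ord_recr /=.
  have := Bg n.+1 nN; rewrite mulrBl coefB coefXM coefCM /= => le.
  apply: (@le_trans _ _ `|rho * g`_n.+1|); first by rewrite normrM ler_peMl.
  rewrite -[rho * _](subKr g`_n) (le_trans (ler_normB _ _)) // lerD //.
  exact/IHn/ltnW.
move=> n nN; apply: le_trans (h n nN) _.
apply: (@le_trans _ _ (\sum_(i < n.+1) B * n.+1%:R ^+ m)).
  apply: ler_sum => i _; rewrite ler_wpM2l // lerXn2r ?nnegrE ?ler0n // ler_nat.
  exact: ltn_ord.
by rewrite sumr_const card_ord exprSr mulrA mulr_natr.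
Qed.

Lemma coef_bound_prod (s : seq algC) g N (B : algC) : 0 <= B ->
  (forall rho, rho \in s -> 1 <= `|rho|) ->
  (forall n, (n < N)%N -> `|((\prod_(rho <- s) ('X - rho%:P)) * g)`_n| <= B) ->
  forall n, (n < N)%N -> `|g`_n| <= B * n.+1%:R ^+ size s.
Proof.
move=> B0; elim: s g => [|rho s IHs] g s1 Bg n nN.
  by rewrite mulr1 (le_trans _ (Bg n nN)) // big_nil mul1r.
apply: (@coef_bound_linear rho g N (size s)) nN => //; first exact/s1/mem_head.
apply: IHs => [z zs|n' n'N]; first by apply: s1; rewrite inE zs orbT.
by have := Bg n' n'N; rewrite big_cons [_ * \prod_(_ <- _) _]mulrC -mulrA.
Qed.


Variables (q : {poly algC}) (h : nat -> nat).
(** The power series identity q (h_0 + h_1 X + ...) = 1, expressed through truncations so that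
    everything stays polynomial. *)
Hypothesis qh : forall N n, (n < N)%N -> (q * \poly_(i < N) (h i)%:R)`_n = (n == 0%N)%:R.
Hypothesis h_bound : forall r : rat, 0 < r -> r < 1 ->
  exists C : rat, forall n, (h n)%:R * r ^+ n <= C.

Lemma mul_poly_coef_le (p g : {poly algC}) (M : algC) n : (forall i, `|g`_i| <= M) ->
  `|(p * g)`_n| <= (\sum_(j < size p) `|p`_j|) * M.
Proof.
move=> gM; have M0 : 0 <= M by apply: le_trans (normr_ge0 _) (gM 0%N).
rewrite -{1}[p]coefK poly_def mulr_suml coef_sum (le_trans (ler_norm_sum _ _ _)) //.
rewrite mulr_suml; apply: ler_sum => j _.
rewrite -scalerAl coefZ normrM ler_wpM2l // mulrC coefMXn.
by case: ifP => _; rewrite ?normr0.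
Qed.

(* At a root rho with |rho| < 1 the truncated product q * P_N differs from 1 by a
   tail that tends to 0. *)
Lemma root_norm_ge1 rho : root q rho -> 1 <= `|rho|.
Proof.
move=> /rootP q0.
have [//|rho1] := real_leP (@real1 _) (normr_real rho).
(* As p + 1 exceeds 1 / (1 - |rho|), the rational r = p / (p + 1) satisfies |rho| < r < 1; [h_bound]
   asks for a rational. *)
pose p := (Num.bound (1 - `|rho|)^-1).+1.
pose r : rat := p%:R / p.+1%:R.
have r0 : 0 < r by rewrite divr_gt0 ?ltr0n.
have r1 : r < 1 by rewrite ltr_pdivrMr ?ltr0n // mul1r ltr_nat.
have [C CP] := h_bound r0 r1.
pose rC : algC := ratr r.
have rC0 : 0 < rC by rewrite ltr0q.
have rhor : `|rho| < rC.
  have pb : (1 - `|rho|)^-1 < p.+1%:R.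
    have b0 : 0 <= (1 - `|rho|)^-1 by rewrite invr_ge0 subr_ge0 ltW.
    by apply: lt_trans (archi_boundP b0) _; rewrite ltr_nat ltnW.
  rewrite /rC /r fmorph_div !rmorph_nat -[p%:R](addrK 1) natr1 mulrBl divff ?pnatr_eq0 // mul1r.
  by rewrite ltrBrDr -ltrBrDl invf_plt // posrE ?subr_gt0 ?ltr0n.
have rC1 : rC < 1 by rewrite -(rmorph1 (ratr : rat -> algC)) ltr_rat.
pose K : algC := \sum_(j < size q) `|q`_j|.
have K0 : 0 <= K by apply: sumr_ge0.
pose CC : algC := ratr `|C|.
have CC0 : 0 <= CC by rewrite ler0q.
have hC n : (h n)%:R <= CC * rC^-1 ^+ n.
  rewrite exprVn ler_pdivlMr ?exprn_gt0 // /rC -(ratr_nat algC) -rmorphXn -rmorphM ler_rat.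
  exact: le_trans (CP n) (ler_norm C).
pose y : algC := `|rho| / rC.
have y0 : 0 <= y by rewrite divr_ge0 // ltW.
have y1 : y < 1 by rewrite ltr_pdivrMr // mul1r.
(* The polynomial q P - 1 has at most [size q] nonzero coefficients, all in degrees >= N, and each
   contributes at most K CC y^N at rho. Its value there is -1, so 1 <= T y^N, which fails for large
   N. *)
pose T : algC := (size q)%:R * (K * CC).
have T0 : 0 <= T by apply: mulr_ge0; [exact: ler0n|exact: mulr_ge0].
have T1 : 0 < 1 + T by rewrite (lt_le_trans ltr01) // lerDl.
have [N0 NP] : exists N, forall n, (N <= n)%N -> y ^+ n < (1 + T)^-1.
  by apply: geometric_small; rewrite ?invr_gt0.
pose N := N0.+1; pose P : {poly algC} := \poly_(i < N) (h i)%:R.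
have PM i : `|P`_i| <= CC * rC^-1 ^+ N.
  rewrite coef_poly; case: ifP => iN; last by rewrite normr0 mulr_ge0 // exprn_ge0 // invr_ge0 ltW.
  rewrite normr_nat (le_trans (hC i)) // ler_wpM2l // ler_weXn2l ?(ltnW iN) //.
  by rewrite invf_ge1 // ltW.
have sz : (size (q * P - 1)%R <= N + size q)%N.
  rewrite (leq_trans (size_polyD _ _)) // geq_max size_polyN size_poly1 addSn ltnS leq0n andbT.
  apply: leq_trans (size_polyMleq _ _) (leq_trans (leq_pred _) _).
  by rewrite addnC -addSn leq_add2r size_poly.
have := horner_coef_wide rho sz; rewrite hornerD hornerM q0 mul0r add0r hornerN hornerC.
rewrite big_split_ord /= big1 ?add0r => [e|i _]; last first.
  by rewrite coefB qh ?coef1 ?subrr ?mul0r //; apply: ltn_ord.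
have : 1 <= T * y ^+ N.
  rewrite -[X in X <= _]normr1 -normrN e (le_trans (ler_norm_sum _ _ _)) //.
  rewrite /T -[_%:R * _ * _]mulrA mulr_natl -[size q in leRHS]card_ord -sumr_const.
  apply: ler_sum => i _; rewrite coefB coef1 /= subr0 normrM normrX.
  apply: (@le_trans _ _ (K * (CC * rC^-1 ^+ N) * `|rho| ^+ N)).
    apply: ler_pM; rewrite ?exprn_ge0 //; first exact: mul_poly_coef_le.
    by rewrite exprD ler_piMr ?exprn_ge0 // exprn_ile1 // ltW.
  by rewrite exprMn [K * (CC * _)]mulrA -!mulrA [rC^-1 ^+ N * _]mulrC.
move=> le1; have : T * y ^+ N < 1.
  apply: le_lt_trans (ler_wpM2l T0 (ltW (NP N (leqnSn _)))) _.
  by rewrite ltr_pdivrMr // mul1r ltrDr ltr01.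
by rewrite (le_gtF le1).
Qed.

Lemma polynomial_growth : exists e B, forall n, (h n <= B * n.+1 ^ e)%N.
Proof.
have q0 : q != 0.
  apply/eqP => q0; have := @qh 1 0 (ltnSn 0); rewrite q0 mul0r coef0 /= => /eqP.
  by rewrite eq_sym oner_eq0.
have [s qE] := closed_field_poly_normal q.
have lq : lead_coef q != 0 by rewrite lead_coef_eq0.
pose B := Num.bound `|(lead_coef q)^-1|.
exists (size s), B => n; rewrite -(ler_nat algC) natrM natrX.
have s1 rho : rho \in s -> 1 <= `|rho|.
  move=> rs; apply: root_norm_ge1; rewrite qE rootZ // root_prod_XsubC //.
have := @coef_bound_prod s (\poly_(i < n.+1) (h i)%:R) n.+1 B%:R (ler0n _ _) s1 _ n (ltnSn n).
rewrite coef_poly ltnSn normr_nat; apply => m mn.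
have := qh mn; rewrite {1}qE -scalerAl coefZ => qm.
have -> : (\prod_(rho <- s) ('X - rho%:P) * \poly_(i < n.+1) (h i)%:R)`_m
    = (lead_coef q)^-1 * (m == 0%N)%:R by rewrite -qm mulKf.
have le : `|(lead_coef q)^-1| <= B%:R by apply/ltW/archi_boundP.
by case: (m == 0%N); rewrite ?mulr1 ?mulr0 ?normr0.
Qed.

End PolynomialGrowth.

Section HilbertGrowth.
Variables (k : fieldType) (A : cgAlg k) (F : minres A) (d : nat).
Hypothesis noethA : left_noetherian A.
Hypothesis rd : mr_rank F d.+1 = 0%N.

(* The Hilbert series of A is 1 / hilb_denom. *)
Definition hilb_denom : {poly algC} :=
  \sum_(i < d.+1) (-1) ^+ i *: \sum_(a < mr_rank F i) 'X^(mr_deg a).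

Lemma hilb_denomP N n : (n < N)%N ->
  (hilb_denom * \poly_(i < N) (hilb F (Posz i))%:R)`_n = (n == 0%N)%:R.
Proof.
move=> nN; transitivity ((\sum_(i < d.+1) (-1) ^+ i * (mr_hilb F i n)%:Z)%:~R : algC).
  rewrite mulr_suml coef_sum rmorph_sum; apply: eq_bigr => i _.
  rewrite -scalerAl coefZ rmorphM rmorphXn rmorphN1; congr (_ * _).
  rewrite mulr_suml coef_sum -[RHS]/((mr_hilb F i n)%:R : algC) natr_sum; apply: eq_bigr => a _.
  rewrite mulrC coefMXn coef_poly; case: ltnP => na.
    have : n%:Z - (mr_deg a)%:Z < 0 by rewrite subr_lt0.
    by case: (_ - _) => // l _; rewrite hilb_neg.
  by rewrite subzn // (leq_ltn_trans (leq_subr _ _)).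
by rewrite hilbert_identity //; case: n nN.
Qed.

Lemma hilb_polynomial : exists e B, forall n : nat, (hilb F n <= B * n.+1 ^ e)%N.
Proof.
apply: (polynomial_growth hilb_denomP).
exact: hilb_subexponential.
Qed.

End HilbertGrowth.

(** * Gelfand-Kirillov dimension *)

Section Filtration.
Variables (k : fieldType) (A : cgAlg k).

(** The finite sets in the definition of the GK dimension need not be homogeneous, so their words
    are controlled by the filtration by degree. *)
Definition filt (D : nat) : set A :=
  [set x | forall i, (D < i)%N -> hcomp (@cg_grading _ A) i x = 0].

Lemma filtS D E x : (D <= E)%N -> filt D x -> filt E x.
Proof. by move=> DE xD i Ei; apply: xD; apply: leq_ltn_trans Ei. Qed.

Lemma filt_homog D i x : cg_homog i x -> (i <= D)%N -> filt D x.
Proof.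
by move=> xi iD j Dj; apply: (hcomp_neq _ xi); rewrite gtn_eqF // (leq_ltn_trans iD).
Qed.

Lemma filt_sum D (I : eqType) (r : seq I) (G : I -> A) :
  (forall i, i \in r -> filt D (G i)) -> filt D (\sum_(i <- r) G i).
Proof.
by move=> GD j Dj; rewrite raddf_sum /= big_seq big1 // => i ir; apply: GD.
Qed.

Lemma filtE D x : filt D x -> x = \sum_(i < D.+1) hcomp (@cg_grading _ A) i x.
Proof.
move=> xD; apply/eqP; rewrite -subr_eq0; apply/eqP.
apply: (hcomp_eq0 (gG := @cg_grading _ A)) => j; rewrite raddfB raddf_sum /=.
under eq_bigr do rewrite (hcompE _ _ (hcomp_homog _ _ _)).
have [jD|Dj] := ltnP j D.+1; last first.
  by rewrite (xD _ Dj) sub0r big1 ?oppr0 // => i _; case: eqP => // <-; apply: xD.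
rewrite (bigD1 (Ordinal jD)) //= eqxx big1 ?addr0 ?subrr // => i ij.
by case: eqP => // e; case/eqP: ij; apply: val_inj.
Qed.

Lemma filt_exists x : exists D, filt D x.
Proof.
have [s [_ _ ->]] := hcomp_sum (@cg_grading _ A) x.
exists (\max_(i <- s) i)%N; apply: filt_sum => i si.
by apply: filt_homog (hcomp_homog _ _ _) _; apply: leq_bigmax_seq.
Qed.

Lemma filt_mul D E x y : filt D x -> filt E y -> filt (D + E) (x * y).
Proof.
move=> xD yE; have [s [_ _ xs]] := hcomp_sum (@cg_grading _ A) x.
have [t [_ _ yt]] := hcomp_sum (@cg_grading _ A) y.
rewrite xs yt mulr_suml; apply: filt_sum => i _; rewrite mulr_sumr; apply: filt_sum => j _.
have zero : filt (D + E) 0 by move=> l _; rewrite raddf0.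
have [iD|Di] := leqP i D; last by rewrite (xD _ Di) mul0r.
have [jE|Ej] := leqP j E; last by rewrite (yE _ Ej) mulr0.
by apply: filt_homog (cg_mul (hcomp_homog _ _ _) (hcomp_homog _ _ _)) _; apply: leq_add.
Qed.

Lemma filt_words D s n w : (forall x, x \in s -> filt D x) -> w \in words s n -> filt (n * D) w.
Proof.
move=> sD; elim: n w => [|n IHn] w /=.
  rewrite inE => /eqP->; apply: (@filt_homog _ 0) => //.
  by apply/cg_conn; exists 1; rewrite scale1r.
rewrite mem_cat mulSn => /orP[/IHn|/allpairsP[[x y] /= [xs ys ->]]].
  exact/filtS/leq_addl.
exact: filt_mul (sD _ xs) (IHn _ ys).
Qed.

Variable F : minres A.

(** The sum map from A_0 x ... x A_D hits every element of degree at most D, so a longer family is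
    linearly dependent. *)
Lemma span_dim_filt D s : (forall x, x \in s -> filt D x) ->
  (span_dim s <= \sum_(i < D.+1) hilb F i)%N.
Proof.
move=> sD; apply/bigmax_leqP => m /asboolP mfree; rewrite leqNgt; apply/negP => lt.
have [f [fl _ fS]] := hasdim_row (fun i : 'I_D.+1 => hilbP F i).
have gl : linear (fun v : 'rV[A]_D.+1 => \sum_i v 0 i : A^o).
  move=> a u v; rewrite scaler_sumr -big_split; apply: eq_bigr => i _.
  by rewrite !mxE.
have [g gE] := linear_exists gl.
have [|c c0 cE] := klinear_dependent (klinear_comp fl g)
    (x := fun i : 'I_(size (mask m s)) => (mask m s)`_i) lt.
  move=> i; have : filt D (mask m s)`_i by apply: sD; apply: mem_mask (mem_nth _ (ltn_ord i)).
  move=> xD; pose v := \row_(j < D.+1) hcomp (@cg_grading _ A) j (mask m s)`_i.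
  have [|u uv] := (fS v).1.
    by move=> j; rewrite mxE; apply: hcomp_homog.
  exists u; rewrite /= uv gE [RHS](filtE xD); apply: eq_bigr => j _.
  by rewrite mxE.
case/eqP: c0; apply/rowP => i; rewrite mxE; apply: (mfree (fun i => c 0 i)).
by rewrite -[RHS]cE; apply: eq_bigr => j _; rewrite -[RHS]scalerAl mul1r.
Qed.

End Filtration.

Section GelfandKirillov.
Variables (R : realType) (k : fieldType) (A : cgAlg k) (F : minres A) (d : nat).
Hypothesis noethA : left_noetherian A.
Hypothesis rd : mr_rank F d.+1 = 0%N.

Lemma GKdim_lt_pinfty : (GKdim A R < +oo)%E.
Proof.
have [e [B hB]] := hilb_polynomial noethA rd.
(* The span has dimension at most C n^(e+1), so the quotient of logarithms is at most e + 1 + ln C /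
   ln n, which is at most e + 2 once n >= C. *)
apply: (@le_lt_trans _ _ (e.+2%:R)%:E); last exact: ltry.
apply: ge_ereal_sup => _ [s _ <-].
have [D sD] : exists D, forall x, x \in s -> filt D x.
  elim: s => [|x s [D IHD]]; first by exists 0%N.
  have [E xE] := filt_exists x; exists (maxn D E) => y; rewrite inE => /orP[/eqP->|ys].
    exact: filtS (leq_maxr _ _) xE.
  exact: filtS (leq_maxl _ _) (IHD _ ys).
(* Summing n D + 1 terms raises the exponent by one, and n D + 1 <= (D + 1) n for n > 0. Taking
   [B.+1] keeps the constant positive for the logarithm. *)
have dim_le n : (0 < n)%N -> (span_dim (words s n) <= (B.+1 * D.+1 ^ e.+1) * n ^ e.+1)%N.
  move=> n0; apply: leq_trans (span_dim_filt F (fun w => filt_words sD)) _.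
  apply: (@leq_trans (\sum_(i < (n * D).+1) B * (n * D).+1 ^ e)).
    apply: leq_sum => i _; apply: leq_trans (hB i) _.
    by apply: leq_mul => //; case: (e) => // e'; rewrite leq_exp2r //; apply: ltn_ord.
  rewrite sum_nat_const card_ord mulnCA -expnS -mulnA -expnMn.
  apply: leq_mul => //; rewrite leq_exp2r //.
  by rewrite mulSn [(D * n)%N]mulnC -add1n leq_add2r.
set C := (B.+1 * _)%N in dim_le.
have C0 : (0 < C)%N by rewrite muln_gt0 expn_gt0.
have [N NP] : exists N, forall n, (N <= n)%N -> ln (C%:R : R) <= ln (n%:R : R).
  by exists C => n Cn; rewrite ler_ln ?posrE ?ltr0n ?ler_nat // (leq_trans C0).
set u := fun n : nat => _.
(* The limsup is at most the supremum over a tail; the summand 2 makes ln n positive on that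
   tail. *)
apply: (@le_trans _ _ (ereal_sup (u @` [set n | (N + 2 <= n)%N]))).
  by apply: ereal_inf_lbound; exists [set n | (N + 2 <= n)%N] => //; exists (N + 2)%N.
apply: ge_ereal_sup => _ [n Nn <-]; rewrite lee_fin.
have n2 : (1 < n)%N by apply: leq_trans Nn; rewrite leq_addl.
have n0 : (0 < n)%N by apply: ltnW.
have lnn : 0 < ln (n%:R : R) by rewrite ln_gt0 // ltr1n.
rewrite ler_pdivrMr //.
apply: (@le_trans _ _ (ln ((C * n ^ e.+1)%N%:R : R))).
  (* [ln] is 0 at 0 by convention, so a zero dimension is treated apart from monotonicity. *)
  have [sd|sd] := posnP (span_dim (words s n)).
    rewrite sd ln0 // ln_ge0 // ler1n muln_gt0 C0 expn_gt0 n0 //.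
  by rewrite ler_ln ?posrE ?ltr0n ?muln_gt0 ?C0 ?expn_gt0 ?n0 // ler_nat dim_le.
rewrite natrM natrX lnM ?posrE ?exprn_gt0 ?ltr0n // lnXn ?ltr0n //.
rewrite -[e.+2]addn1 natrD mulrDl mul1r addrC mulr_natl lerD2l.
by apply: NP; apply: leq_trans Nn; rewrite leq_addr.
Qed.

End GelfandKirillov.

Theorem corollary0p7 (R : realType) (k : fieldType) (A : cgAlg k)
    (d : nat) (l : int) (A_noeth : noetherian A) (A_Gor : AS_Gorenstein A d l)
    (Tor_bound : exists xi : R, forall i : nat,
      (gr_deg R (Tor (triv_mod (opp_alg A)) (triv_mod A) i)
         <= (xi * i%:R + l%:~R - xi * d%:R)%:E)%E) :
  AS_regular R A.
Proof.
have [noethL noethR] := A_noeth.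
have [[_ ExtL ExtLd] [_ ExtR _]] := A_Gor.
have [F] := exists_minres noethL.
have [G] := @exists_minres k (opp_alg A) noethR.
have deg_le (a : 'I_(mr_rank F d)) : (mr_deg a)%:Z <= l.
  have [xi /(_ d) bound] := Tor_bound; have nz := Tor_neq0_min a.
  (* At i = d the two terms in xi cancel, leaving the bound l. *)
  rewrite addrAC subrr add0r in bound; rewrite -(ler_int R) -lee_fin.
  by apply: le_trans bound; apply: ereal_sup_ubound; exists (mr_deg a).
have rG := right_rank0 G ExtL ExtLd ExtR deg_le.
have rF := left_rank0 G ExtL ExtLd ExtR deg_le.
split; first by exists d, l.
split; first exact: finite_gldim_minres rF rG.
exact: GKdim_lt_pinfty noethL rF.
Qed.
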